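(* Let $(M^n,g)$ be a compact, connected, oriented $n$-dimensional Riemannian manifold without boundary, isometrically immersed in $\mathbb{R}^{n+1}$, and let $k>0$ be a constant. If $(M^n,g)$ is almost-Einstein, that is, $\|\mathrm{Ric}-kg\|_\infty\leq\varepsilon$, with $\varepsilon>0$ small enough depending only on $n$, $k$ and $\|B\|_\infty$, then $M$ is diffeomorphic and almost isometric to $\mathbb{S}^n\left(\sqrt{\frac{n-1}{k}}\right)$. Here almost isometric means: for any $\theta\in\,]0,1[$ there exists $\varepsilon_\theta>0$ depending only on $\theta$, $n$, $k$ and $\|B\|_\infty$ such that if $\|\mathrm{Ric}-kg\|_\infty\leq\varepsilon_\theta$, then there is a diffeomorphism $F:M\to\mathbb{S}^n\left(\sqrt{\frac{n-1}{k}}\right)$ with $\big||dF_x(u)|^2-1\big|\leq\theta$ for every $x\in M$ and every unit vector $u\in T_xM$.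
   Context: $\mathbb{R}^{n+1}$ carries its canonical Euclidean metric $\langle\cdot,\cdot\rangle$ and Levi-Civita connection $\overline{\nabla}$; manifolds and immersions are smooth. $\mathrm{Ric}$ is the Ricci tensor of $(M,g)$, and $\|\mathrm{Ric}-kg\|_\infty$ is the sup over $M$ of the pointwise norm of the symmetric bilinear form $\mathrm{Ric}-kg$. With $\nu$ the outward unit normal field, the second fundamental form is $B(Y,Z)=\langle\overline{\nabla}_Y\nu,Z\rangle$, and $\|B\|_\infty$ is the sup over $M$ of its pointwise norm. $\mathbb{S}^n(R)$ is the round sphere of radius $R$ in $\mathbb{R}^{n+1}$ with its induced metric. *)

(* Defs.v *)
From mathcomp Require Import all_boot all_order all_algebra.
From mathcomp Require Import all_classical all_reals all_analysis.
Import Order.TTheory GRing.Theory Num.Theory.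
Import numFieldNormedType.Exports.

Set Implicit Arguments.
Unset Strict Implicit.
Unset Printing Implicit Defensive.

Local Open Scope classical_set_scope.
Local Open Scope ring_scope.

(* Vectors are row vectors, so the Jacobian J of f acts by
   u |-> u *m J and its i-th row is the i-th partial derivative of f.  The norm
   `|u| of the library on 'rV is the sup norm; the Euclidean one is always
   written through dot. *)

Definition dot (R : realType) (m : nat) (u v : 'rV[R]_m) : R :=
  (u *m v^T) 0 0.

Definition partial (R : realType) (n : nat) (V : normedModType R) (i : 'I_n)
    (f : 'rV[R]_n -> V) : 'rV[R]_n -> V :=
  fun x => 'D_(delta_mx 0 i) f x.

(* C^oo on the open set U: every iterated partial derivative is Frechet
   differentiable on U.  Values of f outside U are irrelevant. *)
Definition smooth_on (R : realType) (n : nat) (V : normedModType R)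
    (U : set 'rV[R]_n) (f : 'rV[R]_n -> V) : Prop :=
  forall (s : seq 'I_n) (x : 'rV[R]_n), U x ->
    differentiable (foldr (@partial R n V) f s) x.

(* A homeomorphism of an open subset of M onto an open subset of R^n;
   chart_param is its inverse, with junk values outside the image. *)
Record chart (R : realType) (n : nat) (M : topologicalType) : Type := Chart {
  chart_dom : set M;
  chart_coord : M -> 'rV[R]_n;
  chart_param : 'rV[R]_n -> M;
  chart_dom_open : open chart_dom;
  chart_img_open : open (chart_coord @` chart_dom);
  chart_coordK : forall x, chart_dom x -> chart_param (chart_coord x) = x;
  chart_coord_continuous : {within chart_dom, continuous chart_coord};
  chart_param_continuous :
    {within chart_coord @` chart_dom, continuous chart_param}
}.

Definition chart_img (R : realType) (n : nat) (M : topologicalType)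
    (c : chart R n M) : set 'rV[R]_n :=
  chart_coord c @` chart_dom c.

Definition transition (R : realType) (n : nat) (M : topologicalType)
    (c d : chart R n M) : 'rV[R]_n -> 'rV[R]_n :=
  chart_coord d \o chart_param c.

(* Smooth n-manifold without boundary, presented by a smooth atlas
   (not necessarily maximal). *)
Record manifold (R : realType) (n : nat) : Type := Manifold {
  space :> topologicalType;
  space_hausdorff : hausdorff_space space;
  space_second_countable : @second_countable space;
  atlas : Type;
  chart_of : atlas -> chart R n space;
  atlas_cover : forall x : space, exists a, chart_dom (chart_of a) x;
  atlas_smooth : forall a b,
    smooth_on (chart_coord (chart_of a) @`
                 (chart_dom (chart_of a) `&` chart_dom (chart_of b)))
      (transition (chart_of a) (chart_of b))
}.

(* A manifold is oriented by giving an atlas whose transition maps preserve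
   the orientation of R^n. *)
Definition oriented (R : realType) (n : nat) (M : manifold R n) : Prop :=
  forall (a b : atlas M) (x : M),
    chart_dom (chart_of a) x -> chart_dom (chart_of b) x ->
    0 < \det (jacobian (transition (chart_of a) (chart_of b))
                       (chart_coord (chart_of a) x)).

Definition local_expr (R : realType) (n m : nat) (M : manifold R n)
    (f : M -> 'rV[R]_m) (a : atlas M) : 'rV[R]_n -> 'rV[R]_m :=
  f \o chart_param (chart_of a).

Definition smooth_map (R : realType) (n m : nat) (M : manifold R n)
    (f : M -> 'rV[R]_m) : Prop :=
  forall a : atlas M, smooth_on (chart_img (chart_of a)) (local_expr f a).

(* The matrix, in the chart a, of the differential of f at the point of
   coordinates p. *)
Definition diff_mx (R : realType) (n m : nat) (M : manifold R n)
    (f : M -> 'rV[R]_m) (a : atlas M) (p : 'rV[R]_n) : 'M[R]_(n, m) :=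
  jacobian (local_expr f a) p.

(* gram a p is the matrix (g_ij) in the chart a at the point of coordinates p *)
Record riem_metric (R : realType) (n : nat) (M : manifold R n) : Type :=
  RiemMetric {
  gram :> atlas M -> 'rV[R]_n -> 'M[R]_n;
  gram_smooth : forall a, smooth_on (chart_img (chart_of a)) (gram a);
  gram_sym : forall a p, chart_img (chart_of a) p -> (gram a p)^T = gram a p;
  gram_posdef : forall a p, chart_img (chart_of a) p ->
    forall u : 'rV[R]_n, u != 0 -> 0 < dot (u *m gram a p) u;
  gram_compat : forall a b (x : M),
    chart_dom (chart_of a) x -> chart_dom (chart_of b) x ->
    let J := jacobian (transition (chart_of a) (chart_of b))
                      (chart_coord (chart_of a) x) in
    gram a (chart_coord (chart_of a) x) =
      J *m gram b (chart_coord (chart_of b) x) *m J^T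
}.

(* Christoffel symbol Gamma^l_ij of the Levi-Civita connection of the metric
   with coordinate matrix G. *)
Definition christoffel (R : realType) (n : nat) (G : 'rV[R]_n -> 'M[R]_n)
    (l i j : 'I_n) (p : 'rV[R]_n) : R :=
  2^-1 * \sum_(m < n) invmx (G p) l m *
    (partial i (fun q => G q j m) p + partial j (fun q => G q i m) p
     - partial m (fun q => G q i j) p).

(* Coefficient on d_l of R(d_i, d_j) d_k, with
   R(X, Y) Z = D_X D_Y Z - D_Y D_X Z - D_[X,Y] Z. *)
Definition riemann (R : realType) (n : nat) (G : 'rV[R]_n -> 'M[R]_n)
    (l i j k : 'I_n) (p : 'rV[R]_n) : R :=
  partial i (christoffel G l j k) p - partial j (christoffel G l i k) p
  + \sum_(m < n) (christoffel G m j k p * christoffel G l i m p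
                  - christoffel G m i k p * christoffel G l j m p).

(* Ric(Y, Z) is the trace of W |-> R(W, Y) Z; it is positive on spheres. *)
Definition ricci (R : realType) (n : nat) (G : 'rV[R]_n -> 'M[R]_n)
    (p : 'rV[R]_n) : 'M[R]_n :=
  \matrix_(j < n, k < n) \sum_(i < n) riemann G i i j k p.

(* Tensor norm of a bilinear form T with respect to the inner product G:
   |T|^2 = G^{ik} G^{jl} T_ij T_kl. *)
Definition form_norm (R : realType) (n : nat) (G T : 'M[R]_n) : R :=
  Num.sqrt (\tr (invmx G *m T *m invmx G *m T^T)).

(* Supremum over M of the pointwise norm of a tensor T given by its components
   in the charts; the norm at a point does not depend on the chart, so letting
   the chart vary as well does not change the supremum. *)
Definition sup_norm (R : realType) (n : nat) (M : manifold R n)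
    (g : riem_metric M) (T : atlas M -> 'rV[R]_n -> 'M[R]_n) : \bar R :=
  ereal_sup [set r | exists (a : atlas M) (p : 'rV[R]_n),
    chart_img (chart_of a) p /\ r = (form_norm (g a p) (T a p))%:E].

Definition einstein_defect (R : realType) (n : nat) (M : manifold R n)
    (g : riem_metric M) (k : R) : \bar R :=
  sup_norm g (fun a p => ricci (g a) p - k *: g a p).

Definition isometric_immersion (R : realType) (n m : nat) (M : manifold R n)
    (g : riem_metric M) (X : M -> 'rV[R]_m) : Prop :=
  smooth_map X /\
  forall (a : atlas M) (p : 'rV[R]_n), chart_img (chart_of a) p ->
    row_free (diff_mx X a p) /\ g a p = diff_mx X a p *m (diff_mx X a p)^T.

Definition unit_normal (R : realType) (n : nat) (M : manifold R n)
    (X nu : M -> 'rV[R]_n.+1) : Prop :=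
  [/\ smooth_map nu,
      (forall x : M, dot (nu x) (nu x) = 1) &
      (forall (a : atlas M) (p : 'rV[R]_n), chart_img (chart_of a) p ->
         diff_mx X a p *m (local_expr nu a p)^T = 0)].

(* B(d_i, d_j) = <d_i nu, d_j X>: the connection of R^(n+1) is the flat one. *)
Definition second_form (R : realType) (n : nat) (M : manifold R n)
    (X nu : M -> 'rV[R]_n.+1) (a : atlas M) (p : 'rV[R]_n) : 'M[R]_n :=
  diff_mx nu a p *m (diff_mx X a p)^T.

Definition sphere (R : realType) (n : nat) (r : R) : set 'rV[R]_n.+1 :=
  [set y | dot y y = r ^+ 2].

(* Diffeomorphism of M onto a subset S of R^m with the smooth structure induced
   by R^m: a map into S is smooth when it is smooth into R^m, and a map defined
   on S is smooth when it locally extends to a smooth map on an open subset of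
   R^m. *)
Definition diffeo_onto (R : realType) (n m : nat) (M : manifold R n)
    (S : set 'rV[R]_m) (F : M -> 'rV[R]_m) : Prop :=
  [/\ smooth_map F,
      (forall x : M, S (F x)) &
      exists G : 'rV[R]_m -> M,
        [/\ (forall x : M, G (F x) = x),
            (forall y, S y -> F (G y) = y) &
            (forall y, S y ->
               exists (a : atlas M) (W : set 'rV[R]_m)
                      (h : 'rV[R]_m -> 'rV[R]_n),
                 [/\ open W, W y, smooth_on W h &
                     forall z, W z -> S z ->
                       chart_dom (chart_of a) (G z) /\
                       h z = chart_coord (chart_of a) (G z)])]].

(* | |dF_x(u)|^2 - 1 | <= theta for all x and all g-unit tangent vectors u,
   where |.| on the target is the metric induced by R^m. *)
Definition almost_isometry (R : realType) (n m : nat) (M : manifold R n)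
    (g : riem_metric M) (theta : R) (F : M -> 'rV[R]_m) : Prop :=
  forall (a : atlas M) (p u : 'rV[R]_n), chart_img (chart_of a) p ->
    dot (u *m g a p) u = 1 ->
    `| dot (u *m diff_mx F a p) (u *m diff_mx F a p) - 1 | <= theta.

(* Compact connected oriented manifold isometrically immersed by X in R^(n+1),
   with unit normal field nu.  For an immersed hypersurface the two choices of
   nu differ by a sign, which does not affect the norm of second_form.
   The library counts the empty set as connected, so nonemptiness is explicit. *)
Definition closed_hypersurface (R : realType) (n : nat) (M : manifold R n)
    (g : riem_metric M) (X nu : M -> 'rV[R]_n.+1) : Prop :=
  [/\ compact [set: M], (connected [set: M] /\ [set: M] !=set0), oriented M,
      isometric_immersion g X & unit_normal X nu].

(* Main.v *)
(* The Gauss equation diagonalizes Ric in a principal frame: its eigenvalues are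
   H x_i - x_i^2, where x_i are the principal curvatures and H is their sum.

   For n = 1 this vanishes, so the defect is k and cannot be small.  For n >= 3,
   subtracting the equations for two indices shows that the x_i are almost equal,
   so that x_i^2 is close to k / (n - 1) and F = r nu, r^2 = (n - 1) / k, is almost
   isometric.  It is then an immersion of a closed manifold into a sphere, hence a
   diffeomorphism: local sections of uniform size are transported along arcs,
   which gives a retraction of M, less the fibre over the antipode, onto each
   fibre.

   For n = 2 only the Gauss curvature is pinched.  The Gauss map nu is an immersion,
   hence a diffeomorphism onto the unit sphere, and X = U o nu, where dU is the
   inverse of the shape operator: a symmetric endomorphism of the tangent planes
   with determinant close to r^2 = 1 / k and trace of constant sign, positive up
   to replacing U by -U.  Minkowski's formulas, proved by Green's theorem in
   spherical coordinates, bound the L^1 norm of tr(dU) / 2 - sqrt(det(dU)), hence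
   the L^2 norm of d(U - r id).  Therefore U - r id varies little along almost
   all parallels and, being Lipschitz along meridians, it varies little between
   any two points at distance pi / 2.  So X is close to a translate c + r nu of
   the sphere (up to sign), and F is the radial projection of X - c. *)

Require Import Defs.
From mathcomp Require Import all_boot all_order all_algebra.
From mathcomp Require Import all_classical all_reals all_analysis.
From mathcomp Require Import ring lra.
Import Order.TTheory GRing.Theory Num.Theory.
Import numFieldNormedType.Exports.
Local Open Scope classical_set_scope.
Local Open Scope ring_scope.
Set Implicit Arguments.
Unset Strict Implicit.
Unset Printing Implicit Defensive.

(** * Iterated partial derivatives *)

(** The two cases differ in the control available. With three or more principal curvatures the
    pinching is pointwise and makes the Gauss map itself almost isometric. With two, only their
    product is pinched; dU is then controlled in L^2, and this gives no pointwise bound on d nu. The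
    way out is that uniform closeness of X to a sphere already carries first-order information: a
    tangent vector w is orthogonal to nu, so <X - c, w> is, up to sign, the pairing of w with the
    small vector s (X - c) - r nu, s = 1 or -1. Hence w is almost orthogonal to the radius and the
    radial projection almost preserves its length.

    The number b enters only as a bound on the principal curvatures. In dimension at least three it
    bounds H, which keeps every x_i away from 0; for surfaces it bounds the sum of the principal
    radii, hence the Lipschitz constant of U. All constants are chosen before M, which is what the
    uniformity in the statement asks for.

    An almost isometry with theta < 1 has no kernel, so one covering argument serves both cases. *)

Lemma partialE (R : realType) (n : nat) (V : normedModType R) (i : 'I_n)
    (f : 'rV[R]_n -> V) (x : 'rV[R]_n) :
  differentiable f x -> partial i f x = 'd f x (delta_mx 0 i).
Proof. by move=> df; rewrite /partial deriveE. Qed.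

Lemma diff_partial (R : realType) (n : nat) (V : normedModType R)
    (f : 'rV[R]_n -> V) (x v : 'rV[R]_n) :
  differentiable f x -> 'd f x v = \sum_i v 0 i *: partial i f x.
Proof.
move=> df; rewrite [in LHS](row_sum_delta v) linear_sum; apply: eq_bigr => i _.
by rewrite linearZ partialE.
Qed.

Lemma row_jacobian (R : realType) (n m : nat) (f : 'rV[R]_n -> 'rV[R]_m)
    (x : 'rV[R]_n) (i : 'I_n) :
  differentiable f x -> row i (jacobian f x) = partial i f x.
Proof. by move=> df; rewrite rowE mul_rV_lin1 partialE. Qed.

Lemma partial_near_eq (R : realType) (n : nat) (V : normedModType R) (i : 'I_n)
    (f g : 'rV[R]_n -> V) (x : 'rV[R]_n) :
  (\forall y \near x, f y = g y) -> partial i f x = partial i g x.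
Proof. exact: near_eq_derive. Qed.

Lemma differentiable_near_eq (R : realType) (V W : normedModType R)
    (f g : V -> W) (x : V) :
  (\forall y \near x, f y = g y) -> differentiable f x -> differentiable g x.
Proof.
move=> fg df; have fgx : f x = g x by exact: nbhs_singleton fg.
have gE : g \o shift x = cst (g x) + 'd f x +o_ 0 id.
  have fg0 : \forall y \near 0, (f \o shift x) y = (g \o shift x) y.
    by move: fg; rewrite (near_shift 0 x) subr0.
  have /diff_locally dfl := df.
  apply/eqaddoP => _/posnumP[e].
  have /eqaddoP/(_ e%:num (gt0 e)) H := dfl.
  apply: filterS (filterI fg0 H) => y [E].
  have -> : (g \o shift x - (cst (g x) + 'd f x)) y = (g \o shift x) y - (g x + 'd f x y) by [].
  have -> : (f \o shift x - (cst (f x) + 'd f x)) y = (f \o shift x) y - (f x + 'd f x y) by [].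
  by rewrite E fgx.
have dg := diff_unique (diff_continuous df) gE.
by apply/diff_locallyP; rewrite dg; split=> //; exact: diff_continuous.
Qed.

Lemma differentiable_mxP (R : realType) (V : normedModType R) (m n : nat)
    (f : V -> 'M[R]_(m, n)) (x : V) :
  differentiable f x <-> forall i j, differentiable (fun y => f y i j) x.
Proof.
split=> [df i j|df].
  apply: (@differentiable_comp _ _ _ _ f (fun N : 'M[R]_(m, n) => N i j)) => //.
  exact: differentiable_coord.
have -> : f = \sum_i \sum_j (fun y => f y i j *: (delta_mx i j : 'M[R]_(m, n))).
  apply/funext => y; rewrite [LHS]matrix_sum_delta fct_sumE.
  by apply: eq_bigr => i _; rewrite fct_sumE.
apply: differentiable_sum => i; apply: differentiable_sum => j.
exact/differentiableZl/df.
Qed.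

Lemma partial_mxE (R : realType) (n p q : nat) (k : 'I_n)
    (f : 'rV[R]_n -> 'M[R]_(p, q)) (x : 'rV[R]_n) i j :
  differentiable f x ->
  partial k f x i j = partial k (fun y => f y i j) x.
Proof.
by move=> df; rewrite /partial derive_mx ?mxE//; exact: diff_derivable.
Qed.

(* The partials of order at most k are Frechet differentiable, so Ck k lies
   between C^k and C^(k+1). *)
Fixpoint Ck (R : realType) (n : nat) (V : normedModType R) (k : nat)
    (U : set 'rV[R]_n) (f : 'rV[R]_n -> V) : Prop :=
  (forall x, U x -> differentiable f x) /\
  (if k is k'.+1 then forall i, Ck k' U (partial i f) else True).

Lemma Ck_diff (R : realType) (n : nat) (V : normedModType R) k
    (U : set 'rV[R]_n) (f : 'rV[R]_n -> V) :
  Ck k U f -> forall x, U x -> differentiable f x.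
Proof. by case: k => [|k] []. Qed.

(** [foldr] peels off the outermost derivative and [Ck] the innermost one, hence the inductions on
    the end of the list. With [Ck], closure properties are proved by induction on the order. *)
Lemma smooth_onP (R : realType) (n : nat) (V : normedModType R)
    (U : set 'rV[R]_n) (f : 'rV[R]_n -> V) :
  smooth_on U f <-> forall k, Ck k U f.
Proof.
split=> [sf k|cf s].
  elim: k f sf => [|k IH] f sf; split=> //; do ?exact: (sf [::]).
  by move=> i; apply: IH => s x Ux; have := sf (rcons s i) x Ux; rewrite foldr_rcons.
elim/last_ind: s f cf => [|s i IH] f cf x Ux; first exact: (Ck_diff (cf 0%N)).
by rewrite foldr_rcons; apply: IH => // k; have [_] := cf k.+1; apply.
Qed.

Lemma smooth_on_diff (R : realType) (n : nat) (V : normedModType R)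
    (U : set 'rV[R]_n) (f : 'rV[R]_n -> V) x :
  smooth_on U f -> U x -> differentiable f x.
Proof. by move=> sf; exact: (sf [::]). Qed.

Lemma smooth_on_partial (R : realType) (n : nat) (V : normedModType R)
    (U : set 'rV[R]_n) (f : 'rV[R]_n -> V) i :
  smooth_on U f -> smooth_on U (partial i f).
Proof. by move=> sf s x Ux; have := sf (rcons s i) x Ux; rewrite foldr_rcons. Qed.

Arguments smooth_on_partial {R n V U f} i _.

Lemma smooth_on_partial_diff (R : realType) (n : nat) (V : normedModType R)
    (U : set 'rV[R]_n) (f : 'rV[R]_n -> V) i x :
  smooth_on U f -> U x -> differentiable (partial i f) x.
Proof. by move=> sf Ux; exact: (smooth_on_diff (smooth_on_partial i sf) Ux). Qed.

(** A derivative depends only on the germ, so on an open set functions may be exchanged for equal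
    ones. Every closure property below uses this, since the formulas for derivatives hold only on
    [U]. *)
Lemma Ck_ext (R : realType) (n : nat) (V : normedModType R) k
    (U : set 'rV[R]_n) (f g : 'rV[R]_n -> V) :
  open U -> (forall x, U x -> f x = g x) -> Ck k U f -> Ck k U g.
Proof.
move=> oU; have nr (h h' : 'rV[R]_n -> V) x : (forall x, U x -> h x = h' x) ->
    U x -> \forall y \near x, h y = h' y.
  move=> hh Ux; have : nbhs x U by exact: open_nbhs_nbhs.
  by apply: filterS => y; exact: hh.
elim: k f g => [|k IH] f g fg [df cf]; split=> //.
- by move=> x Ux; apply: differentiable_near_eq (df x Ux); exact: nr.
- by move=> x Ux; apply: differentiable_near_eq (df x Ux); exact: nr.
move=> i; apply: IH (cf i) => x Ux; apply: partial_near_eq; exact: nr.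
Qed.

Lemma smooth_on_ext (R : realType) (n : nat) (V : normedModType R)
    (U : set 'rV[R]_n) (f g : 'rV[R]_n -> V) :
  open U -> (forall x, U x -> f x = g x) -> smooth_on U f -> smooth_on U g.
Proof.
by move=> oU fg /smooth_onP cf; apply/smooth_onP => k; exact: Ck_ext (cf k).
Qed.

Lemma smooth_onW (R : realType) (n : nat) (V : normedModType R)
    (U U' : set 'rV[R]_n) (f : 'rV[R]_n -> V) :
  U' `<=` U -> smooth_on U f -> smooth_on U' f.
Proof. by move=> UU sf s x /UU; exact: sf. Qed.

Lemma CkW (R : realType) (n : nat) (V : normedModType R) k
    (U : set 'rV[R]_n) (f : 'rV[R]_n -> V) :
  Ck k.+1 U f -> Ck k U f.
Proof.
elim: k f => [|k IH] f [df cf]; split=> // i; apply: IH; exact: cf.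
Qed.

(** * Closure properties of differentiable functions of finite order *)

Lemma partialD (R : realType) (n : nat) (V : normedModType R) i
    (f g : 'rV[R]_n -> V) x :
  differentiable f x -> differentiable g x ->
  partial i (fun y => f y + g y) x = partial i f x + partial i g x.
Proof. by move=> df dg; rewrite /partial deriveD//; exact: diff_derivable. Qed.

Lemma partialB (R : realType) (n : nat) (V : normedModType R) i
    (f g : 'rV[R]_n -> V) x :
  differentiable f x -> differentiable g x ->
  partial i (fun y => f y - g y) x = partial i f x - partial i g x.
Proof. by move=> df dg; rewrite /partial deriveB//; exact: diff_derivable. Qed.

Lemma partialM (R : realType) (n : nat) i (f g : 'rV[R]_n -> R) x :
  differentiable f x -> differentiable g x ->
  partial i (fun y => f y * g y) x = partial i f x * g x + f x * partial i g x.
Proof.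
move=> df dg; rewrite /partial deriveM; try exact: diff_derivable.
by rewrite addrC; congr (_ + _); exact: mulrC.
Qed.

Lemma partial_cst (R : realType) (n : nat) (V : normedModType R) i (c : V)
    (x : 'rV[R]_n) : partial i (fun=> c) x = 0.
Proof. exact: derive_cst. Qed.

Lemma partial_sum (R : realType) (n : nat) (V : normedModType R) i m
    (f : 'I_m -> 'rV[R]_n -> V) x :
  (forall j, differentiable (f j) x) ->
  partial i (fun y => \sum_j f j y) x = \sum_j partial i (f j) x.
Proof.
move=> df; rewrite /partial -derive_sum; last by move=> j; exact: diff_derivable.
by congr (derive _ _ _); apply/funext => y; rewrite fct_sumE.
Qed.

Lemma differentiable_bigsum (R : realType) (V W : normedModType R) m
    (f : 'I_m -> V -> W) x :
  (forall j, differentiable (f j) x) ->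
  differentiable (fun y => \sum_j f j y) x.
Proof.
move=> df; have -> : (fun y => \sum_j f j y) = \sum_j f j.
  by apply/funext => y; rewrite fct_sumE.
exact: differentiable_sum.
Qed.

Lemma Ck_cst (R : realType) (n : nat) (V : normedModType R) k
    (U : set 'rV[R]_n) (c : V) : Ck k U (fun=> c : V).
Proof.
elim: k c => [|k IH] c; (split; first by move=> x _; exact: differentiable_cst) => //.
move=> i; have -> : partial i (fun _ : 'rV[R]_n => c) = fun=> 0.
  by apply/funext => x; exact: partial_cst.
exact: IH.
Qed.

Lemma CkD (R : realType) (n : nat) (V : normedModType R) k
    (U : set 'rV[R]_n) (f g : 'rV[R]_n -> V) :
  open U -> Ck k U f -> Ck k U g -> Ck k U (fun x => f x + g x).
Proof.
move=> oU; elim: k f g => [|k IH] f g [df cf] [dg cg].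
  by split=> // x Ux; apply: differentiableD; [exact: df|exact: dg].
split=> [x Ux|i]; first by apply: differentiableD; [exact: df|exact: dg].
apply: Ck_ext (IH _ _ (cf i) (cg i)) => // x Ux.
by rewrite partialD//; [exact: df|exact: dg].
Qed.

Lemma CkM (R : realType) (n : nat) k (U : set 'rV[R]_n) (f g : 'rV[R]_n -> R) :
  open U -> Ck k U f -> Ck k U g -> Ck k U (fun x => f x * g x).
Proof.
move=> oU; elim: k f g => [|k IH] f g cf cg.
  by split=> // x Ux; apply: differentiableM; [exact: (Ck_diff cf)|exact: (Ck_diff cg)].
split=> [x Ux|i].
  by apply: differentiableM; [exact: (Ck_diff cf)|exact: (Ck_diff cg)].
apply: (@Ck_ext _ _ _ _ _ (fun x => partial i f x * g x + f x * partial i g x)) => //.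
  by move=> x Ux; rewrite partialM//; [exact: (Ck_diff cf)|exact: (Ck_diff cg)].
by apply: CkD => //; apply: IH; do ?exact: CkW; [have [_] := cf|have [_] := cg]; apply.
Qed.

Lemma Ck_sum (R : realType) (n : nat) (V : normedModType R) k
    (U : set 'rV[R]_n) (I : Type) (r : seq I) (P : pred I) (f : I -> 'rV[R]_n -> V) :
  open U -> (forall j, P j -> Ck k U (f j)) -> Ck k U (fun x => \sum_(j <- r | P j) f j x).
Proof.
move=> oU cf; elim: r => [|a r IH].
  by under eq_fun do rewrite big_nil; exact: Ck_cst.
under eq_fun do rewrite big_cons.
by case Pa: (P a) => //; apply: CkD => //; exact: cf.
Qed.

Lemma Ck_prod (R : realType) (n : nat) k
    (U : set 'rV[R]_n) (I : Type) (r : seq I) (P : pred I) (f : I -> 'rV[R]_n -> R) :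
  open U -> (forall j, P j -> Ck k U (f j)) -> Ck k U (fun x => \prod_(j <- r | P j) f j x).
Proof.
move=> oU cf; elim: r => [|a r IH].
  by under eq_fun do rewrite big_nil; exact: Ck_cst.
under eq_fun do rewrite big_cons.
by case Pa: (P a) => //; apply: CkM => //; exact: cf.
Qed.

Lemma partial_coord (R : realType) (n : nat) (l j : 'I_n) (i : 'I_1) (x : 'rV[R]_n) :
  partial l (fun x : 'rV[R]_n => x i j) x = (delta_mx 0 l : 'rV[R]_n) i j.
Proof.
have := @partial_mxE R n 1 n l id x i j _ => <-; last by apply: ex_diff.
by rewrite /partial derive_id.
Qed.

Lemma Ck_coord (R : realType) (n : nat) k (U : set 'rV[R]_n) (i : 'I_1) (j : 'I_n) :
  Ck k U (fun x : 'rV[R]_n => x i j).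
Proof.
have dc x : differentiable (fun x : 'rV[R]_n => x i j) x.
  exact: differentiable_coord.
case: k => [|k]; (split=> [x _|]; first exact: dc) => // l.
have -> : partial l (fun x : 'rV[R]_n => x i j) = fun=> (delta_mx 0 l : 'rV[R]_n) i j.
  by apply/funext => x; exact: partial_coord.
exact: Ck_cst.
Qed.

Lemma sum_partial_coord (R : realType) (n : nat) (w x : 'rV[R]_n) (j : 'I_n) :
  \sum_i w 0 i * partial i (fun x : 'rV[R]_n => x 0 j) x = w 0 j.
Proof.
rewrite [in RHS](row_sum_delta w) summxE; apply: eq_bigr => i _.
by rewrite partial_coord [RHS]mxE.
Qed.

Lemma Ck_mxP (R : realType) (n p q : nat) k (U : set 'rV[R]_n)
    (f : 'rV[R]_n -> 'M[R]_(p, q)) : open U ->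
  Ck k U f <-> forall i j, Ck k U (fun x => f x i j).
Proof.
move=> oU; elim: k f => [|k IH] f; split.
- by case=> df _ i j; split=> // x Ux; exact: ((differentiable_mxP _ _).1 (df x Ux)).
- move=> cf; split=> // x Ux; apply/differentiable_mxP => i j.
  exact: (Ck_diff (cf i j)).
- case=> df cf i j; split=> [x Ux|l].
    exact: ((differentiable_mxP _ _).1 (df x Ux)).
  apply: Ck_ext (((IH _).1 (cf l)) i j) => // x Ux.
  by rewrite partial_mxE//; exact: df.
move=> cf; have df x : U x -> differentiable f x.
  by move=> Ux; apply/differentiable_mxP => i j; exact: (Ck_diff (cf i j)).
split=> // l; apply/IH => i j; have [_ /(_ l)] := cf i j.
by apply: Ck_ext => // x Ux; rewrite partial_mxE//; exact: df.
Qed.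

Lemma smooth_on_mxP (R : realType) (n p q : nat) (U : set 'rV[R]_n)
    (f : 'rV[R]_n -> 'M[R]_(p, q)) : open U ->
  smooth_on U f <-> forall i j, smooth_on U (fun x => f x i j).
Proof.
move=> oU; split=> [/smooth_onP cf i j|cf].
  by apply/smooth_onP => k; exact: (Ck_mxP _ _ oU).1.
apply/smooth_onP => k; apply/(Ck_mxP _ _ oU) => i j.
exact: (smooth_onP _ _).1 (cf i j) k.
Qed.

Lemma differentiable_compose (R : realType) (n m : nat) (V : normedModType R)
  (f : 'rV[R]_m -> V) (g : 'rV[R]_n -> 'rV[R]_m) x :
  differentiable g x -> differentiable f (g x) ->
  differentiable (fun y => f (g y)) x.
Proof. by move=> dg df; exact: (@differentiable_comp _ _ _ _ g f). Qed.

Lemma partial_comp (R : realType) (n m : nat) (V : normedModType R)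
  (f : 'rV[R]_m -> V) (g : 'rV[R]_n -> 'rV[R]_m) i x :
  differentiable g x -> differentiable f (g x) ->
  partial i (fun y => f (g y)) x =
  \sum_j partial i (fun y => g y 0 j) x *: partial j f (g x).
Proof.
move=> dg df; rewrite partialE; last exact: differentiable_compose.
have -> : 'd (fun y => f (g y)) x = 'd f (g x) \o 'd g x :> (_ -> _).
  exact: (@diff_comp _ _ _ _ g f).
rewrite /= -partialE// diff_partial//.
by apply: eq_bigr => j _; rewrite partial_mxE.
Qed.

Lemma jacobian_comp (R : realType) (n m p : nat)
  (f : 'rV[R]_m -> 'rV[R]_p) (g : 'rV[R]_n -> 'rV[R]_m) x :
  differentiable g x -> differentiable f (g x) ->
  jacobian (fun y => f (g y)) x = jacobian g x *m jacobian f (g x).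
Proof.
move=> dg df; apply/row_matrixP => i; rewrite row_mul !row_jacobian//; last first.
  exact: differentiable_compose.
rewrite (@partial_comp _ _ _ _ f g)// mulmx_sum_row; apply: eq_bigr => j _.
by rewrite row_jacobian// partial_mxE.
Qed.

Lemma Ck_comp (R : realType) (n m : nat) k (U : set 'rV[R]_n) (W : set 'rV[R]_m)
    (f : 'rV[R]_m -> R) (g : 'rV[R]_n -> 'rV[R]_m) :
  open U -> (forall x, U x -> W (g x)) -> Ck k W f -> Ck k U g ->
  Ck k U (fun x => f (g x)).
Proof.
move=> oU UW; elim: k f => [|k IH] f cf cg.
  split=> // x Ux; apply: differentiable_compose; first exact: (Ck_diff cg).
  by apply: (Ck_diff cf); exact: UW.
split=> [x Ux|i].
  apply: differentiable_compose; first exact: (Ck_diff cg).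
  by apply: (Ck_diff cf); exact: UW.
apply: (@Ck_ext _ _ _ _ _ (fun x => \sum_j partial i (fun y => g y 0 j) x * partial j f (g x))) => //.
  move=> x Ux; rewrite partial_comp//; first exact: (Ck_diff cg).
  by apply: (Ck_diff cf); exact: UW.
apply: Ck_sum => // j _; apply: CkM => //.
  by have [_] := (Ck_mxP _ _ oU).1 cg 0 j; apply.
by apply: IH; [have [_] := cf; apply|exact: CkW].
Qed.

Lemma smooth_on_comp (R : realType) (n m p q : nat) (U : set 'rV[R]_n) (W : set 'rV[R]_m)
    (f : 'rV[R]_m -> 'M[R]_(p, q)) (g : 'rV[R]_n -> 'rV[R]_m) :
  open U -> open W -> (forall x, U x -> W (g x)) -> smooth_on W f -> smooth_on U g ->
  smooth_on U (fun x => f (g x)).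
Proof.
move=> oU oW UW /smooth_onP cf /smooth_onP cg; apply/smooth_onP => k.
apply/(Ck_mxP _ _ oU) => i j; apply: (@Ck_comp _ _ _ _ _ W (fun y => f y i j)) => //.
exact: (Ck_mxP _ _ oW).1.
Qed.

Lemma partial_id (R : realType) (n : nat) (i : 'I_n) (x : 'rV[R]_n) :
  partial i (fun x => x) x = delta_mx 0 i.
Proof. exact: derive_id. Qed.

(** * Estimates in the sup norm and differentiability in epsilon form *)

Lemma le_mx_norm (R : realType) (m n : nat) (M : 'M[R]_(m, n)) i j :
  `|M i j| <= `|M|.
Proof.
by rewrite [leRHS]/Num.Def.normr/= mx_normrE; exact: (le_bigmax _ _ (i, j)).
Qed.

Lemma mx_norm_le (R : realType) (m n : nat) (M : 'M[R]_(m, n)) (c : R) :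
  0 <= c -> (forall i j, `|M i j| <= c) -> `|M| <= c.
Proof.
move=> c0 H; rewrite [leLHS]/Num.Def.normr/= mx_normrE.
by apply: bigmax_le => // -[i j] _; exact: H.
Qed.

Lemma mulmx_norm_le (R : realType) (p n m : nat) (v : 'M[R]_(p, n)) (A : 'M[R]_(n, m)) :
  `|v *m A| <= (n%:R * `|A|) * `|v|.
Proof.
apply: mx_norm_le => [|i j]; first by rewrite !mulr_ge0.
rewrite mxE (le_trans (ler_norm_sum _ _ _))//.
apply: (@le_trans _ _ (\sum_(k < n) `|A| * `|v|)).
  apply: ler_sum => k _; rewrite normrM mulrC.
  by apply: ler_pM => //; exact: le_mx_norm.
by rewrite sumr_const card_ord -[leLHS]mulr_natl mulrA.
Qed.

Lemma continuous_mulmxr (R : realType) (n m : nat) (A : 'M[R]_(n, m)) :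
  continuous (mulmxr A : 'rV[R]_n -> 'rV[R]_m).
Proof.
apply/linear_bounded_continuous/ex_bound.
exists (n%:R * `|A|); apply/nbhs_ballP; exists 1 => //= v.
rewrite -ball_normE /ball_ /= sub0r normrN => v1.
rewrite (le_trans (mulmx_norm_le _ _))// ler_piMr ?mulr_ge0// ltW//.
Qed.

Lemma differentiable_eps (R : realType) (V W : normedModType R) (f : V -> W) x :
  differentiable f x -> forall e : R, 0 < e ->
  exists2 d : R, 0 < d &
    forall v, `|v| < d -> `|f (x + v) - f x - 'd f x v| <= e * `|v|.
Proof.
move=> df e e0; have /diff_locally/eqaddoP/(_ e e0) := df.
move=> /nbhs_ballP[d /= d0 H]; exists d => // v vd.
have /H : ball (0 : V) d v by rewrite -ball_normE /ball_ /= sub0r normrN.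
suff -> : (f \o shift x - (cst (f x) + 'd f x)) v = f (x + v) - f x - 'd f x v by [].
rewrite [LHS](_ : _ = f (v + x) - (f x + 'd f x v))//.
by rewrite opprD addrA [v + x]addrC.
Qed.

Lemma differentiable_of_eps (R : realType) (V W : normedModType R) (f : V -> W) x
    (L : {linear V -> W}) : continuous L ->
  (forall e : R, 0 < e -> exists2 d : R, 0 < d &
    forall v, `|v| < d -> `|f (x + v) - f x - L v| <= e * `|v|) ->
  differentiable f x /\ 'd f x = L :> (V -> W).
Proof.
move=> cL H.
have fE : f \o shift x = cst (f x) + L +o_ 0 id.
  apply/eqaddoP => e e0; have [d d0 Hd] := H e e0.
  apply/nbhs_ballP; exists d => // v; rewrite -ball_normE /ball_ /= sub0r normrN => /Hd.
  suff -> : (f \o shift x - (cst (f x) + L)) v = f (x + v) - f x - L v by [].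
  rewrite [LHS](_ : _ = f (v + x) - (f x + L v))//.
  by rewrite opprD addrA [v + x]addrC.
have dL := diff_unique cL fE; split=> //.
by apply/diff_locallyP; rewrite dL.
Qed.

Lemma jacobian_of_eps (R : realType) (n m : nat) (f : 'rV[R]_n -> 'rV[R]_m) x
    (A : 'M[R]_(n, m)) :
  (forall e : R, 0 < e -> exists2 d : R, 0 < d &
    forall v, `|v| < d -> `|f (x + v) - f x - v *m A| <= e * `|v|) ->
  differentiable f x /\ jacobian f x = A.
Proof.
move=> H.
have [df dE] := @differentiable_of_eps R _ _ f x (mulmxr A) (@continuous_mulmxr _ _ _ A) H.
split=> //; apply/row_matrixP => i; rewrite row_jacobian// partialE// dE.
by rewrite rowE.
Qed.

Lemma is_derive_line (R : realType) (n : nat) (V : normedModType R)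
    (f : 'rV[R]_n -> V) (x v : 'rV[R]_n) (t : R) :
  differentiable f (x + t *: v) ->
  is_derive t 1 (fun s : R => f (x + s *: v)) ('d f (x + t *: v) v).
Proof.
move=> df.
have dg : is_diff t (fun s : R => x + s *: v) (fun s => s *: v).
  have := is_diffD (is_diff_cst x t) (is_diff_scalel t v).
  by move=> /is_diff_eq; apply; apply/funext => s /=; rewrite add0r.
have dfg : differentiable (fun s : R => f (x + s *: v)) t.
  by apply: (@differentiable_comp _ _ _ _ (fun s : R => x + s *: v) f).
apply: DeriveDef; first exact: diff_derivable.
rewrite deriveE// (@diff_comp _ _ _ _ (fun s : R => x + s *: v) f)//=.
by rewrite diff_val scale1r.
Qed.

(** Young's theorem: the second difference [D a b h] is symmetric in [a] and [b], and
    differentiability of [partial a f] at the single point [x] determines it up to o(h^2). *)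
Lemma partial_partialC (R : realType) (n : nat) (f : 'rV[R]_n -> R)
    (i j : 'I_n) (x : 'rV[R]_n) :
  (\forall y \near x, differentiable f y) ->
  differentiable (partial i f) x -> differentiable (partial j f) x ->
  partial i (partial j f) x = partial j (partial i f) x.
Proof.
move=> nf di dj.
have nd (k : 'I_n) : `|(delta_mx 0 k : 'rV[R]_n)| <= 1.
  apply: mx_norm_le => // a b; rewrite mxE.
  by case: (_ && _); rewrite /= ?normr1 ?normr0.
have [r r0 fr] : exists2 r : R, 0 < r & forall v, `|v| < r -> differentiable f (x + v).
  have /nbhs_ballP[r /= r0 H] := nf; exists r => // v vr; apply: H.
  by rewrite -ball_normE /ball_ /= opprD addNKr normrN.
pose D (a b : 'I_n) (h : R) : R :=
  f (x + (h *: delta_mx 0 a + h *: delta_mx 0 b)) - f (x + h *: delta_mx 0 a)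
  - f (x + h *: delta_mx 0 b) + f x.
have step (a b : 'I_n) : differentiable (partial a f) x ->
    forall e : R, 0 < e -> exists2 d : R, 0 < d & forall h : R, 0 < h -> h < d ->
    `|D a b h - h ^+ 2 * partial b (partial a f) x| <= e * h ^+ 2.
  (* The two increments used below have norms at most 2 h and h, so a third of [e] is spent on each
     h. *)
  move=> da e e0; have e3 : 0 < e / 3 by rewrite divr_gt0.
  have [d d0 Hd] := differentiable_eps da e3.
  exists (Num.min (d / 2) (r / 2)); first by rewrite lt_min !divr_gt0.
  move=> h h0; rewrite lt_min => /andP[hd hr].
  pose phi (t : R) := f ((x + h *: delta_mx 0 b) + t *: delta_mx 0 a) - f (x + t *: delta_mx 0 a).
  have small (t : R) (c : R) : 0 <= t -> t <= h -> 0 <= c -> c <= h ->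
      `|c *: (delta_mx 0 b : 'rV[R]_n) + t *: delta_mx 0 a| <= c + t.
    move=> t0 th c0 ch; rewrite (le_trans (ler_normD _ _))// !normrZ !ger0_norm//.
    by rewrite lerD// ler_piMr.
  have dphi t : 0 <= t <= h -> is_derive t 1 phi
     (partial a f ((x + h *: delta_mx 0 b) + t *: delta_mx 0 a) - partial a f (x + t *: delta_mx 0 a)).
    move=> /andP[t0 th].
    have d1 : differentiable f ((x + h *: delta_mx 0 b) + t *: delta_mx 0 a).
      rewrite -addrA; apply: fr; rewrite (le_lt_trans (small t h _ _ _ _))//; first exact: ltW.
      by rewrite (splitr r) ltrD// (le_lt_trans th).
    have d2 : differentiable f (x + t *: delta_mx 0 a).
      apply: fr; have := small t 0 t0 th (lexx _) (ltW h0); rewrite scale0r !add0r.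
      move=> /le_lt_trans; apply; rewrite (le_lt_trans th)// (lt_trans hr)//.
      by rewrite gtr_pMr// invf_lt1// ltr1n.
    rewrite (partialE a d1) (partialE a d2).
    exact: (is_deriveB (is_derive_line d1) (is_derive_line d2)).
  (* The mean value theorem is used in direction [a] only; direction [b] is handled by the
     differentiability of [partial a f] at [x]. *)
  have [c /andP[c0 ch] cE] : exists2 c, 0 <= c <= h & phi h - phi 0 =
     (partial a f ((x + h *: delta_mx 0 b) + c *: delta_mx 0 a) - partial a f (x + c *: delta_mx 0 a)) * h.
    have [c|c|c cin E] := @MVT R phi (fun t => partial a f ((x + h *: delta_mx 0 b) + t *: delta_mx 0 a)
        - partial a f (x + t *: delta_mx 0 a)) 0 h h0.
    - by rewrite in_itv/= => /andP[c0 c1]; apply: dphi; rewrite !ltW.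
    - apply: derivable_within_continuous => t; rewrite in_itv/= => t0.
      by have [] := dphi t t0.
    - exists c; last by rewrite E subr0.
      by move: cin; rewrite in_itv/= => /andP[? ?]; rewrite !ltW.
  have DE : D a b h = phi h - phi 0.
    rewrite /D /phi !scale0r !addr0 [h *: delta_mx 0 a + _]addrC [x + (_ + _)]addrA.
    by rewrite opprB [RHS]addrA [RHS]addrAC.
  have E1 := Hd (h *: delta_mx 0 b + c *: delta_mx 0 a) _.
  have E2 := Hd (c *: delta_mx 0 a) _.
  have n1 := small c h c0 ch (ltW h0) (lexx _).
  have n2 := small c 0 c0 ch (lexx _) (ltW h0).
  rewrite scale0r !add0r in n2.
  have {}E1 := E1 (le_lt_trans n1 _); have {}E2 := E2 (le_lt_trans n2 _).
  have {}E1 := E1 ltac:(lra); have {}E2 := E2 ltac:(lra).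
  have LZ v s : 'd (partial a f) x (s *: v) = s *: 'd (partial a f) x v by rewrite linearZ.
  move: E1 E2; rewrite linearD !LZ -(partialE a da) -(partialE b da) addrA.
  set A1 := partial a f (_ + _ + _); set A2 := partial a f (x + _).
  set A0 := partial a f x; set P := partial b (partial a f) x; set Q := partial a (partial a f) x.
  move: n1 n2; set N1 := `|_ + _|; set N2 := `|_ *: _| => n1 n2 E1 E2.
  have {}DE : D a b h = (A1 - A2) * h by rewrite DE.
  have -> : D a b h - h ^+ 2 * P =
      h * ((A1 - A0 - (h *: P + c *: Q)) - (A2 - A0 - c *: Q)).
    by rewrite DE /GRing.scale/=; ring.
  rewrite normrM gtr0_norm//.
  have -> : e * h ^+ 2 = h * (e / 3 * h *+ 3) by rewrite -mulr_natr; field.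
  rewrite ler_pM2l// (le_trans (ler_normB _ _))//.
  apply: (le_trans (lerD E1 E2)); rewrite -mulrDr -mulrnAr ler_pM2l//.
  rewrite -mulr_natl; lra.
apply/eqP; rewrite -subr_eq0 -normr_eq0 eq_sym eq_le normr_ge0/=.
apply/ler_addgt0Pl => e e0; rewrite addr0.
have e2 : 0 < e / 2 by rewrite divr_gt0.
have [d d0 Hd] := step i j di _ e2; have [d' d'0 Hd'] := step j i dj _ e2.
pose h := Num.min d d' / 2.
have h0 : 0 < h by rewrite divr_gt0// lt_min d0.
have hd : h < Num.min d d' by rewrite /h ltr_pdivrMr// ltr_pMr ?ltr1n// lt_min d0.
move: hd; rewrite lt_min => /andP[hd hd'].
have DC : D i j h = D j i h.
  by rewrite /D [h *: _ + _]addrC; congr (_ + _); rewrite addrAC.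
have := Hd h h0 hd; have := Hd' h h0 hd'; rewrite DC.
set P := partial i _ x; set Q := partial j _ x; set DD := D _ _ _.
move=> E1 E2; rewrite -(ler_pM2l (exprn_gt0 2 h0)).
rewrite -[X in X * `|_|](ger0_norm (ltW (exprn_gt0 2 h0))) -normrM.
have -> : h ^+ 2 * (P - Q) = (DD - h ^+ 2 * Q) - (DD - h ^+ 2 * P) by ring.
rewrite (le_trans (ler_normB _ _))//.
have -> : h ^+ 2 * e = e / 2 * h ^+ 2 + e / 2 * h ^+ 2 by field.
exact: (lerD E2 E1).
Qed.

Lemma diff_comp1 (R : realType) (n : nat) (f : 'rV[R]_n -> R) (g : R -> R) (dg : R)
    (i : 'I_n) x :
  differentiable f x -> is_derive (f x) 1 g dg ->
  differentiable (fun y => g (f y)) x /\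
  partial i (fun y => g (f y)) x = dg * partial i f x.
Proof.
move=> df [gd gE].
have dg1 : differentiable g (f x) by exact/derivable1_diffP.
have dgf : differentiable (fun y => g (f y)) x.
  exact: (@differentiable_comp _ _ _ _ f g).
split=> //; rewrite !partialE//.
rewrite (@diff_comp _ _ _ _ f g)//=.
by rewrite (deriv1E gd) -derive1E in gE *; rewrite gE mulrC.
Qed.

Lemma Ck_inv (R : realType) (n : nat) k (U : set 'rV[R]_n) (f : 'rV[R]_n -> R) :
  open U -> (forall x, U x -> f x != 0) -> Ck k U f -> Ck k U (fun x => (f x)^-1).
Proof.
move=> oU f0; elim: k => [|k IH] cf.
  by split=> // x Ux; apply: differentiableV; [exact: (Ck_diff cf)|exact: f0].
have dV x i : U x -> differentiable (fun x => (f x)^-1) x /\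
    partial i (fun x => (f x)^-1) x = - ((f x)^-1 * (f x)^-1) * partial i f x.
  move=> Ux; apply: (@diff_comp1 _ _ f (fun y => y^-1)); first exact: (Ck_diff cf).
  have := is_deriveV (f0 x Ux) (is_derive_id (f x) 1).
  move=> [d1 d2]; apply: DeriveDef => //.
  by rewrite [LHS]d2 /GRing.scale/= mulr1 expr2 invfM.
split=> [x Ux|i]; first by apply: differentiableV; [exact: (Ck_diff cf)|exact: f0].
have cV := IH (CkW cf).
apply: (@Ck_ext _ _ _ _ _ (fun x => (-1) * ((f x)^-1 * (f x)^-1) * partial i f x)) => //.
  by move=> x Ux; have [_ ->] := dV x i Ux; rewrite mulN1r.
apply: CkM => //; last by have [_] := cf; apply.
by apply: CkM => //; [exact: Ck_cst|exact: CkM].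
Qed.

Lemma Ck_sqrt (R : realType) (n : nat) k (U : set 'rV[R]_n) (f : 'rV[R]_n -> R) :
  open U -> (forall x, U x -> 0 < f x) -> Ck k U f -> Ck k U (fun x => Num.sqrt (f x)).
Proof.
move=> oU f0; elim: k => [|k IH] cf.
  split=> // x Ux.
  (* [diff_comp1] asks for a coordinate index; in dimension zero there is none, but every function
     is constant. *)
  case: n U oU f f0 cf x Ux => [|n] U oU f f0 cf x Ux.
    have -> : (fun x => Num.sqrt (f x)) = fun=> Num.sqrt (f x).
      by apply/funext => y; congr (Num.sqrt (f _)); apply/matrixP => a [].
    exact: differentiable_cst.
  have [] := @diff_comp1 R n.+1 f Num.sqrt _ ord0 x (Ck_diff cf Ux) (is_derive1_sqrt (f0 x Ux)).
  by [].
have dV x i : U x -> differentiable (fun x => Num.sqrt (f x)) x /\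
    partial i (fun x => Num.sqrt (f x)) x = (2 * Num.sqrt (f x))^-1 * partial i f x.
  move=> Ux; apply: (@diff_comp1 _ _ f Num.sqrt); first exact: (Ck_diff cf).
  exact: is_derive1_sqrt (f0 x Ux).
have cS := IH (CkW cf).
split=> [x Ux|i]; first exact: Ck_diff cS x Ux.
apply: (@Ck_ext _ _ _ _ _ (fun x => (2 * Num.sqrt (f x))^-1 * partial i f x)) => //.
  by move=> x Ux; have [_ ->] := dV x i Ux.
apply: CkM => //; last by have [_] := cf; apply.
apply: Ck_inv => //; first by move=> x Ux; rewrite mulf_neq0// ?pnatr_eq0// gt_eqF ?sqrtr_gt0 ?f0.
by apply: CkM => //; exact: Ck_cst.
Qed.

Lemma Ck_cossin (R : realType) (n : nat) k (U : set 'rV[R]_n) (f : 'rV[R]_n -> R) :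
  open U -> Ck k U f -> Ck k U (fun x => cos (f x)) /\ Ck k U (fun x => sin (f x)).
Proof.
move=> oU; case: n U oU f => [|n] U oU f.
  move=> _; have E (g : R -> R) : (fun x => g (f x)) = (fun=> g (f 0)).
    by apply/funext => y; congr (g (f _)); apply/matrixP => a [].
  by rewrite (E cos) (E sin); split; exact: Ck_cst.
have dc x (i : 'I_n.+1) : differentiable f x -> differentiable (fun x => cos (f x)) x /\
    partial i (fun x => cos (f x)) x = - sin (f x) * partial i f x.
  by move=> dfx; apply: (@diff_comp1 _ _ f cos) => //; exact: is_derive_cos.
have ds x (i : 'I_n.+1) : differentiable f x -> differentiable (fun x => sin (f x)) x /\
    partial i (fun x => sin (f x)) x = cos (f x) * partial i f x.
  by move=> dfx; apply: (@diff_comp1 _ _ f sin) => //; exact: is_derive_sin.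
elim: k => [|k IH] cf.
  by split; (split=> // x Ux); [have [] := dc x ord0 (Ck_diff cf Ux)|have [] := ds x ord0 (Ck_diff cf Ux)].
have [cc cs] := IH (CkW cf).
split; (split=> [x Ux|i]).
- exact: Ck_diff cc x Ux.
- apply: (@Ck_ext _ _ _ _ _ (fun x => (-1) * sin (f x) * partial i f x)) => //.
    by move=> x Ux; have [_ ->] := dc x i (Ck_diff cf Ux); rewrite mulN1r.
  apply: CkM => //; last by have [_] := cf; apply.
  by apply: CkM => //; exact: Ck_cst.
- exact: Ck_diff cs x Ux.
- apply: (@Ck_ext _ _ _ _ _ (fun x => cos (f x) * partial i f x)) => //.
    by move=> x Ux; have [_ ->] := ds x i (Ck_diff cf Ux).
  by apply: CkM => //; have [_] := cf; apply.
Qed.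

Lemma Ck_det (R : realType) (n m : nat) k (U : set 'rV[R]_n)
    (f : 'rV[R]_n -> 'M[R]_m) :
  open U -> (forall i j, Ck k U (fun x => f x i j)) -> Ck k U (fun x => \det (f x)).
Proof.
move=> oU cf; apply: Ck_sum => // s _; apply: CkM => //; first exact: Ck_cst.
by apply: Ck_prod => // i _; exact: cf.
Qed.

(** By Cramer's rule the entries of the inverse are cofactors divided by the determinant. *)
Lemma Ck_invmx (R : realType) (n m : nat) k (U : set 'rV[R]_n)
    (f : 'rV[R]_n -> 'M[R]_m) :
  open U -> (forall x, U x -> f x \in unitmx) ->
  (forall i j, Ck k U (fun x => f x i j)) ->
  forall i j, Ck k U (fun x => invmx (f x) i j).
Proof.
move=> oU fu cf i j.
apply: (@Ck_ext _ _ _ _ _ (fun x => (\det (f x))^-1 * ((-1) ^+ (j + i) * \det (row' j (col' i (f x)))))) => //.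
  by move=> x Ux; rewrite /invmx fu// !mxE.
apply: CkM => //.
  apply: Ck_inv => //; last exact: Ck_det.
  by move=> x /fu; rewrite unitmxE unitfE.
apply: CkM => //; first exact: Ck_cst.
apply: Ck_det => // a b; under eq_fun do rewrite !mxE; exact: cf.
Qed.

Lemma Ck_mulmx (R : realType) (n p q r : nat) k (U : set 'rV[R]_n)
    (f : 'rV[R]_n -> 'M[R]_(p, q)) (g : 'rV[R]_n -> 'M[R]_(q, r)) :
  open U -> Ck k U f -> Ck k U g -> Ck k U (fun x => f x *m g x).
Proof.
move=> oU cf cg; apply/Ck_mxP => // i j; under eq_fun do rewrite mxE.
by apply: Ck_sum => // l _; apply: CkM => //; [exact: (Ck_mxP _ _ oU).1|exact: (Ck_mxP _ _ oU).1].
Qed.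

Lemma Ck_scalemx (R : realType) (n p q : nat) k (U : set 'rV[R]_n)
    (f : 'rV[R]_n -> R) (g : 'rV[R]_n -> 'M[R]_(p, q)) :
  open U -> Ck k U f -> Ck k U g -> Ck k U (fun x => f x *: g x).
Proof.
move=> oU cf cg; apply/Ck_mxP => // i j; under eq_fun do rewrite mxE.
by apply: CkM => //; exact: (Ck_mxP _ _ oU).1.
Qed.

Lemma Ck_dot (R : realType) (n m : nat) k (U : set 'rV[R]_n)
    (f g : 'rV[R]_n -> 'rV[R]_m) :
  open U -> Ck k U f -> Ck k U g -> Ck k U (fun x => dot (f x) (g x)).
Proof.
move=> oU cf cg; rewrite /dot; under eq_fun do rewrite mxE.
apply: Ck_sum => // l _; apply: CkM => //; first exact: (Ck_mxP _ _ oU).1.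
by under eq_fun do rewrite mxE; exact: (Ck_mxP _ _ oU).1.
Qed.

Lemma smooth_on_jacobian (R : realType) (n m : nat) (U : set 'rV[R]_n)
    (f : 'rV[R]_n -> 'rV[R]_m) :
  open U -> smooth_on U f -> smooth_on U (jacobian f).
Proof.
move=> oU sf; apply/(smooth_on_mxP _ oU) => i j.
apply: (@smooth_on_ext _ _ _ _ (fun x => partial i f x 0 j)) => //.
  move=> x Ux; have df := smooth_on_diff sf Ux.
  by rewrite -row_jacobian// mxE.
exact: ((smooth_on_mxP _ oU).1 (smooth_on_partial i sf) 0 j).
Qed.

Lemma differentiable_mulmxr (R : realType) (n p q : nat) (f : 'rV[R]_n -> 'rV[R]_p)
    (B : 'M[R]_(p, q)) x : differentiable f x ->
  differentiable (fun z => f z *m B) x.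
Proof.
move=> df; apply: (@differentiable_comp _ _ _ _ f (mulmxr B)); first exact: df.
by apply: linear_differentiable; exact: continuous_mulmxr.
Qed.

Lemma partial_mulmxr (R : realType) (n p q : nat) (f : 'rV[R]_n -> 'rV[R]_p)
    (B : 'M[R]_(p, q)) i x : differentiable f x ->
  partial i (fun z => f z *m B) x = partial i f x *m B.
Proof.
move=> df; have dB z : differentiable (mulmxr B : 'rV[R]_p -> 'rV[R]_q) z.
  by apply: linear_differentiable; exact: continuous_mulmxr.
rewrite (partialE i (differentiable_mulmxr B df)) (partialE i df).
have E := diff_comp df (dB (f x)).
transitivity (('d (mulmxr B : 'rV[R]_p -> 'rV[R]_q) (f x) \o 'd f x) (delta_mx 0 i)).
  by rewrite -E.
by rewrite /= diff_lin//; exact: continuous_mulmxr.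
Qed.

(** * The inverse function theorem *)

Lemma segment_norm_lt (R : realType) (V : normedModType R) (x0 x y : V) (r t : R) :
  0 <= t <= 1 -> `|x - x0| < r -> `|y - x0| < r -> `|x + t *: (y - x) - x0| < r.
Proof.
move=> /andP[t0 t1] xr yr.
have -> : x + t *: (y - x) - x0 = (1 - t) *: (x - x0) + t *: (y - x0).
  rewrite scalerBl scale1r -[RHS]addrA addrAC; congr (_ + _).
  rewrite -scalerN -scalerDr opprB; congr (_ *: _).
  by rewrite [RHS]addrC addrA subrK.
rewrite (le_lt_trans (ler_normD _ _))// !normrZ !ger0_norm ?subr_ge0//.
have [->|tn0] := eqVneq t 0; first by rewrite subr0 mul1r mul0r addr0.
have tgt : 0 < t by rewrite lt_neqAle eq_sym tn0.
have -> : r = (1 - t) * r + t * r by ring.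
by rewrite ler_ltD// ?ler_wpM2l ?subr_ge0// ?(ltW xr)// ltr_pM2l.
Qed.

(** The one-variable theorem is applied to each coordinate along the segment; the factor [n%:R]
    comes from estimating a row times a matrix in the sup norm. *)
Lemma mean_value_le (R : realType) (n m : nat) (f : 'rV[R]_n -> 'rV[R]_m)
    (x0 : 'rV[R]_n) (r c : R) : 0 <= c ->
  (forall x, `|x - x0| < r -> differentiable f x /\ `|jacobian f x| <= c) ->
  forall x y, `|x - x0| < r -> `|y - x0| < r ->
    `|f y - f x| <= n%:R * c * `|y - x|.
Proof.
move=> c0 H x y xr yr.
have seg (t : R) : 0 <= t <= 1 -> `|x + t *: (y - x) - x0| < r.
  by move=> t01; exact: segment_norm_lt.
apply: mx_norm_le => [|a j]; first by rewrite !mulr_ge0.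
rewrite ord1 {a}.
pose g (t : R) := f (x + t *: (y - x)) 0 j.
have dg (t : R) : 0 <= t <= 1 -> is_derive t 1 g (((y - x) *m jacobian f (x + t *: (y - x))) 0 j).
  move=> t01; have [df _] := H _ (seg t t01).
  have dfj : differentiable (fun z => f z 0 j) (x + t *: (y - x)).
    exact: ((differentiable_mxP _ _).1 df 0 j).
  have E : ((y - x) *m jacobian f (x + t *: (y - x))) 0 j =
           'd (fun z => f z 0 j) (x + t *: (y - x)) (y - x).
    rewrite diff_partial// mxE; apply: eq_bigr => k _.
    by congr (_ * _); rewrite -partial_mxE// -row_jacobian// [RHS]mxE.
  rewrite E; exact: (is_derive_line dfj).
have [||t tin E] := @MVT R g (fun t => ((y - x) *m jacobian f (x + t *: (y - x))) 0 j) 0 1 ltr01.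
- by move=> s; rewrite in_itv/= => /andP[t0 t1]; apply: dg; rewrite !ltW.
- by apply: derivable_within_continuous => s; rewrite in_itv/= => s01; have [] := dg s s01.
have t01 : 0 <= t <= 1 by move: tin; rewrite in_itv/= => /andP[? ?]; rewrite !ltW.
have -> : (f y - f x) 0 j = g 1 - g 0.
  by rewrite /g scale1r scale0r addr0 subrKC !mxE.
rewrite E subr0 mulr1 (le_trans (le_mx_norm _ _ _))// (le_trans (mulmx_norm_le _ _))//.
rewrite ler_wpM2r// ler_wpM2l//.
by have [] := H _ (seg t t01).
Qed.

Lemma unitmx_row_inj (R : fieldType) (m : nat) (A : 'M[R]_m) :
  (forall v : 'rV[R]_m, v *m A = 0 -> v = 0) -> A \in unitmx.
Proof.
move=> H; rewrite -row_free_unit -kermx_eq0; apply/eqP/row_matrixP => i.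
by rewrite row0; apply: H; rewrite -row_mul mulmx_ker row0.
Qed.

Lemma ball_compact (R : realType) (n : nat) (x0 : 'rV[R]_n) (r : R) :
  0 < r -> compact [set x | `|x - x0| <= r].
Proof.
move=> r0; have -> : [set x | `|x - x0| <= r] = closed_ball x0 r.
  rewrite closed_ballE//; apply/seteqP; split=> x; rewrite /closed_ball_ /=; by rewrite distrC.
apply: bounded_closed_compact; last exact: closed_ball_closed.
exists (`|x0| + r); split; first exact: num_real.
move=> M ltM x; rewrite closed_ballE// /closed_ball_ /= => xr.
apply: le_trans (ltW ltM).
have -> : x = x0 + (x - x0) by rewrite subrKC.
by rewrite (le_trans (ler_normD _ _))// lerD2l distrC.
Qed.

Lemma nbhs_norm_lt (R : realType) (V : normedModType R) (x : V) (P : set V) :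
  nbhs x P -> exists2 r : R, 0 < r & forall y, `|y - x| < r -> P y.
Proof.
move=> /nbhs_ballP[r /= r0 H]; exists r => // y yr; apply: H.
by rewrite -ball_normE /ball_ /= distrC.
Qed.

Lemma open_normP (R : realType) (V : normedModType R) (P : set V) :
  (forall x, P x -> exists2 r : R, 0 < r & forall y, `|y - x| < r -> P y) -> open P.
Proof.
move=> H; rewrite openE => x /H[r r0 rP]; apply/nbhs_ballP; exists r => // y.
by rewrite -ball_normE /ball_ /= distrC; exact: rP.
Qed.

Lemma continuous_norm_eps (R : realType) (V W : normedModType R) (f : V -> W) (x : V) :
  {for x, continuous f} -> forall e : R, 0 < e ->
  exists2 r : R, 0 < r & forall y, `|y - x| < r -> `|f y - f x| < e.
Proof.
move=> cf e e0; have /cvgrPdist_lt/(_ e e0) := cf.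
by move=> /nbhs_norm_lt[r r0 H]; exists r => // y /H; rewrite distrC.
Qed.

(** Newton's method with the derivative frozen at [x0]: the error map [e x = Phi x *m B - x] has
    zero derivative at [x0], hence is a 1/2-contraction nearby. This gives the reverse Lipschitz
    bound directly and the surjectivity by a fixed point. *)
Lemma inverse_function_local (R : realType) (m : nat) (U : set 'rV[R]_m)
    (Phi : 'rV[R]_m -> 'rV[R]_m) (x0 : 'rV[R]_m) :
  open U -> U x0 -> smooth_on U Phi -> jacobian Phi x0 \in unitmx ->
  exists r d c : R, [/\ 0 < r, 0 < d & 0 <= c] /\
   [/\ (forall x, `|x - x0| < r -> U x /\ jacobian Phi x \in unitmx),
      (forall x y, `|x - x0| < r -> `|y - x0| < r ->
          `|x - y| <= c * `|Phi x - Phi y|) &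
      (forall y, `|y - Phi x0| < d ->
          exists2 x, `|x - x0| < r & Phi x = y)].
Proof.
move=> oU Ux0 sPhi u0.
pose B := invmx (jacobian Phi x0).
have dPhi x : U x -> differentiable Phi x by exact: smooth_on_diff.
pose e x := Phi x *m B - x.
have de x : U x -> differentiable e x /\ jacobian e x = jacobian Phi x *m B - 1%:M.
  move=> Ux.
  have d1 := differentiable_mulmxr B (dPhi x Ux).
  have d2 : differentiable e x.
    by apply: (@differentiableB _ _ _ (fun z => Phi z *m B) id) => //; apply: ex_diff.
  split; first exact: d2.
  apply/row_matrixP => i; rewrite row_jacobian//.
  rewrite (@partialB _ _ _ i (fun z => Phi z *m B) id x d1); last by apply: ex_diff.
  rewrite (partial_mulmxr B i (dPhi x Ux)) linearB/= row_mul (row_jacobian i (dPhi x Ux)).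
  by rewrite /partial derive_id rowE mulmx1.
have [r1 r10 r1U] := nbhs_norm_lt (open_nbhs_nbhs (conj oU Ux0)).
pose N := m%:R * `|B|; have N0 : 0 <= N by rewrite mulr_ge0.
pose M := (m.+1%:R : R); have M0 : 0 < M by rewrite ltr0n.
have cJ : {for x0, continuous (jacobian Phi)}.
  apply: differentiable_continuous; apply: smooth_on_diff Ux0.
  exact: smooth_on_jacobian.
(* Multiplication by [B] turns this bound into 1/(2M) for the derivative of [e], and [mean_value_le]
   costs another factor [m], leaving 1/2. Taking [m.+1] and [N + 1] avoids dividing by zero. *)
have eta0 : 0 < (2 * M * (N + 1))^-1.
  by rewrite invr_gt0 !mulr_gt0// ltr_wpDl.
have [r2 r20 r2J] := continuous_norm_eps cJ eta0.
pose r := Num.min r1 r2; have r0 : 0 < r by rewrite lt_min r10.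
have rU x : `|x - x0| < r -> U x by rewrite lt_min => /andP[/r1U].
have Je x : `|x - x0| < r -> `|jacobian e x| <= (2 * M)^-1.
  move=> xr; have [_ ->] := de x (rU x xr).
  have -> : 1%:M = jacobian Phi x0 *m B by rewrite mulmxV.
  rewrite -mulmxBl (le_trans (mulmx_norm_le _ _))// -/N.
  have xr2 : `|x - x0| < r2 by move: xr; rewrite lt_min => /andP[].
  apply: (@le_trans _ _ ((N + 1) * (2 * M * (N + 1))^-1)).
    by apply: ler_pM => //; [rewrite lerDl|exact/ltW/r2J].
  by rewrite le_eqVlt; apply/orP; left; apply/eqP; field; rewrite !gt_eqF// ltr_wpDl.
have elip x y : `|x - x0| < r -> `|y - x0| < r -> `|e y - e x| <= 2^-1 * `|y - x|.
  move=> xr yr.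
  have c0 : 0 <= (2 * M)^-1 by rewrite invr_ge0 mulr_ge0 ?ltW.
  apply: le_trans (mean_value_le c0 _ xr yr) _.
    by move=> z zr; split; [have [] := de z (rU z zr)|exact: Je].
  rewrite ler_wpM2r// invfM mulrCA ler_piMr ?invr_ge0//.
  by rewrite ler_pdivrMr// mul1r ler_nat.
have lip x y : `|x - x0| < r -> `|y - x0| < r -> `|x - y| <= (2 * N) * `|Phi x - Phi y|.
  move=> xr yr.
  have -> : x - y = (Phi x - Phi y) *m B - (e x - e y).
    by rewrite /e mulmxBl; apply/matrixP => a b; rewrite !mxE; ring.
  have E1 := mulmx_norm_le (Phi x - Phi y) B.
  have E2 := elip y x yr xr.
  have := ler_normB ((Phi x - Phi y) *m B) (e x - e y).
  have -> : (Phi x - Phi y) *m B - (e x - e y) = x - y.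
    by rewrite /e mulmxBl; apply/matrixP => a b; rewrite !mxE; ring.
  rewrite -/N in E1; move: E1 E2; set a := `|x - y|; set b := `|Phi x - Phi y|.
  set p := `|_ *m B|; set q := `|e x - e y|; nra.
(* With this radius the target moves the fixed point map by at most r/4 and the contraction by
   another r/4, so the ball of radius r/2 is stable. *)
exists r, (r / (4 * (N + 1))), (2 * N); split.
  split => //; last by rewrite mulr_ge0.
  by rewrite divr_gt0// mulr_gt0// ltr_wpDl.
split.
- move=> x xr; split; first exact: rU.
  suff : jacobian Phi x *m B \in unitmx by rewrite unitmx_mul => /andP[].
  (* A vector [v] in the kernel satisfies v *m jacobian e x = - v, whereas this product has norm at
     most half that of [v]. *)
  apply: unitmx_row_inj => v v0.
  have E : v *m jacobian e x = - v.
    by have [_ ->] := de x (rU x xr); rewrite mulmxBr mulmx1 v0 sub0r.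
  have := mulmx_norm_le v (jacobian e x); rewrite E normrN => E1.
  have E2 : m%:R * `|jacobian e x| <= 2^-1.
    apply: (@le_trans _ _ (M * (2 * M)^-1)).
      by apply: ler_pM => //; [rewrite ler_nat|exact: Je].
    by rewrite le_eqVlt; apply/orP; left; apply/eqP; field; rewrite gt_eqF.
  apply/eqP; rewrite -normr_eq0.
  have E3 := ler_wpM2r (normr_ge0 v) E2; have := normr_ge0 v.
  by move: E1 E3; set a := `|v|; set b := _ * a => *; apply/eqP; lra.
- exact: lip.
move=> y yd.
pose A := [set x : 'rV[R]_m | `|x - x0| <= r / 2].
have r20' : 0 < r / 2 by rewrite divr_gt0.
have Ar x : A x -> `|x - x0| < r.
  by move=> /le_lt_trans; apply; rewrite ltr_pdivrMr// ltr_pMr// ltr1n.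
have cA : compact A by exact: ball_compact.
pose T x := y *m B - e x.
have TA x : A x -> A (T x).
  move=> Ax; rewrite /A /=.
  have -> : T x - x0 = (y - Phi x0) *m B - (e x - e x0).
    by rewrite /T /e mulmxBl; apply/matrixP => a b; rewrite !mxE; ring.
  rewrite (le_trans (ler_normB _ _))//.
  have x0r : `|x0 - x0| < r by rewrite subrr normr0.
  have E1 := elip x0 x x0r (Ar x Ax).
  have E2 := mulmx_norm_le (y - Phi x0) B.
  have E3 : N * `|y - Phi x0| <= r / 4.
    apply: (@le_trans _ _ ((N + 1) * (r / (4 * (N + 1))))).
      by apply: ler_pM => //; [rewrite lerDl|exact: ltW].
    by rewrite le_eqVlt; apply/orP; left; apply/eqP; field; rewrite gt_eqF ?ltr_wpDl.
  rewrite /A /= in Ax; rewrite -/N in E2.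
  move: E1 E2 E3 Ax; set a := `|e x - e x0|; set b := `|_ *m B|; set c := N * _; set d := `|x - x0|; lra.
(* T contracts by 1/2, so a minimum of the displacement |T x - x| is a fixed
   point. *)
have TN x : T x - x = (y - Phi x) *m B.
  by rewrite /T /e mulmxBl; apply/matrixP => a b; rewrite !mxE; ring.
have [] := @EVT_min_rV R m (fun x => `|T x - x|) A.
- by exists x0; rewrite /A /= subrr normr0 ltW.
- exact: cA.
- apply: continuous_in_subspaceT => x /set_mem Ax.
  apply: (@continuous_comp _ _ _ (fun x => T x - x) Num.norm); last exact: norm_continuous.
  apply: differentiable_continuous.
  apply: (@differentiableB _ _ _ T id); last by apply: ex_diff.
  apply: (@differentiableB _ _ _ (fun=> y *m B) e); first exact: differentiable_cst.
  by have [] := de x (rU x (Ar x Ax)).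
move=> x /set_mem Ax xmin.
have := xmin (T x) (mem_set (TA x Ax)).
have -> : T (T x) - T x = - (e (T x) - e x).
  by rewrite /T; apply/matrixP => a b; rewrite !mxE; ring.
rewrite normrN => E1; have E2 := elip x (T x) (Ar x Ax) (Ar _ (TA x Ax)).
have /eqP : `|T x - x| = 0 by have := normr_ge0 (T x - x); move: E1 E2; set a := `|T x - x|; set b := `|e _ - _|; lra.
rewrite normr_eq0 TN => /eqP yx; exists x; first exact: Ar.
have : (y - Phi x) *m B *m jacobian Phi x0 = 0 by rewrite yx mul0mx.
by rewrite mulmxKV// => /eqP; rewrite subr_eq0 => /eqP.
Qed.

Lemma open_norm_ball (R : realType) (V : normedModType R) (x0 : V) (r : R) :
  open [set x | `|x - x0| < r].
Proof.
apply: open_normP => x /= xr; exists (r - `|x - x0|); first by rewrite subr_gt0.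
move=> y; rewrite ltrBrDr => yr; apply: le_lt_trans yr.
by rewrite (le_trans _ (ler_normD _ _))// subrKA.
Qed.

(** The Lipschitz bound on [psi] converts an error that is small relative to the increment of [psi]
    into one that is small relative to the increment of [y]. *)
Lemma inverse_derivative (R : realType) (m : nat)
    (Phi psi : 'rV[R]_m -> 'rV[R]_m) (y0 : 'rV[R]_m) (d c : R) :
  0 < d -> 0 <= c ->
  (forall y, `|y - y0| < d -> Phi (psi y) = y /\ `|psi y - psi y0| <= c * `|y - y0|) ->
  differentiable Phi (psi y0) -> jacobian Phi (psi y0) \in unitmx ->
  differentiable psi y0 /\ jacobian psi y0 = invmx (jacobian Phi (psi y0)).
Proof.
move=> d0 c0 H dPhi uA; set A := jacobian Phi (psi y0) in uA *.
apply: jacobian_of_eps => e e0.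
pose N := m%:R * `|invmx A|; have N0 : 0 <= N by rewrite mulr_ge0.
have e'0 : 0 < e / ((N + 1) * (c + 1)) by rewrite divr_gt0// mulr_gt0// ltr_wpDl.
have [d1 d10 H1] := differentiable_eps dPhi e'0.
exists (Num.min d (d1 / (c + 1))).
  by rewrite lt_min d0 divr_gt0// ltr_wpDl.
move=> k; rewrite lt_min => /andP[kd kd1].
have [E1 E2] : Phi (psi (y0 + k)) = y0 + k /\ `|psi (y0 + k) - psi y0| <= c * `|k|.
  have := H (y0 + k); have -> : y0 + k - y0 = k by rewrite addrAC subrr add0r.
  by apply.
have [E0 _] : Phi (psi y0) = y0 /\ `|psi y0 - psi y0| <= c * `|y0 - y0|.
  by apply: H; rewrite subrr normr0.
set h := psi (y0 + k) - psi y0 in E2 *.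
have hd : `|h| < d1.
  rewrite (le_lt_trans E2)//; move: kd1; rewrite ltr_pdivlMr ?ltr_wpDl// => /(le_lt_trans _); apply.
  by rewrite mulrC ler_wpM2l// lerDl.
have := H1 h hd; rewrite /h subrKC -/h E1 E0.
have -> : 'd Phi (psi y0) h = h *m A by rewrite mul_rV_lin1.
have -> : y0 + k - y0 - h *m A = k - h *m A by rewrite [y0 + k - y0]addrAC subrr add0r.
move=> E3.
have -> : h - k *m invmx A = - ((k - h *m A) *m invmx A).
  by rewrite mulmxBl mulmxK// opprB.
rewrite normrN (le_trans (mulmx_norm_le _ _))// -/N.
apply: (@le_trans _ _ ((N + 1) * (e / ((N + 1) * (c + 1)) * ((c + 1) * `|k|)))).
  apply: ler_pM => //; first by rewrite lerDl.
  apply: (le_trans E3); rewrite ler_wpM2l ?(ltW e'0)//.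
  by apply: (le_trans E2); rewrite ler_wpM2r// lerDl.
rewrite le_eqVlt; apply/orP; left; apply/eqP; field.
by rewrite !gt_eqF// ltr_wpDl.
Qed.

(** Bootstrap: the first derivatives of [psi] are smooth functions of [psi] itself, so each order of
    differentiability yields the next. *)
Lemma smooth_inverse (R : realType) (m : nat) (U W : set 'rV[R]_m)
    (Phi psi : 'rV[R]_m -> 'rV[R]_m) :
  open U -> open W -> smooth_on U Phi -> (forall y, W y -> U (psi y)) ->
  (forall y, W y -> jacobian Phi (psi y) \in unitmx) ->
  (forall y, W y -> differentiable psi y /\
     jacobian psi y = invmx (jacobian Phi (psi y))) ->
  smooth_on W psi.
Proof.
move=> oU oW sPhi WU uJ dpsi; apply/smooth_onP => k; elim: k => [|k IH].
  by split=> // y /dpsi[].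
split=> [y /dpsi[]//|i]; apply/(Ck_mxP _ _ oW) => a j.
apply: (@Ck_ext _ _ _ _ _ (fun y => invmx (jacobian Phi (psi y)) i j)) => //.
  move=> y Wy; have [d1 <-] := dpsi y Wy.
  by rewrite -(row_jacobian i d1) [RHS]mxE.
apply: Ck_invmx => // p q.
apply: (@Ck_comp _ _ _ _ _ U (fun x => jacobian Phi x p q)) => //.
have /smooth_onP/(_ k) := smooth_on_jacobian oU sPhi.
by move=> /(Ck_mxP _ _ oU).
Qed.

Theorem inverse_function (R : realType) (m : nat) (U : set 'rV[R]_m)
    (Phi : 'rV[R]_m -> 'rV[R]_m) (x0 : 'rV[R]_m) :
  open U -> U x0 -> smooth_on U Phi -> jacobian Phi x0 \in unitmx ->
  exists (V W : set 'rV[R]_m) (psi : 'rV[R]_m -> 'rV[R]_m),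
   [/\ open V, V x0 & V `<=` U] /\
   [/\ open W, W (Phi x0), smooth_on W psi,
      (forall x, V x -> W (Phi x) /\ psi (Phi x) = x) &
      (forall y, W y -> V (psi y) /\ Phi (psi y) = y)].
Proof.
move=> oU Ux0 sPhi uJ.
have [r [d [c [[r0 d0 c0] [rU lip surj]]]]] := inverse_function_local oU Ux0 sPhi uJ.
pose P y x := `|x - x0| < r /\ Phi x = y.
(* The default [x0] is taken only where no preimage lies in the ball, which does not happen on
   [W]. *)
pose psi y := xget x0 (P y).
have psiP y : `|y - Phi x0| < d -> P y (psi y).
  move=> yd; have [x xr xy] := surj y yd.
  by apply: (@xgetPex _ x0 (P y)); exists x.
pose W := [set y | `|y - Phi x0| < d]; pose V := [set x | `|x - x0| < r /\ W (Phi x)].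
have oW : open W by exact: open_norm_ball.
have lipW y z : W y -> W z -> `|psi y - psi z| <= c * `|y - z|.
  move=> /psiP[yr yE] /psiP[zr zE]; apply: (le_trans (lip _ _ yr zr)).
  by rewrite yE zE.
have WV y : W y -> V (psi y) /\ Phi (psi y) = y.
  by move=> Wy; have [yr yE] := psiP y Wy; split=> //; split; rewrite ?yE.
exists V, W, psi; split; split.
- rewrite openE => x [xr Wx].
  have cPhi : {for x, continuous Phi}.
    by apply: differentiable_continuous; apply: smooth_on_diff sPhi _; have [] := rU x xr.
  have n1 : nbhs x [set z | `|z - x0| < r].
    by apply: open_nbhs_nbhs; split=> //; exact: open_norm_ball.
  have n2 : nbhs x (Phi @^-1` W) by apply: cPhi; exact: open_nbhs_nbhs.
  exact: filterI n1 n2.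
- split; first by rewrite subrr normr0.
  have -> : W (Phi x0) = (`|Phi x0 - Phi x0| < d) by [].
  by rewrite subrr normr0.
- by move=> x [xr _]; have [] := rU x xr.
- exact: oW.
- have -> : W (Phi x0) = (`|Phi x0 - Phi x0| < d) by [].
  by rewrite subrr normr0.
- apply: (smooth_inverse oU oW sPhi).
  + by move=> y /WV[[yr _] _]; have [] := rU _ yr.
  + by move=> y /WV[[yr _] _]; have [] := rU _ yr.
  move=> y Wy; have [[yr _] _] := WV y Wy; have [Uy uy] := rU _ yr.
  have [e e0 eW] := nbhs_norm_lt (open_nbhs_nbhs (conj oW Wy)).
  apply: (@inverse_derivative _ _ Phi psi y e c e0 c0 _ _ uy).
    move=> z /eW Wz; split; first by have [] := WV z Wz.
    exact: lipW.
  exact: smooth_on_diff sPhi Uy.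
- move=> x [xr Wx]; split=> //.
  have [yr yE] := psiP _ Wx.
  have := lip _ _ yr xr; rewrite yE subrr normr0 mulr0 normr_le0 subr_eq0.
  by move=> /eqP.
- exact: WV.
Qed.

(** * Quadratic forms *)

Lemma dotE (R : realType) (m : nat) (u v : 'rV[R]_m) : dot u v = \sum_i u 0 i * v 0 i.
Proof. by rewrite /dot mxE; apply: eq_bigr => i _; rewrite [X in _ * X]mxE. Qed.

Lemma dotC (R : realType) (m : nat) (u v : 'rV[R]_m) : dot u v = dot v u.
Proof. by rewrite !dotE; apply: eq_bigr => i _; rewrite mulrC. Qed.

Lemma dotDl (R : realType) (m : nat) (u v w : 'rV[R]_m) :
  dot (u + v) w = dot u w + dot v w.
Proof. by rewrite /dot mulmxDl mxE. Qed.

Lemma dotDr (R : realType) (m : nat) (u v w : 'rV[R]_m) :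
  dot w (u + v) = dot w u + dot w v.
Proof. by rewrite ![dot w _]dotC dotDl. Qed.

Lemma dotZl (R : realType) (m : nat) (a : R) (u v : 'rV[R]_m) :
  dot (a *: u) v = a * dot u v.
Proof. by rewrite /dot -scalemxAl mxE. Qed.

Lemma dotZr (R : realType) (m : nat) (a : R) (u v : 'rV[R]_m) :
  dot u (a *: v) = a * dot u v.
Proof. by rewrite ![dot u _]dotC dotZl. Qed.

Lemma dotNl (R : realType) (m : nat) (u v : 'rV[R]_m) : dot (- u) v = - dot u v.
Proof. by rewrite -scaleN1r dotZl mulN1r. Qed.

Lemma dotNr (R : realType) (m : nat) (u v : 'rV[R]_m) : dot u (- v) = - dot u v.
Proof. by rewrite dotC dotNl dotC. Qed.

Lemma dotBl (R : realType) (m : nat) (u v w : 'rV[R]_m) :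
  dot (u - v) w = dot u w - dot v w.
Proof. by rewrite dotDl dotNl. Qed.

Lemma dotBr (R : realType) (m : nat) (u v w : 'rV[R]_m) :
  dot w (u - v) = dot w u - dot w v.
Proof. by rewrite dotDr dotNr. Qed.

Lemma dot0l (R : realType) (m : nat) (v : 'rV[R]_m) : dot 0 v = 0.
Proof. by rewrite /dot mul0mx mxE. Qed.

Lemma dot_ge0 (R : realType) (m : nat) (u : 'rV[R]_m) : 0 <= dot u u.
Proof. by rewrite dotE; apply: sumr_ge0 => i _; rewrite -expr2 sqr_ge0. Qed.

Lemma dot_eq0 (R : realType) (m : nat) (u : 'rV[R]_m) : (dot u u == 0) = (u == 0).
Proof.
apply/idP/idP => [|/eqP ->]; last by rewrite dot0l.
rewrite dotE psumr_eq0; last by move=> i _; rewrite -expr2 sqr_ge0.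
move=> /allP H; apply/eqP/matrixP => a b; rewrite ord1 [RHS]mxE.
by have := H b (mem_index_enum _); rewrite /= -expr2 sqrf_eq0 => /eqP.
Qed.

Lemma dot_gt0 (R : realType) (m : nat) (u : 'rV[R]_m) : (0 < dot u u) = (u != 0).
Proof. by rewrite lt_def dot_ge0 andbT dot_eq0. Qed.

Lemma dot1_neq0 (R : realType) (m : nat) (u : 'rV[R]_m) : dot u u = 1 -> u != 0.
Proof. by move=> u1; rewrite -dot_eq0 u1 oner_neq0. Qed.

Lemma dot_mulmxl (R : realType) (m p : nat) (u : 'rV[R]_m) (A : 'M[R]_(m, p)) (v : 'rV[R]_p) :
  dot (u *m A) v = dot u (v *m A^T).
Proof. by rewrite /dot trmx_mul trmxK mulmxA. Qed.

(** At u + t (u C) the form equals 2 t |u C|^2 + O(t^2), which would be negative for a small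
    negative [t]. The value -b / (c + 1) also works when c = 0. *)
Lemma psd_null (R : realType) (n : nat) (C : 'M[R]_n) (u : 'rV[R]_n) :
  C^T = C -> (forall v, 0 <= dot (v *m C) v) -> dot (u *m C) u = 0 -> u *m C = 0.
Proof.
move=> sC pC uC; set w := u *m C; apply/eqP; rewrite -dot_eq0; apply/eqP.
set b := dot w w; set c := dot (w *m C) w; have c0 : 0 <= c := pC w.
have b0 : 0 <= b := dot_ge0 w.
have H t : 0 <= 2 * t * b + t ^+ 2 * c.
  have := pC (u + t *: w).
  rewrite mulmxDl -scalemxAl dotDl !dotDr !dotZl !dotZr uC -/w -/b -/c.
  have -> : dot (w *m C) u = b by rewrite dot_mulmxl sC -/w.
  by rewrite (_ : _ + _ = 2 * t * b + t ^+ 2 * c)//; ring.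
have c1 : 0 < c + 1 by rewrite ltr_wpDl.
have := H (- (b / (c + 1))).
have -> : 2 * - (b / (c + 1)) * b + (- (b / (c + 1))) ^+ 2 * c =
   - ((b / (c + 1)) ^+ 2 * (c + 2)) by field; rewrite gt_eqF.
rewrite oppr_ge0 => H1.
have : (b / (c + 1)) ^+ 2 * (c + 2) = 0.
  by apply: le_anti; rewrite H1 mulr_ge0 ?sqr_ge0// addr_ge0.
move=> /eqP; rewrite mulf_eq0 sqrf_eq0 mulf_eq0 invr_eq0 (gt_eqF c1) orbF.
by rewrite (@gt_eqF _ _ (c + 2)) ?orbF ?ltr_wpDl// => /eqP.
Qed.

Lemma continuous_form (R : realType) (n : nat) (A : 'M[R]_n) :
  continuous (fun u : 'rV[R]_n => dot (u *m A) u).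
Proof.
move=> u; apply: differentiable_continuous.
have c : Ck 0 [set: 'rV[R]_n] (fun u : 'rV[R]_n => dot (u *m A) u).
  have cid : Ck 0 [set: 'rV[R]_n] (fun u : 'rV[R]_n => u).
    by apply/(Ck_mxP _ _ openT) => i j; exact: Ck_coord.
  apply: (Ck_dot openT) => //; apply: (Ck_mulmx openT) => //; exact: Ck_cst.
exact: (Ck_diff c I).
Qed.

(** At a maximum [l] of the quotient of the two forms, l G - B is nonnegative and vanishes on [u],
    so [psd_null] makes [u] a generalized eigenvector. *)
Lemma rayleigh (R : realType) (n : nat) (G B : 'M[R]_n.+1) :
  G^T = G -> B^T = B -> (forall u : 'rV[R]_n.+1, u != 0 -> 0 < dot (u *m G) u) ->
  exists (u : 'rV[R]_n.+1) (l : R), dot (u *m G) u = 1 /\ u *m B = l *: (u *m G).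
Proof.
move=> sG sB pG.
(* The quotient is homogeneous of degree zero, so the unit sphere of the sup norm serves as well as
   a Euclidean one. *)
pose S := [set u : 'rV[R]_n.+1 | `|u| = 1].
have cS : compact S.
  have cl : closed S.
    have -> : S = Num.norm @^-1` [set 1] by [].
    by apply: closed_comp; [move=> u _; exact: norm_continuous|exact: closed_eq].
  have -> : S = S `&` [set u | `|u - 0| <= 1].
    by apply/seteqP; split=> [u uS|u []//]; split=> //=; rewrite subr0 uS.
  by rewrite setIC; apply: compact_closedI => //; exact: ball_compact.
have S0 : S !=set0.
  exists (const_mx 1); apply: le_anti; apply/andP; split.
    by apply: mx_norm_le => // i j; rewrite mxE normr1.
  by have := le_mx_norm (const_mx 1 : 'rV[R]_n.+1) 0 0; rewrite mxE normr1.
have Sn u : S u -> u != 0.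
  by move=> uS; apply/eqP => u0; move: uS; rewrite /S /= u0 normr0 => /eqP; rewrite eq_sym oner_eq0.
have [] := @EVT_max_rV R n.+1 (fun u => dot (u *m B) u / dot (u *m G) u) S S0 cS.
  apply: continuous_in_subspaceT => u /set_mem uS.
  have cB := @continuous_form R n.+1 B u; have cG := @continuous_form R n.+1 G u.
  by apply: (cvgM cB (cvgV _ cG)); rewrite gt_eqF// pG// Sn.
move=> u /set_mem uS umax; set l := _ / _ in umax.
have u0 := Sn u uS; have q0 := pG u u0.
have le v : dot (v *m B) v <= l * dot (v *m G) v.
  have [->|v0] := eqVneq v 0; first by rewrite !mul0mx !dot0l mulr0.
  have vS : S (`|v|^-1 *: v).
    by rewrite /S /= normrZ ger0_norm ?invr_ge0// mulVf// normr_eq0.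
  have := umax _ (mem_set vS).
  rewrite -!scalemxAl !dotZl !dotZr -mulf_div divff ?mul1r; last first.
    by rewrite invr_eq0 normr_eq0.
  rewrite -mulf_div divff ?mul1r ?invr_eq0 ?normr_eq0//.
  by rewrite ler_pdivrMr// pG.
have uC : u *m (l *: G - B) = 0.
  apply: psd_null.
  - by rewrite linearB/= linearZ/= sG sB.
  - by move=> v; rewrite mulmxBr -scalemxAr dotBl dotZl subr_ge0.
  rewrite mulmxBr -scalemxAr dotBl dotZl /l divfK ?subrr//.
  by rewrite gt_eqF.
pose s := (Num.sqrt (dot (u *m G) u))^-1.
exists (s *: u), l; split.
  rewrite -scalemxAl dotZl dotZr mulrA -expr2 /s exprVn sqr_sqrtr ?ltW//.
  by rewrite mulVf// gt_eqF.
rewrite -!scalemxAl scalerA mulrC -scalerA; congr (_ *: _).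
by move: uC; rewrite mulmxBr -scalemxAr => /eqP; rewrite subr_eq0 => /eqP.
Qed.

Lemma ortho_complement (R : fieldType) (n : nat) (w : 'cV[R]_n.+1) : w != 0 ->
  exists2 N : 'M[R]_(n, n.+1), row_free N & N *m w = 0.
Proof.
move=> w0; pose K := kermx w.
have wt : w^T != 0 by apply: contra w0 => /eqP h; rewrite -[w]trmxK h trmx0.
have e : \rank K = n by rewrite mxrank_ker -mxrank_tr rank_rV wt subn1.
have fK := row_base_free K.
have K0 : row_base K *m w = 0 by apply/sub_kermxP; rewrite eq_row_base.
by move: (row_base K) fK K0; rewrite e => N fN N0; exists N.
Qed.

(** For an eigenvector with u B = l u G, the complement orthogonal to [u] for [G] is also orthogonal
    to it for [B], so both forms split and the induction runs on the complement. *)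
Theorem simultaneous_diag (R : realType) (n : nat) (G B : 'M[R]_n) :
  G^T = G -> B^T = B -> (forall u : 'rV[R]_n, u != 0 -> 0 < dot (u *m G) u) ->
  exists (P : 'M[R]_n) (d : 'rV[R]_n),
    P *m G *m P^T = 1%:M /\ P *m B *m P^T = diag_mx d.
Proof.
elim: n G B => [|n IH] G B sG sB pG.
  by exists 0, 0; split; apply/matrixP => -[].
have [u [l [u1 uB]]] := rayleigh sG sB pG.
have w0 : G *m u^T != 0.
  apply/eqP => w0; move: u1; rewrite /dot -mulmxA w0 mulmx0 mxE => /eqP.
  by rewrite eq_sym oner_eq0.
have [N fN N0] := ortho_complement w0.
have uGN : u *m G *m N^T = 0 by apply: trmx_inj; rewrite trmx_mul trmxK trmx_mul sG N0 trmx0.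
have [|||P' [d' [PG PB]]] := IH (N *m G *m N^T) (N *m B *m N^T).
- by rewrite !trmx_mul trmxK sG mulmxA.
- by rewrite !trmx_mul trmxK sB mulmxA.
- move=> v v0; rewrite !mulmxA dot_mulmxl trmxK; apply: pG.
  apply: contra v0 => /eqP vN; apply/eqP; apply: (row_free_inj fN).
  by rewrite vN mul0mx.
exists (col_mx u (P' *m N) : 'M[R]_n.+1), (row_mx l%:M d' : 'rV[R]_n.+1).
have u1' : u *m G *m u^T = 1%:M by apply/matrixP => i j; rewrite !ord1 [RHS]mxE.
have NuG : P' *m N *m G *m u^T = 0 by rewrite -!mulmxA N0 mulmx0.
split.
  rewrite [LHS](_ : _ = (col_mx u (P' *m N)) *m G *m (col_mx u (P' *m N))^T)//.
  rewrite mul_col_mx tr_col_mx mul_col_row u1' NuG trmx_mul mulmxA uGN mul0mx.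
  rewrite !mulmxA -[P' *m N *m G]mulmxA -[P' *m (N *m G) *m N^T]mulmxA PG.
  by rewrite -scalar_mx_block.
rewrite [LHS](_ : _ = (col_mx u (P' *m N)) *m B *m (col_mx u (P' *m N))^T)//.
rewrite mul_col_mx tr_col_mx mul_col_row.
have -> : u *m B *m u^T = l%:M by rewrite uB -scalemxAl u1' scalemx1.
have E1 : u *m B *m (P' *m N)^T = 0.
  by rewrite uB -scalemxAl trmx_mul mulmxA uGN mul0mx scaler0.
have -> : P' *m N *m B *m u^T = 0.
  by apply: trmx_inj; rewrite !trmx_mul trmxK sB trmx0 -trmx_mul mulmxA.
rewrite E1 trmx_mul !mulmxA -[P' *m N *m B]mulmxA -[P' *m (N *m B) *m N^T]mulmxA PB.
transitivity (block_mx (diag_mx (l%:M : 'rV[R]_1)) 0 0 (diag_mx d')); last first.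
  by rewrite -diag_mx_row.
rewrite (_ : diag_mx (l%:M : 'rV[R]_1) = l%:M)//.
by apply/matrixP => i j; rewrite !ord1 !mxE eqxx !mulr1n.
Qed.

Lemma jacobian_dot_cst (R : realType) (n m : nat) (f : 'rV[R]_n -> 'rV[R]_m)
    (p : 'rV[R]_n) (c : R) :
  differentiable f p -> (\forall q \near p, dot (f q) (f q) = c) ->
  jacobian f p *m (f p)^T = 0.
Proof.
move=> df fc; apply/matrixP => i j; rewrite ord1 [RHS]mxE.
have dfb b : differentiable (fun q => f q 0 b) p.
  exact: ((differentiable_mxP _ _).1 df 0 b).
have H : partial i (fun q => \sum_b f q 0 b * f q 0 b) p = 0.
  rewrite (@partial_near_eq _ _ _ i _ (fun=> c)) ?partial_cst//.
  by apply: filterS fc => q; rewrite dotE.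
rewrite (@partial_sum _ _ _ i _ (fun b q => f q 0 b * f q 0 b)) in H; last first.
  by move=> b; apply: differentiableM; exact: dfb.
have E b : partial i (fun q => f q 0 b * f q 0 b) p = 2 * (jacobian f p i b * f p 0 b).
  rewrite (partialM i (dfb b) (dfb b)) -(partial_mxE i 0 b df) -(row_jacobian i df).
  by rewrite [row _ _ _ _]mxE [f p 0 b * _]mulrC -mulr2n mulr_natl.
have {}H : 2 * \sum_b jacobian f p i b * f p 0 b = 0.
  rewrite -[RHS]H [LHS]mulr_sumr; apply: eq_bigr => b _.
  by rewrite E.
move/eqP: H; rewrite mulf_eq0 pnatr_eq0/= => /eqP H.
rewrite mxE -[RHS]H; apply: eq_bigr => b _.
by congr (_ * _); rewrite mxE.
Qed.

Local Opaque partial jacobian.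

(** * The Gauss equation *)

Lemma sum_exchange_mul (R : comPzRingType) (n m : nat) (a : 'I_n -> R) (b : 'I_n -> 'I_m -> R)
  (c : 'I_m -> R) :
  \sum_l a l * (\sum_s b l s * c s) = \sum_s (\sum_l a l * b l s) * c s.
Proof.
under eq_bigr do rewrite mulr_sumr.
rewrite exchange_big; apply: eq_bigr => s _; rewrite mulr_suml.
by apply: eq_bigr => l _; rewrite mulrA.
Qed.

(** The rows of [J] together with [N] form a basis. The second conclusion writes the identity as the
    sum of the tangential and the normal projection. *)
Lemma hypersurface_frame_unit (R : realType) (n : nat) (J : 'M[R]_(n, n.+1))
    (N : 'rV[R]_n.+1) :
  row_free J -> dot N N = 1 -> J *m N^T = 0 ->
  [/\ J *m J^T \in unitmx,
      J^T *m invmx (J *m J^T) *m J + N^T *m N = 1%:M &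
      (forall m (V : 'M[R]_(m, n.+1)), V *m J^T = 0 -> V *m N^T = 0 -> V = 0)].
Proof.
move=> fJ N1 JN.
have NN : N *m N^T = 1%:M.
  by apply/matrixP => i j; rewrite !ord1 [RHS]mxE -N1.
have NJ : N *m J^T = 0 by apply: trmx_inj; rewrite trmx_mul trmxK trmx0.
have dot0 (v : 'rV[R]_n.+1) : v *m v^T = 0 -> v = 0.
  move=> /matrixP/(_ 0 0); rewrite !mxE => /eqP; rewrite psumr_eq0; last first.
    by move=> i _; rewrite mxE -expr2 sqr_ge0.
  move=> /allP H; apply/matrixP => a b; rewrite ord1 mxE.
  by have := H b (mem_index_enum _); rewrite /= mxE -expr2 sqrf_eq0 => /eqP.
have uG : J *m J^T \in unitmx.
  apply: unitmx_row_inj => v vG.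
  have vJ : v *m J = 0.
    by apply: dot0; rewrite trmx_mul mulmxA -[v *m J *m J^T]mulmxA vG mul0mx.
  by apply: (row_free_inj fJ); rewrite vJ mul0mx.
have K : col_mx N J \in unitmx.
  apply: (unitmx_row_inj (A := (col_mx N J : 'M[R]_n.+1))) => v.
  pose u : 'rV[R]_(1 + n) := v.
  have -> : v *m (col_mx N J : 'M[R]_n.+1) = lsubmx u *m N + rsubmx u *m J.
    by rewrite -mul_row_col hsubmxK.
  move=> vE.
  have E1 : lsubmx u = 0.
    have /(congr1 (mulmx^~ N^T)) := vE.
    by rewrite mulmxDl -!mulmxA NN JN mulmx0 mulmx1 addr0 mul0mx.
  have E2 : rsubmx u = 0.
    apply: (row_free_inj fJ); move: vE; rewrite E1 mul0mx add0r => ->.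
    by rewrite mul0mx.
  by rewrite -[v]/u -[u]hsubmxK E1 E2 row_mx0.
have inj m (V : 'M[R]_(m, n.+1)) : V *m J^T = 0 -> V *m N^T = 0 -> V = 0.
  move=> VJ VN.
  have : V *m (col_mx N J)^T = 0 by rewrite tr_col_mx mul_mx_row VJ VN row_mx0.
  move=> /(congr1 (mulmx^~ (invmx (col_mx N J)^T))).
  by rewrite mulmxK ?unitmx_tr// mul0mx.
split=> //.
apply/eqP; rewrite -subr_eq0; apply/eqP; apply: inj.
  rewrite mulmxBl mulmxDl mul1mx -!mulmxA NJ mulmx0 addr0.
  by rewrite mulVmx// mulmx1 subrr.
by rewrite mulmxBl mulmxDl mul1mx -!mulmxA NN JN !mulmx0 add0r mulmx1 subrr.
Qed.

Section GaussEquation.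
Context (R : realType) (n : nat).
Variables (U : set 'rV[R]_n) (X N : 'rV[R]_n -> 'rV[R]_n.+1) (G : 'rV[R]_n -> 'M[R]_n).
Hypotheses (oU : open U) (sX : smooth_on U X) (sN : smooth_on U N).
Hypothesis fX : forall p, U p -> row_free (jacobian X p).
Hypothesis GE : forall p, U p -> G p = jacobian X p *m (jacobian X p)^T.
Hypothesis N1 : forall p, U p -> dot (N p) (N p) = 1.
Hypothesis XN : forall p, U p -> jacobian X p *m (N p)^T = 0.

Let x (a : 'I_n.+1) (q : 'rV[R]_n) : R := X q 0 a.
Let nu (a : 'I_n.+1) (q : 'rV[R]_n) : R := N q 0 a.
Let B (p : 'rV[R]_n) := jacobian N p *m (jacobian X p)^T.

Let sx a : smooth_on U (x a).
Proof. exact: ((smooth_on_mxP _ oU).1 sX 0 a). Qed.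
Let sn a : smooth_on U (nu a).
Proof. exact: ((smooth_on_mxP _ oU).1 sN 0 a). Qed.

Let jXE p i a : U p -> jacobian X p i a = partial i (x a) p.
Proof.
move=> Up; have dX := smooth_on_diff sX Up.
by rewrite -(partial_mxE i 0 a dX) -(row_jacobian i dX) [RHS]mxE.
Qed.
Let jNE p i a : U p -> jacobian N p i a = partial i (nu a) p.
Proof.
move=> Up; have dX := smooth_on_diff sN Up.
by rewrite -(partial_mxE i 0 a dX) -(row_jacobian i dX) [RHS]mxE.
Qed.

(** The Christoffel symbols of the first kind, as the products <d_i d_j X, d_m X>. *)
Let C (i j m : 'I_n) (p : 'rV[R]_n) : R :=
  \sum_a partial i (partial j (x a)) p * partial m (x a) p.

Let nearU (V : normedModType R) (f g : 'rV[R]_n -> V) p :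
  U p -> (forall q, U q -> f q = g q) -> \forall q \near p, f q = g q.
Proof.
move=> Up fg; have : nbhs p U by exact: open_nbhs_nbhs.
by apply: filterS => q; exact: fg.
Qed.

Let young (f : 'rV[R]_n -> R) i j p : smooth_on U f -> U p ->
  partial i (partial j f) p = partial j (partial i f) p.
Proof.
move=> sf Up; apply: partial_partialC.
- have : nbhs p U by exact: open_nbhs_nbhs.
  by apply: filterS => q; exact: smooth_on_diff.
- exact: (smooth_on_partial_diff _ sf Up).
- exact: (smooth_on_partial_diff _ sf Up).
Qed.

Let dsx a i p : U p -> differentiable (partial i (x a)) p.
Proof. by move=> Up; exact: (smooth_on_partial_diff _ (sx a) Up). Qed.
Let ddsx a i j p : U p -> differentiable (partial i (partial j (x a))) p.
Proof.
by move=> Up; exact: (smooth_on_partial_diff _ (smooth_on_partial j (sx a)) Up).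
Qed.
Let dn a p : U p -> differentiable (nu a) p.
Proof. by move=> Up; exact: (smooth_on_diff (sn a) Up). Qed.

Let partial_dot (f g : 'I_n.+1 -> 'rV[R]_n -> R) k p :
  (forall a, differentiable (f a) p) -> (forall a, differentiable (g a) p) ->
  partial k (fun q => \sum_a f a q * g a q) p =
  \sum_a partial k (f a) p * g a p + \sum_a f a p * partial k (g a) p.
Proof.
move=> df dg.
rewrite (@partial_sum _ _ _ k n.+1 (fun a q => f a q * g a q)); last first.
  by move=> a; exact: differentiableM.
by rewrite -big_split; apply: eq_bigr => a _; rewrite partialM.
Qed.

Let gE p i j : U p -> G p i j = \sum_a partial i (x a) p * partial j (x a) p.
Proof.
move=> Up; rewrite GE// mxE; apply: eq_bigr => a _.
by congr (_ * _); [exact: (jXE i a Up)|rewrite mxE; exact: (jXE j a Up)].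
Qed.

Let dg p k i j : U p ->
  partial k (fun q => G q i j) p = C k i j p + C k j i p.
Proof.
move=> Up.
rewrite (@partial_near_eq _ _ _ k _ (fun q => \sum_a partial i (x a) q * partial j (x a) q)); last first.
  by apply: nearU => // q; exact: gE.
rewrite (@partial_dot (fun a => partial i (x a)) (fun a => partial j (x a))) => [|a|a]; try exact: dsx.
congr (_ + _); apply: eq_bigr => a _; exact: mulrC.
Qed.

Let Csym i j m p : U p -> C i j m p = C j i m p.
Proof. by move=> Up; apply: eq_bigr => a _; rewrite (young i j (sx a) Up). Qed.

(** Each derivative of the metric is a sum of two values of [C]; by symmetry in the first two
    indices four of the six cancel and the other two agree. *)
Lemma christoffelE l i j p : U p ->
  christoffel G l i j p = \sum_m invmx (G p) l m * C i j m p.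
Proof.
move=> Up; rewrite /christoffel mulr_sumr; apply: eq_bigr => m _.
rewrite (dg i j m Up) (dg j i m Up) (dg m i j Up).
rewrite (Csym j i m Up) (Csym j m i Up) (Csym i m j Up).
have E (a c d e : R) : 2^-1 * (a * (c + d + (c + e) - (d + e))) = a * c by field.
exact: E.
Qed.

Let frame p : U p -> [/\ G p \in unitmx,
   (jacobian X p)^T *m invmx (G p) *m jacobian X p + (N p)^T *m N p = 1%:M &
   (forall m (V : 'M[R]_(m, n.+1)), V *m (jacobian X p)^T = 0 -> V *m (N p)^T = 0 -> V = 0)].
Proof. by move=> Up; rewrite GE//; apply: hypersurface_frame_unit; [exact: fX|exact: N1|exact: XN]. Qed.

Let BE p i j : U p -> B p i j = \sum_a partial i (nu a) p * partial j (x a) p.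
Proof.
move=> Up; rewrite /B mxE; apply: eq_bigr => a _.
by congr (_ * _); [exact: (jNE i a Up)|rewrite mxE; exact: (jXE j a Up)].
Qed.

Let XN0 p i : U p -> \sum_a partial i (x a) p * nu a p = 0.
Proof.
move=> Up; transitivity ((jacobian X p *m (N p)^T) i 0); last by rewrite XN// mxE.
rewrite [RHS]mxE; apply: eq_bigr => a _; congr (_ * _); last by rewrite mxE.
by apply/esym; exact: (jXE i a Up).
Qed.

Let BN p i j : U p -> B p i j = - \sum_a partial i (partial j (x a)) p * nu a p.
Proof.
move=> Up; rewrite BE//.
have : partial i (fun q => \sum_a partial j (x a) q * nu a q) p = 0.
  rewrite (@partial_near_eq _ _ _ i _ (fun=> 0)) ?partial_cst//.
  by apply: nearU => // q; exact: XN0.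
rewrite (@partial_dot (fun a => partial j (x a)) nu) => [/eqP|a|a]; [|exact: dsx|exact: dn].
rewrite addrC addr_eq0 => /eqP <-.
by apply: eq_bigr => a _; exact: mulrC.
Qed.

Lemma second_fundamental_sym p : U p -> (B p)^T = B p.
Proof.
move=> Up; apply/matrixP => i j.
rewrite [LHS]mxE.
rewrite (BN j i Up).
rewrite (BN i j Up).
apply: (congr1 (fun z : R => - z)); apply: eq_bigr => a _.
by rewrite (young j i (sx a) Up).
Qed.

(** The second derivatives of [X] are split into tangential and normal parts. The sign of the [B]
    term reflects the convention B = <d nu, dX> = - <nu, d d X>. *)
Let gauss_formula i j a p : U p ->
  \sum_l christoffel G l i j p * partial l (x a) p =
  partial i (partial j (x a)) p + B p i j * nu a p.
Proof.
move=> Up; have [uG pr _] := frame Up.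
pose v : 'rV[R]_n.+1 := \row_a partial i (partial j (x a)) p.
have vJ m : (v *m (jacobian X p)^T) 0 m = C i j m p.
  rewrite mxE; apply: eq_bigr => b _.
  by rewrite [v 0 b]mxE [X in _ * X]mxE (jXE m b Up).
have vN : v *m (N p)^T = (- B p i j)%:M.
  apply/matrixP => b c; rewrite !ord1 [RHS]mxE (BN i j Up) opprK [LHS]mxE.
  by apply: eq_bigr => d _; rewrite [v 0 d]mxE [X in _ * X]mxE.
have Gs : (invmx (G p))^T = invmx (G p).
  by rewrite trmx_inv; congr invmx; rewrite GE// trmx_mul trmxK.
have chr l : christoffel G l i j p = (v *m (jacobian X p)^T *m invmx (G p)) 0 l.
  rewrite (christoffelE l i j Up) [RHS]mxE; apply: eq_bigr => m _.
  by rewrite vJ mulrC; congr (_ * _); rewrite -{1}Gs mxE.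
have : v = v *m (jacobian X p)^T *m invmx (G p) *m jacobian X p + (- B p i j) *: N p.
  rewrite -{1}[v]mulmx1 -pr mulmxDr !mulmxA vN.
  by rewrite mul_scalar_mx.
move=> /matrixP/(_ 0 a); rewrite [v 0 a]mxE [RHS]mxE => ->.
rewrite [X in _ + X + _]mxE mulNr subrK [RHS]mxE.
by apply: eq_bigr => l _; rewrite chr (jXE l a Up).
Qed.

Let smooth_gamma l i j : smooth_on U (christoffel G l i j).
Proof.
apply: (@smooth_on_ext _ _ _ _ (fun p => \sum_m invmx (jacobian X p *m (jacobian X p)^T) l m * C i j m p)) => //.
  by move=> p Up; rewrite christoffelE// GE.
apply/smooth_onP => k; apply: Ck_sum => // m _; apply: CkM => //.
  apply: Ck_invmx => //.
    by move=> p Up; have [] := frame Up; rewrite GE.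
  apply/(Ck_mxP _ _ oU); apply: Ck_mulmx => //.
    by have /smooth_onP := smooth_on_jacobian oU sX.
  apply/(Ck_mxP _ _ oU) => a b.
  have /smooth_onP/(_ k)/(Ck_mxP _ _ oU)/(_ b a) := smooth_on_jacobian oU sX.
  by apply: Ck_ext => // q _; rewrite [RHS]mxE.
apply: Ck_sum => // a _; apply: CkM => //.
  exact: ((smooth_onP _ _).1 (smooth_on_partial i (smooth_on_partial j (sx a))) k).
exact: ((smooth_onP _ _).1 (smooth_on_partial m (sx a)) k).
Qed.

Let dgamma l i j p : U p -> differentiable (christoffel G l i j) p.
Proof. by move=> Up; exact: (smooth_on_diff (smooth_gamma l i j) Up). Qed.

Let dB i j p : U p -> differentiable (fun q => B q i j) p.
Proof.
move=> Up.
apply: (@differentiable_near_eq _ _ _ (fun q => \sum_a partial i (nu a) q * partial j (x a) q)).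
  by apply: nearU => // q Uq; rewrite (BE i j Uq).
apply: differentiable_bigsum => a; apply: differentiableM; last exact: dsx.
exact: (smooth_on_partial_diff _ (sn a) Up).
Qed.

(** Gauss's formula is differentiated along d_k and paired with d_m X; the derivative of [B] drops
    out because nu is normal. The third derivative that remains is symmetric in [k] and [i], hence
    disappears from the curvature. *)
Let curv k i j m p : U p ->
  \sum_l (partial k (christoffel G l i j) p +
          \sum_s christoffel G s i j p * christoffel G l k s p) * G p l m =
  \sum_a partial k (partial i (partial j (x a))) p * partial m (x a) p
  + B p i j * B p k m.
Proof.
move=> Up.
have E a : \sum_l (partial k (christoffel G l i j) p * partial l (x a) p
      + christoffel G l i j p * partial k (partial l (x a)) p) =
    partial k (partial i (partial j (x a))) p +
      (partial k (fun q => B q i j) p * nu a p + B p i j * partial k (nu a) p).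
  rewrite -partialM//; [|exact: dB|exact: dn].
  rewrite -partialD//; [|exact: ddsx|by apply: differentiableM; [exact: dB|exact: dn]].
  rewrite -(@partial_near_eq _ _ _ k (fun q => \sum_l christoffel G l i j q * partial l (x a) q)); last first.
    by apply: nearU => // q; exact: gauss_formula.
  rewrite (@partial_sum _ _ _ k n (fun l q => christoffel G l i j q * partial l (x a) q)).
    by apply: eq_bigr => l _; rewrite partialM//; [exact: dgamma|exact: dsx].
  by move=> l; apply: differentiableM; [exact: dgamma|exact: dsx].
have Cg l : C k l m p = \sum_s christoffel G s k l p * G p s m.
  transitivity (\sum_a (\sum_s christoffel G s k l p * partial s (x a) p) * partial m (x a) p).
    transitivity (\sum_a (partial k (partial l (x a)) p * partial m (x a) p
        + B p k l * (partial m (x a) p * nu a p))).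
      by rewrite big_split/= -mulr_sumr (XN0 m Up) mulr0 addr0.
    have E4 (a b c d : R) : a * c + b * (c * d) = (a + b * d) * c by ring.
    by apply: eq_bigr => a _; rewrite (gauss_formula k l a Up) E4.
  rewrite -sum_exchange_mul; apply: eq_bigr => s _; congr (_ * _).
  by rewrite gE.
transitivity (\sum_a (\sum_l (partial k (christoffel G l i j) p * partial l (x a) p
      + christoffel G l i j p * partial k (partial l (x a)) p)) * partial m (x a) p).
  under [RHS]eq_bigr do rewrite mulr_suml.
  rewrite exchange_big/=.
  transitivity (\sum_l (partial k (christoffel G l i j) p * G p l m
       + christoffel G l i j p * C k l m p)).
    rewrite [RHS]big_split/=; under [LHS]eq_bigr do rewrite mulrDl.
    rewrite [LHS]big_split/=; congr (_ + _).
    under [RHS]eq_bigr do rewrite Cg.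
    by rewrite sum_exchange_mul.
  have E4 (a b c d e : R) : (a * b + d * e) * c = a * (b * c) + d * (e * c) by ring.
  apply: eq_bigr => l _; rewrite (gE l m Up) /C !mulr_sumr -big_split/=.
  by apply: eq_bigr => a _; rewrite E4.
under eq_bigr do rewrite E mulrDl.
rewrite big_split/=; congr (_ + _).
transitivity (\sum_a (partial k (fun q => B q i j) p * (partial m (x a) p * nu a p)
   + B p i j * (partial k (nu a) p * partial m (x a) p))).
  have E4 (a b c d e : R) : (a * b + d * e) * c = a * (c * b) + d * (e * c) by ring.
  by apply: eq_bigr => a _; rewrite E4.
by rewrite big_split/= -!mulr_sumr (XN0 m Up) mulr0 add0r -(BE k m Up).
Qed.

Lemma riemann_hypersurface l i j k p : U p ->
  riemann G l i j k p =
  \sum_m (B p j k * B p i m - B p i k * B p j m) * invmx (G p) m l.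
Proof.
move=> Up; have [uG _ _] := frame Up.
pose r : 'rV[R]_n := \row_l riemann G l i j k p.
pose w : 'rV[R]_n := \row_m (B p j k * B p i m - B p i k * B p j m).
have rG : r *m G p = w.
  apply/matrixP => a m; rewrite [RHS]mxE [LHS]mxE.
  under eq_bigr do rewrite [r _ _]mxE.
  transitivity (
    \sum_l (partial i (christoffel G l j k) p +
          \sum_s christoffel G s j k p * christoffel G l i s p) * G p l m -
    \sum_l (partial j (christoffel G l i k) p +
          \sum_s christoffel G s i k p * christoffel G l j s p) * G p l m).
    rewrite -sumrB; apply: eq_bigr => q _; rewrite -mulrBl; congr (_ * _).
    have E4 (s t u v : R) : s - t + (u - v) = s + u - (t + v) by ring.
    by rewrite /riemann sumrB; exact: E4.
  rewrite (curv i j k m Up) (curv j i k m Up).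
  have E4 (s s' t u : R) : s = s' -> s + t - (s' + u) = t - u by move=> ->; ring.
  apply: E4; apply: eq_bigr => b _.
  by rewrite (young i j (smooth_on_partial k (sx b)) Up).
have : r = w *m invmx (G p) by rewrite -rG mulmxK.
move=> /matrixP/(_ 0 l); rewrite mxE [RHS]mxE => ->.
by apply: eq_bigr => m _; rewrite [w _ _]mxE.
Qed.

Theorem ricci_hypersurface p : U p ->
  ricci G p = \tr (B p *m invmx (G p)) *: B p - B p *m invmx (G p) *m B p.
Proof.
move=> Up; apply/matrixP => j k; rewrite [LHS]mxE.
under eq_bigr do rewrite (riemann_hypersurface _ _ _ _ Up).
transitivity (\sum_i (\sum_m B p i m * invmx (G p) m i * B p j k
   - (\sum_m B p j m * invmx (G p) m i) * B p i k)).
  apply: eq_bigr => i _; rewrite mulr_suml -sumrB; apply: eq_bigr => m _; ring.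
have E2 (Y Z : 'M[R]_n) : (Y - Z) j k = Y j k - Z j k by rewrite !mxE.
have E3 (t : R) (Y : 'M[R]_n) : (t *: Y) j k = t * Y j k by rewrite mxE.
have E5 (Y Z : 'M[R]_n) a b : (Y *m Z) a b = \sum_c Y a c * Z c b by rewrite mxE.
rewrite sumrB E2 E3 E5; congr (_ - _).
  rewrite mulr_suml; apply: eq_bigr => i _; rewrite E5 mulr_suml.
  by apply: eq_bigr.
by apply: eq_bigr => i _; rewrite E5.
Qed.

End GaussEquation.

(** * Hypersurfaces *)

Lemma open_chart_img (R : realType) (n : nat) (M : topologicalType) (c : chart R n M) :
  open (chart_img c).
Proof. exact: chart_img_open. Qed.

Arguments open_chart_img {R n M} c.

Lemma tangent_expand (R : realType) (n m : nat) (J : 'M[R]_(n, n.+1))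
    (N : 'rV[R]_n.+1) (D : 'M[R]_(m, n.+1)) :
  row_free J -> dot N N = 1 -> J *m N^T = 0 -> D *m N^T = 0 ->
  D = D *m J^T *m invmx (J *m J^T) *m J.
Proof.
move=> fJ N1 JN DN; have [_ pr _] := hypersurface_frame_unit fJ N1 JN.
by rewrite -{1}[D]mulmx1 -pr mulmxDr !mulmxA DN mul0mx addr0.
Qed.

Section LocalGeometry.
Context (R : realType) (n : nat) (M : manifold R n) (g : riem_metric M)
  (X nu : M -> 'rV[R]_n.+1).
Hypotheses (hX : isometric_immersion g X) (hnu : unit_normal X nu).
Variables (a : atlas M) (p : 'rV[R]_n).
Hypothesis ap : chart_img (chart_of a) p.

Lemma second_form_sym : (second_form X nu a p)^T = second_form X nu a p.
Proof.
have [sX HX] := hX; have [sn n1 Xn] := hnu.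
apply: (@second_fundamental_sym R n _ (local_expr X a) (local_expr nu a) (open_chart_img (chart_of a)) (sX a) (sn a)) => //.
by move=> q aq; exact: Xn.
Qed.

Lemma ricci_second_form : ricci (g a) p =
  \tr (second_form X nu a p *m invmx (g a p)) *: second_form X nu a p
  - second_form X nu a p *m invmx (g a p) *m second_form X nu a p.
Proof.
have [sX HX] := hX; have [sn n1 Xn] := hnu.
apply: (@ricci_hypersurface R n _ (local_expr X a) (local_expr nu a) (g a)
  (open_chart_img (chart_of a)) (sX a) (sn a)).
- by move=> q aq; have [] := HX a q aq.
- by move=> q aq; have [] := HX a q aq.
- by move=> q aq; exact: n1.
- by move=> q aq; exact: Xn.
- exact: ap.
Qed.

Lemma gram_unit : g a p \in unitmx.
Proof.
have [sX HX] := hX; have [sn n1 Xn] := hnu; have [fJ gE] := HX a p ap.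
rewrite gE; have [] := hypersurface_frame_unit fJ (n1 (chart_param (chart_of a) p)) (Xn a p ap).
by [].
Qed.

(** As |nu| = 1, its derivative is orthogonal to nu, hence tangent, and is determined by its
    products with dX. *)
Lemma weingarten : diff_mx nu a p =
  second_form X nu a p *m invmx (g a p) *m diff_mx X a p.
Proof.
have [sX HX] := hX; have [sn n1 Xn] := hnu; have [fJ gE] := HX a p ap.
rewrite gE; apply: (tangent_expand fJ (n1 (chart_param (chart_of a) p)) (Xn a p ap)).
apply: (@jacobian_dot_cst _ _ _ (local_expr nu a) p 1 (smooth_on_diff (sn a) ap)).
apply: filterS (open_nbhs_nbhs (conj (open_chart_img (chart_of a)) ap)) => q _.
exact: n1.
Qed.

Lemma third_form : diff_mx nu a p *m (diff_mx nu a p)^T =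
  second_form X nu a p *m invmx (g a p) *m second_form X nu a p.
Proof.
have [sX HX] := hX; have [fJ gE] := HX a p ap.
have E : diff_mx nu a p *m (diff_mx X a p)^T = second_form X nu a p := erefl.
have sg : (invmx (g a p))^T = invmx (g a p) by rewrite trmx_inv gram_sym.
transitivity (diff_mx nu a p *m ((diff_mx X a p)^T *m invmx (g a p) *m second_form X nu a p)).
  by congr (_ *m _); rewrite weingarten trmx_mul trmx_mul sg second_form_sym mulmxA.
by rewrite !mulmxA E.
Qed.

End LocalGeometry.

(** The rows of [P] are an orthonormal frame for [G]; in it the tensor norm becomes the Euclidean
    norm of the matrix entries. *)
Lemma form_norm_diag (R : realType) (n : nat) (G T P : 'M[R]_n) (d : 'rV[R]_n) :
  P *m G *m P^T = 1%:M -> P *m T *m P^T = diag_mx d ->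
  invmx G = P^T *m P /\ form_norm G T = Num.sqrt (\sum_i d 0 i ^+ 2).
Proof.
move=> PG PT.
have uP : P \in unitmx.
  have : P *m G *m P^T \in unitmx by rewrite PG unitmx1.
  by rewrite !unitmx_mul => /andP[/andP[]].
have uG : G \in unitmx.
  have : P *m G *m P^T \in unitmx by rewrite PG unitmx1.
  by rewrite !unitmx_mul => /andP[/andP[]].
have iG : invmx G = P^T *m P.
  have : G *m (P^T *m P) = 1%:M by rewrite mulmxA; apply: mulmx1C; rewrite mulmxA.
  by move=> /(congr1 (mulmx (invmx G))); rewrite mulKmx// mulmx1.
split=> //; rewrite /form_norm iG; congr Num.sqrt.
transitivity (\tr (diag_mx d *m (diag_mx d)^T)).
  by rewrite -PT !trmx_mul trmxK !mulmxA [RHS]mxtrace_mulC !mulmxA.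
rewrite tr_diag_mx mulmx_diag mxtrace_diag.
by apply: eq_bigr => i _; rewrite mxE expr2.
Qed.

(** Since H x_i >= k / 2 and |H| <= n b, every x_i has the sign of H and size at least m = k / (2 n
    b). This gives |x_i - x_j| <= 2 e / m; replacing H by n x_i in the i-th equation then costs n b
    (2 e / m) = 4 (n b)^2 e / k, the second term of the constant. *)
Lemma pinched_curvatures (R : realType) (n : nat) (k b e : R) (x : 'I_n -> R)
    (H := \sum_i x i) :
  (2 < n)%N -> 0 < k -> 0 <= b -> e <= k / 2 ->
  (forall i, `|x i| <= b) ->
  (forall i, `|H * x i - x i ^+ 2 - k| <= e) ->
  forall i, `|x i ^+ 2 - k / (n%:R - 1)| <= (1 + 4 * (n%:R * b) ^+ 2 / k) * e.
Proof.
move=> n2 k0 b0 ek xb Hx i.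
have n0 : (1 : R) < n%:R - 1 by rewrite ltrBrDr -(natrD _ 1 1) ltr_nat.
have nb0 : 0 <= n%:R * b by rewrite mulr_ge0.
have Hb : `|H| <= n%:R * b.
  rewrite (le_trans (ler_norm_sum _ _ _))//.
  apply: (@le_trans _ _ (\sum_(j < n) b)); first exact: ler_sum.
  by rewrite sumr_const card_ord mulr_natl.
have xH j : k / 2 <= x j * H.
  have := Hx j; rewrite ler_norml => /andP[+ _].
  have := sqr_ge0 (x j); nra.
have H0 : H != 0.
  by apply/eqP => H0; have := xH i; rewrite H0 mulr0 leNgt divr_gt0.
have Hgt : 0 < `|H| by rewrite normr_gt0.
have nbgt : 0 < n%:R * b := lt_le_trans Hgt Hb.
pose s := Num.sg H.
have sH : s * H = `|H| by rewrite /s -normrEsg.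
have s2 : s * s = 1 by rewrite /s -expr2 sqr_sg H0.
pose m := k / (2 * (n%:R * b)).
have m0 : 0 < m by rewrite divr_gt0// mulr_gt0.
have xm j : m <= s * x j.
  have d0 : 0 < 2 * (n%:R * b) by apply: mulr_gt0.
  rewrite /m ler_pdivrMr//.
  have E : s * x j * `|H| = x j * H by rewrite -sH mulrACA s2 mul1r.
  have := xH j; rewrite -E => E1.
  have p0 : 0 <= s * x j.
    rewrite -(pmulr_lge0 _ Hgt) (le_trans _ E1)// divr_ge0// ltW//.
  have := ler_wpM2l p0 Hb; lra.
have e0 : 0 <= e := le_trans (normr_ge0 _) (Hx i).
have dist (p q : 'I_n) : `|x p - x q| <= 2 * e / m.
  have [->|ij] := eqVneq p q.
    by rewrite subrr normr0 divr_ge0 ?(ltW m0)// mulr_ge0.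
  pose S := \sum_(l | (l != p) && (l != q)) x l.
  have HS : H = x p + x q + S.
    by rewrite /H (bigD1 p)//= (bigD1 q) 1?eq_sym//= addrA.
  (* The only place where 2 < n matters essentially: a third index makes the remaining sum [S]
     nonempty. *)
  have [l /andP[li lj]] : exists l, (l != p) && (l != q).
    apply/existsP; apply: contraT; rewrite negb_exists => /forallP H1.
    have : (#|'I_n| <= #|[set p; q]%SET|)%N.
      apply: subset_leq_card; apply/fintype.subsetP => l _.
      by have := H1 l; rewrite negb_and !negbK !inE.
    by rewrite card_ord cards2 leqNgt; case: (p != q) => /=; rewrite ?n2 // (leq_trans _ n2).
  have Sm : m <= s * S.
    rewrite /S mulr_sumr (bigD1 l) ?li ?lj//= (le_trans (xm l))// lerDl.
    by apply: sumr_ge0 => o _; rewrite (le_trans _ (xm o))// ltW.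
  (* Subtracting two of the equations; S is bounded away from 0 since all the
     x l have the sign of H and 2 < n. *)
  have E : (x p - x q) * S = (H * x p - x p ^+ 2 - k) - (H * x q - x q ^+ 2 - k).
    by rewrite HS; ring.
  have : `|(x p - x q) * S| <= e + e.
    by rewrite E (le_trans (ler_normB _ _))// lerD.
  rewrite normrM => E1; rewrite ler_pdivlMr//.
  have Sm' : m <= `|S|.
    have <- : `|s * S| = `|S| by rewrite normrM /s normr_sg H0 mul1r.
    by rewrite (le_trans Sm)// ler_norm.
  have := ler_wpM2l (normr_ge0 (x p - x q)) Sm'; lra.
have Hn : `|H - n%:R * x i| <= n%:R * (2 * e / m).
  have -> : H - n%:R * x i = \sum_j (x j - x i).
    by rewrite sumrB sumr_const card_ord mulr_natl.
  rewrite (le_trans (ler_norm_sum _ _ _))//.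
  apply: (@le_trans _ _ (\sum_(j < n) (2 * e / m))); first exact: ler_sum.
  by rewrite sumr_const card_ord [leRHS]mulr_natl.
have n1 : 0 < n%:R - 1 :> R by rewrite (lt_trans _ n0).
have -> : x i ^+ 2 - k / (n%:R - 1) =
   ((H * x i - x i ^+ 2 - k) - (H - n%:R * x i) * x i) / (n%:R - 1).
  by field; rewrite gt_eqF.
rewrite normrM normfV (gtr0_norm n1) ler_pdivrMr//.
apply: (@le_trans _ _ ((1 + 4 * (n%:R * b) ^+ 2 / k) * e)); last first.
  by rewrite ler_peMr ?(ltW n0)// mulr_ge0// addr_ge0// divr_ge0 ?(ltW k0)// mulr_ge0// sqr_ge0.
rewrite (le_trans (ler_normB _ _))// [leRHS]mulrDl mul1r lerD// normrM.
have -> : 4 * (n%:R * b) ^+ 2 / k * e = n%:R * (2 * e / m) * b.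
  have ngt : (0 : R) < n%:R by rewrite ltr0n (leq_trans _ n2).
  have bgt : 0 < b by rewrite -(pmulr_rgt0 _ ngt).
  by rewrite /m; field; rewrite !gt_eqF.
by apply: ler_pM.
Qed.

(** * Immersions into the sphere *)

(** Stated with neighbourhoods in [T] rather than in the subspace, the form in which continuation
    along segments and over the whole manifold meets it. *)
Lemma connected_clopen (T : topologicalType) (A : set T) (P : T -> Prop) :
  connected A ->
  (forall s, A s -> P s -> \forall t \near s, A t -> P t) ->
  (forall s, A s -> ~ P s -> \forall t \near s, A t -> ~ P t) ->
  (exists2 s, A s & P s) -> forall s, A s -> P s.
Proof.
move=> cA oP oN [s0 As0 Ps0] s As.
have oE (Q : T -> Prop) : open [set s | \forall t \near s, A t -> Q t].
  by rewrite openE => t /= H; exact: nbhs_interior H.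
suff E : [set s | A s /\ P s] = A by have [] : [set s | A s /\ P s] s by rewrite E.
apply: cA.
- by exists s0.
- exists [set s | \forall t \near s, A t -> P t]; first exact: oE.
  apply/seteqP; split=> [t [At Pt]|t [At /= /nbhs_singleton H]].
    by split=> //; exact: oP.
  by split=> //; exact: H.
exists (~` [set s | \forall t \near s, A t -> ~ P t]).
  by apply: open_closedC; exact: oE.
apply/seteqP; split=> t /=.
  by move=> [At Pt]; split=> // /nbhs_singleton; apply.
move=> [At H]; split=> //; apply: contrapT => nP.
by apply: H; exact: oN.
Qed.

Section Charts.
Context (R : realType) (n : nat) (M : manifold R n).

Lemma chart_coord_cvg (a : atlas M) (x : M) : chart_dom (chart_of a) x ->
  {for x, continuous (chart_coord (chart_of a))}.
Proof.
move=> ax; have := @chart_coord_continuous _ _ _ (chart_of a).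
rewrite continuous_open_subspace; last exact: chart_dom_open.
by apply; rewrite inE.
Qed.

Lemma chart_param_cvg (a : atlas M) (p : 'rV[R]_n) : chart_img (chart_of a) p ->
  {for p, continuous (chart_param (chart_of a))}.
Proof.
move=> ap; have := @chart_param_continuous _ _ _ (chart_of a).
rewrite continuous_open_subspace; last exact: chart_img_open.
by apply; rewrite inE.
Qed.

Lemma chart_img_coord (a : atlas M) (x : M) : chart_dom (chart_of a) x ->
  chart_img (chart_of a) (chart_coord (chart_of a) x).
Proof. by move=> ax; exists x. Qed.

Lemma chart_dom_param (a : atlas M) (p : 'rV[R]_n) : chart_img (chart_of a) p ->
  chart_dom (chart_of a) (chart_param (chart_of a) p) /\
  chart_coord (chart_of a) (chart_param (chart_of a) p) = p.
Proof. by move=> [x ax <-]; rewrite chart_coordK. Qed.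

Lemma smooth_map_continuous (m : nat) (f : M -> 'rV[R]_m) :
  smooth_map f -> continuous f.
Proof.
move=> sf x; have [a ax] := atlas_cover x.
have ip := chart_img_coord ax.
have c1 : {for x, continuous (local_expr f a \o chart_coord (chart_of a))}.
  apply: continuous_comp; first exact: chart_coord_cvg.
  exact/differentiable_continuous/(smooth_on_diff (sf a)).
have n1 : \forall y \near x, (local_expr f a \o chart_coord (chart_of a)) y = f y.
  apply: filterS (open_nbhs_nbhs (conj (@chart_dom_open _ _ _ (chart_of a)) ax)) => y ay.
  by rewrite /local_expr /= chart_coordK.
rewrite /continuous_at -(nbhs_singleton n1).
apply: cvg_trans c1; exact: near_eq_cvg n1.
Qed.

End Charts.

Lemma partial_scale (R : realType) (n m : nat) (c : 'rV[R]_n -> R)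
    (f : 'rV[R]_n -> 'rV[R]_m) i x :
  differentiable c x -> differentiable f x ->
  differentiable (fun v => c v *: f v) x /\
  partial i (fun v => c v *: f v) x = partial i c x *: f x + c x *: partial i f x.
Proof.
move=> dc df; have dfb b : differentiable (fun q => f q 0 b) x.
  exact: ((differentiable_mxP _ _).1 df 0 b).
have E (a : 'I_1) b : (fun v => (c v *: f v) a b) = (fun v => c v * f v 0 b).
  by apply/funext => v; rewrite ord1 mxE.
have d : differentiable (fun v => c v *: f v) x.
  by apply/differentiable_mxP => a b; rewrite E; apply: differentiableM; [exact: dc|exact: dfb].
split=> //; apply/matrixP => a b; rewrite ord1 (partial_mxE i 0 b d) E.
by rewrite (partialM i dc (dfb b)) -(partial_mxE i 0 b df) !mxE.
Qed.

Lemma jacobian_scale (R : realType) (n m : nat) (c : R) (f : 'rV[R]_n -> 'rV[R]_m) p :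
  differentiable f p -> jacobian (fun x => c *: f x) p = c *: jacobian f p.
Proof.
move=> df; apply/row_matrixP => i; rewrite row_jacobian.
  have [_] := partial_scale i (differentiable_cst c p) df.
  rewrite partial_cst scale0r add0r => E.
  by apply: (etrans E); rewrite -(row_jacobian i df) linearZ.
by have [] := partial_scale i (differentiable_cst c p) df.
Qed.

Lemma row_unit_jacobian (R : realType) (n m : nat) (f : 'rV[R]_n -> 'rV[R]_m)
    (x w : 'rV[R]_n) : differentiable f x ->
  w *m jacobian f x = \sum_i w 0 i *: partial i f x.
Proof.
move=> df; rewrite mulmx_sum_row; apply: eq_bigr => i _.
by rewrite (row_jacobian i df).
Qed.

(** The differential sends (t, q) to t f(p) + q J. As |f| is constant, f(p) is orthogonal to the
    rows of [J], so both terms vanish together. *)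
Lemma cone_jacobian_unit (R : realType) (n : nat) (f : 'rV[R]_n -> 'rV[R]_n.+1)
    (p : 'rV[R]_n) (r : R) : 0 < r ->
  differentiable f p -> (\forall q \near p, dot (f q) (f q) = r ^+ 2) ->
  row_free (jacobian f p) ->
  jacobian (fun v : 'rV[R]_(1 + n) => v 0 0 *: f (rsubmx v))
    (row_mx 1%:M p) \in unitmx.
Proof.
move=> r0 df fr fJ.
pose v0 : 'rV[R]_(1 + n) := row_mx 1%:M p.
have rv0 : rsubmx v0 = p by rewrite row_mxKr.
have dc : differentiable (fun v : 'rV[R]_(1 + n) => v 0 0) v0 by exact: differentiable_coord.
have dr : differentiable (rsubmx : 'rV[R]_(1 + n) -> 'rV[R]_n) v0.
  exact: differentiable_rsubmx.
have df' : differentiable f (rsubmx v0) by rewrite rv0.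
have dfr : differentiable (fun v : 'rV[R]_(1 + n) => f (rsubmx v)) v0.
  exact: (differentiable_compose dr df').
have d i := (partial_scale i dc dfr).
have d1 : differentiable (fun v : 'rV[R]_(1 + n) => v 0 0 *: f (rsubmx v)) v0.
  by have [] := d 0.
apply: unitmx_row_inj => w.
have -> : w *m jacobian (fun v : 'rV[R]_(1 + n) => v 0 0 *: f (rsubmx v)) v0 =
    w 0 0 *: f p + rsubmx (w : 'rV[R]_(1 + n)) *m jacobian f p.
  rewrite (row_unit_jacobian w d1).
  have v1 : v0 0 0 = 1.
    transitivity (v0 0 (lshift n 0)); first by congr (v0 _ _); exact: val_inj.
    by rewrite row_mxEl mxE.
  transitivity (\sum_i ((w 0 i * partial i (fun v : 'rV[R]_(1 + n) => v 0 0) v0) *: f p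
     + w 0 i *: partial i (fun v : 'rV[R]_(1 + n) => f (rsubmx v)) v0)).
    apply: eq_bigr => i _; have [_ ->] := d i.
    by rewrite v1 rv0 scale1r scalerDr scalerA.
  rewrite big_split/= -scaler_suml sum_partial_coord.
  rewrite -(row_unit_jacobian w dfr) (jacobian_comp dr df') mulmxA rv0.
  congr (_ + _ *m _); apply/matrixP => a b; rewrite ord1.
  rewrite (row_unit_jacobian w dr) summxE [RHS]mxE.
  rewrite -[RHS](sum_partial_coord w v0); apply: eq_bigr => i _.
  rewrite [LHS]mxE (partial_mxE i 0 b dr).
  have -> : (fun v : 'rV[R]_(1 + n) => rsubmx v 0 b) = (fun v => v 0 (rshift 1 b)) => //.
  by apply/funext => v; rewrite mxE.
move=> H.
have fJ0 : jacobian f p *m (f p)^T = 0 by exact: jacobian_dot_cst df fr.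
have ff : f p *m (f p)^T = (r ^+ 2)%:M.
  by apply/matrixP => i j; rewrite !ord1 [RHS]mxE -(nbhs_singleton fr).
have w0 : w 0 0 = 0.
  have := congr1 (mulmx^~ (f p)^T) H.
  rewrite mulmxDl -scalemxAl ff -mulmxA fJ0 mulmx0 addr0 mul0mx scale_scalar_mx.
  move=> /matrixP/(_ 0 0); rewrite !mxE/= mulr1n => /eqP.
  by rewrite mulf_eq0 expf_eq0/= (gt_eqF r0) orbF => /eqP.
have wr : rsubmx (w : 'rV[R]_(1 + n)) = 0.
  by apply: (row_free_inj fJ); move: H; rewrite w0 scale0r add0r => ->; rewrite mul0mx.
have wl : lsubmx (w : 'rV[R]_(1 + n)) = 0.
  apply/matrixP => i j; rewrite !ord1 !mxE -[RHS]w0; congr (w _ _); exact: val_inj.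
have -> : w = row_mx (lsubmx (w : 'rV[R]_(1 + n))) (rsubmx (w : 'rV[R]_(1 + n))).
  by rewrite hsubmxK.
by rewrite wl wr row_mx0.
Qed.

Definition radial (R : realType) (m : nat) (r : R) (z : 'rV[R]_m) : 'rV[R]_m :=
  (r / Num.sqrt (dot z z)) *: z.

Lemma radial_id (R : realType) (m : nat) (r : R) (z : 'rV[R]_m) :
  0 < r -> dot z z = r ^+ 2 -> radial r z = z.
Proof.
by move=> r0 zr; rewrite /radial zr sqrtr_sqr gtr0_norm// divff ?gt_eqF// scale1r.
Qed.

Lemma smooth_on_id (R : realType) (n : nat) (U : set 'rV[R]_n) :
  open U -> smooth_on U (fun x : 'rV[R]_n => x).
Proof.
by move=> oU; apply/(smooth_on_mxP _ oU) => i j; apply/smooth_onP => k; exact: Ck_coord.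
Qed.

Section Immersion.
Context (R : realType) (n : nat) (M : manifold R n) (F : M -> 'rV[R]_n.+1) (r : R).
Hypotheses (r0 : 0 < r) (sF : smooth_map F) (FS : forall x, dot (F x) (F x) = r ^+ 2).
Hypothesis iF : forall (a : atlas M) p, chart_img (chart_of a) p ->
  row_free (diff_mx F a p).

(* Obtained by applying the inverse function theorem to the cone map
   (t, q) |-> t F(q). *)
Lemma local_section (x : M) :
  exists (a : atlas M) (V : set M) (W : set 'rV[R]_n.+1) (h : 'rV[R]_n.+1 -> 'rV[R]_n),
  [/\ open V, V x, open W & W (F x)] /\
  [/\ smooth_on W h,
      (forall z, W z -> chart_img (chart_of a) (h z) /\
          F (chart_param (chart_of a) (h z)) = radial r z) &
      (forall y, V y -> [/\ chart_dom (chart_of a) y, W (F y) &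
          h (F y) = chart_coord (chart_of a) y])].
Proof.
have [a ax] := atlas_cover x; have ap := chart_img_coord ax.
set p := chart_coord (chart_of a) x in ap.
have oI := open_chart_img (chart_of a).
pose f := local_expr F a.
have sf : smooth_on (chart_img (chart_of a)) f by exact: sF.
(* Positivity of the first coordinate lets [radial r] undo the scaling of the cone map. *)
pose U : set 'rV[R]_(1 + n) := [set v : 'rV[R]_(1 + n) | 0 < v 0 0 /\ chart_img (chart_of a) (rsubmx v)].
pose Phi (v : 'rV[R]_(1 + n)) : 'rV[R]_(1 + n) := v 0 0 *: f (rsubmx v).
have sr (U' : set 'rV[R]_(1 + n)) : open U' -> smooth_on U' (rsubmx : 'rV[R]_(1 + n) -> 'rV[R]_n).
  move=> oU'; apply/(smooth_on_mxP _ oU') => i j; apply/smooth_onP => k.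
  have -> : (fun v : 'rV[R]_(1 + n) => rsubmx v i j) = fun v => v i (rshift 1 j).
    by apply/funext => v; rewrite mxE.
  exact: Ck_coord.
have oU : open U.
  have -> : U = (fun v : 'rV[R]_(1 + n) => v 0 0 : R) @^-1` [set t | 0 < t] `&`
                rsubmx @^-1` (chart_img (chart_of a)) by [].
  apply: openI.
    apply: open_comp; last exact: open_gt.
    by move=> v _; exact: coord_continuous.
  apply: open_comp; last exact: oI.
  by move=> v _; exact/differentiable_continuous/differentiable_rsubmx.
pose v0 : 'rV[R]_(1 + n) := row_mx 1%:M p.
have rv0 : rsubmx v0 = p by rewrite row_mxKr.
have lE (q : 'rV[R]_n) : (row_mx 1%:M q : 'rV[R]_(1 + n)) 0 0 = 1.
  transitivity ((row_mx 1%:M q : 'rV[R]_(1 + n)) 0 (lshift n 0)).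
    by congr (_ _ _); exact: val_inj.
  by rewrite row_mxEl mxE.
have Uv0 : U v0 by split; [rewrite lE|rewrite rv0].
have sPhi : smooth_on U Phi.
  have s1 : smooth_on U (fun v => f (rsubmx v)).
    by apply: (@smooth_on_comp _ _ _ _ _ U _ f _ oU oI _ sf (sr U oU)) => v [].
  apply/smooth_onP => k; apply: (Ck_scalemx oU); last exact: ((smooth_onP _ _).1 s1 k).
  exact: Ck_coord.
have uJ : jacobian Phi v0 \in unitmx.
  apply: (@cone_jacobian_unit R n f p r r0 (smooth_on_diff sf ap)); last exact: iF.
  by apply: filterE => q; rewrite /f /local_expr /= FS.
have [V [W [psi [[oV Vv0 VU] [oW WF spsi Vpsi Wpsi]]]]] :=
  inverse_function oU Uv0 sPhi uJ.
have PhiE q : Phi (row_mx 1%:M q) = f q by rewrite /Phi lE scale1r row_mxKr.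
pose h z := rsubmx (psi z : 'rV[R]_(1 + n)).
pose j (q : 'rV[R]_n) : 'rV[R]_(1 + n) := row_mx 1%:M q.
have cj : continuous j.
  move=> q; apply: differentiable_continuous; apply/differentiable_mxP => i b.
  have -> : (fun y : 'rV[R]_n => j y i b) =
     match fintype.split b with inl c => fun=> (1%:M : 'M[R]_1) i c | inr c => fun y => y i c end.
    by apply/funext => y; rewrite /j mxE; case: (fintype.split b).
  by case: (fintype.split b) => c; [exact: differentiable_cst|exact: differentiable_coord].
exists a, (chart_dom (chart_of a) `&` [set y | V (j (chart_coord (chart_of a) y))]), W, h.
have fx : f p = F x by rewrite /f /local_expr /= /p chart_coordK.
split; split.
- rewrite openE => y [ay Vy].
  have n1 : nbhs y (chart_dom (chart_of a)).
    by apply: open_nbhs_nbhs; split=> //; exact: chart_dom_open.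
  have n2 : nbhs y [set y | V (j (chart_coord (chart_of a) y))].
    have c : {for y, continuous (j \o chart_coord (chart_of a))}.
      by apply: continuous_comp; [exact: chart_coord_cvg|exact: cj].
    by apply: c; apply: open_nbhs_nbhs.
  exact: filterI n1 n2.
- by split.
- exact: oW.
- by rewrite -fx -PhiE.
- apply: (@smooth_on_comp _ _ _ _ _ W setT rsubmx psi oW openT) => //.
  by apply: sr; exact: openT.
- move=> z Wz; have [Vz Ez] := Wpsi z Wz; have [t0 ih] := VU _ Vz.
  split; first exact: ih.
  have E : (psi z) 0 0 *: F (chart_param (chart_of a) (h z)) = z by rewrite -[RHS]Ez.
  rewrite /radial -[in RHS]E dotZl dotZr FS mulrA -expr2 -exprMn sqrtr_sqr.
  rewrite scalerA gtr0_norm ?mulr_gt0// invfM mulrCA divff ?gt_eqF// mulr1 mulVf ?gt_eqF//.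
  by rewrite scale1r.
- move=> y [ay Vy]; have [Wy Ey] := Vpsi _ Vy.
  have Fy : Phi (j (chart_coord (chart_of a) y)) = F y.
    by rewrite PhiE /f /local_expr /= chart_coordK.
  by rewrite -Fy; split=> //; rewrite /h Ey row_mxKr.
Qed.

Lemma immersion_locally_injective (x : M) :
  exists V : set M, [/\ open V, V x & forall y z, V y -> V z -> F y = F z -> y = z].
Proof.
have [a [V [W [h [[oV Vx oW WF] [sh hE Vh]]]]]] := local_section x.
exists V; split=> // y z /Vh[ay _ hy] /Vh[az _ hz] yz.
by rewrite -(chart_coordK ay) -(chart_coordK az) -hy -hz yz.
Qed.

(** Sections live on a ball of the ambient space, through [radial]. The second clause selects the
    sheet through [x], and does so on a whole neighbourhood of [x], so that sections at nearby
    points can be compared. *)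
Definition is_section (x : M) (d : R) (s : 'rV[R]_n.+1 -> M) : Prop :=
  (forall z, `|z - F x| < d -> {for z, continuous s} /\ F (s z) = radial r z) /\
  (exists V : set M, [/\ open V, V x & forall y, V y -> s (F y) = y]).

(** A section built at [x] also serves every nearby point of the same sheet, at the cost of halving
    the radius; compactness then gives one radius for all points. *)
Lemma uniform_sections : compact [set: M] ->
  exists2 d : R, 0 < d & forall x, exists s, is_section x d s.
Proof.
move=> /compact_near_coveringP cM.
have cF := smooth_map_continuous sF.
have : \forall d \near (0 : R)^'+, [set: M] `<=` (fun x => exists s, is_section x d s).
  apply: cM => x _.
  have [a [V [W [h [[oV Vx oW WF] [sh hE Vh]]]]]] := local_section x.
  have [e e0 eW] := nbhs_norm_lt (open_nbhs_nbhs (conj oW WF)).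
  have n1 : nbhs x (V `&` [set y | `|F y - F x| < e / 2]).
    apply: filterI; first exact: open_nbhs_nbhs.
    have /cvgrPdist_lt/(_ (e / 2)) := cF x; rewrite divr_gt0// => /(_ isT).
    by apply: filterS => y; rewrite /= distrC.
  exists (V `&` [set y | `|F y - F x| < e / 2], [set d | d < e / 2]).
    split; first exact: n1.
    by apply: nbhs_right_lt; rewrite divr_gt0.
  move=> [y d] [[Vy yx] de] /=.
  exists (fun z => chart_param (chart_of a) (h z)); split.
    move=> z zd; have Wz : W z.
      apply: eW; rewrite -(subrKA (F y)) (le_lt_trans (ler_normD _ _))//.
      by rewrite (splitr e) ltrD// (lt_trans zd).
    have [ih FE] := hE z Wz; split; last exact: FE.
    apply: continuous_comp; last exact: chart_param_cvg.
    exact/differentiable_continuous/(smooth_on_diff sh Wz).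
  exists V; split=> // w /Vh[aw _ ->]; exact: chart_coordK.
move=> H; have : \forall d \near (0 : R)^'+, 0 < d /\ [set: M] `<=` (fun x => exists s, is_section x d s).
  by apply: filterI => //; exact: nbhs_right_gt.
by move=> /filter_ex[d [d0 Hd]]; exists d => // x; exact: Hd.
Qed.

(** Two lifts of a path agree on an open set of parameters by local injectivity and differ on an
    open set because the manifold is Hausdorff. *)
Lemma path_unique (g0 g1 : R -> M) :
  (forall s, 0 <= s <= 1 -> {for s, continuous g0}) ->
  (forall s, 0 <= s <= 1 -> {for s, continuous g1}) ->
  (forall s, 0 <= s <= 1 -> F (g0 s) = F (g1 s)) ->
  g0 0 = g1 0 -> g0 1 = g1 1.
Proof.
move=> c0 c1 E0 E.
apply: (@connected_clopen R `[0, 1]%classic (fun s => g0 s = g1 s)).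
- exact: segment_connected.
- move=> s /=; rewrite in_itv /= => s01 gs.
  have [V [oV Vx iV]] := immersion_locally_injective (g0 s).
  have n0 : nbhs s (g0 @^-1` V) by apply: c0 => //; exact: open_nbhs_nbhs.
  have n1 : nbhs s (g1 @^-1` V) by apply: c1 => //; apply: open_nbhs_nbhs; rewrite -gs.
  apply: filterS (filterI n0 n1) => t [V0 V1]; rewrite in_itv /= => t01.
  by apply: iV => //; exact: E0.
- move=> s /=; rewrite in_itv /= => s01 /eqP gs.
  have := @space_hausdorff _ _ M; rewrite open_hausdorff => /(_ _ _ gs).
  move=> [[A B] /= [/set_mem A0 /set_mem B1] [oA oB /eqP AB]].
  have n0 : nbhs s (g0 @^-1` A) by apply: c0 => //; exact: open_nbhs_nbhs.
  have n1 : nbhs s (g1 @^-1` B) by apply: c1 => //; exact: open_nbhs_nbhs.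
  apply: filterS (filterI n0 n1) => t [V0 V1] _ gt.
  have : (A `&` B) (g0 t) by split=> //; rewrite gt.
  by rewrite AB.
- by exists 0 => //=; rewrite in_itv /= lexx ler01.
- by rewrite /= in_itv /= lexx ler01.
Qed.

End Immersion.

(** * Transport of points along great arcs *)

Lemma line_continuous (R : realType) (V : normedModType R) (x v : V) :
  continuous (fun t : R => x + t *: v).
Proof.
move=> t; apply: (@differentiable_continuous R R _ t (fun t => x + t *: v)).
by case: (is_diffD (is_diff_cst x t) (is_diff_scalel t v)).
Qed.

Lemma norm_le_dot (R : realType) (m : nat) (v : 'rV[R]_m) : `|v| <= Num.sqrt (dot v v).
Proof.
apply: mx_norm_le => [|i j]; first exact: sqrtr_ge0.
rewrite -sqrtr_sqr ler_wsqrtr// dotE (bigD1 j)//= ord1 -expr2 lerDl.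
by apply: sumr_ge0 => k _; rewrite -expr2 sqr_ge0.
Qed.

Lemma norm_lt_dot (R : realType) (m : nat) (v : 'rV[R]_m) (d : R) :
  0 < d -> dot v v < d ^+ 2 -> `|v| < d.
Proof.
move=> d0 vd; rewrite (le_lt_trans (norm_le_dot v))//.
by rewrite -(gtr0_norm d0) -sqrtr_sqr ltr_sqrt// exprn_gt0.
Qed.

Lemma dot_radial (R : realType) (m : nat) (r : R) (z : 'rV[R]_m) : z != 0 ->
  dot (radial r z) (radial r z) = r ^+ 2.
Proof.
rewrite -dot_gt0 => z0; rewrite /radial dotZl dotZr mulrA -expr2 exprMn exprVn.
by rewrite sqr_sqrtr ?(ltW z0)// divfK// gt_eqF.
Qed.

Lemma open_neq0 (R : realType) (n : nat) : open [set z : 'rV[R]_n | z != 0].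
Proof.
have -> : [set z : 'rV[R]_n | z != 0] = ~` [set 0].
  by apply/seteqP; split=> z /= /eqP.
apply: closed_openC; apply: accessible_closed_set1.
exact: hausdorff_accessible (@norm_hausdorff _ _).
Qed.

Lemma smooth_radial (R : realType) (m : nat) (r : R) :
  smooth_on [set z : 'rV[R]_m | z != 0] (radial r).
Proof.
have oU := @open_neq0 R m; apply/smooth_onP => k.
have cid : Ck k [set z : 'rV[R]_m | z != 0] (fun z : 'rV[R]_m => z).
  by apply/(Ck_mxP _ _ oU) => i j; exact: Ck_coord.
have z0 (z : 'rV[R]_m) : z != 0 -> 0 < dot z z by rewrite dot_gt0.
apply: (Ck_scalemx oU) => //; apply: (CkM oU); first exact: Ck_cst.
apply: (Ck_inv oU); first by move=> z /z0; rewrite -sqrtr_gt0 => /gt_eqF ->.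
by apply: (Ck_sqrt oU) => //; exact: (Ck_dot oU).
Qed.

Lemma radial_continuous (R : realType) (m : nat) (r : R) (z : 'rV[R]_m) : z != 0 ->
  {for z, continuous (radial r)}.
Proof.
by move=> z0; apply: differentiable_continuous; exact: smooth_on_diff (@smooth_radial R m r) z0.
Qed.

(** For nonantipodal points of the sphere of radius [r], the midpoint of the short great arc joining
    them. *)
Definition mid (R : realType) (m : nat) (r : R) (y z : 'rV[R]_m) := radial r (y + z).

Lemma midC (R : realType) (m : nat) (r : R) (y z : 'rV[R]_m) : mid r y z = mid r z y.
Proof. by rewrite /mid addrC. Qed.

Section Mid.
Context (R : realType) (m : nat) (r : R) (y z : 'rV[R]_m).
Hypotheses (r0 : 0 < r) (yr : dot y y = r ^+ 2) (zr : dot z z = r ^+ 2) (yz : y + z != 0).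

Lemma dot_sub_sphere : dot (y - z) (y - z) = 4 * r ^+ 2 - dot (y + z) (y + z).
Proof.
rewrite dotBl !dotBr dotDl !dotDr yr zr [dot z y]dotC; ring.
Qed.

(** With q = |y + z| the two sides are 2 r^2 - r q and 2 r^2 - q^2 / 2, so the claim is q <= 2 r. *)
Lemma mid_dist : dot (y - mid r y z) (y - mid r y z) <= dot (y - z) (y - z) / 2.
Proof.
have s0 : 0 < dot (y + z) (y + z) by rewrite dot_gt0.
rewrite dot_sub_sphere dotBl !dotBr [dot (mid _ _ _) y]dotC /mid dot_radial// yr.
set s := dot (y + z) (y + z) in s0 *.
have ym : dot y (y + z) = s / 2.
  rewrite /s dotDl !dotDr yr zr [dot z y]dotC; by field.
rewrite /radial dotZr ym -/s.
set q := Num.sqrt s; have q0 : 0 < q by rewrite sqrtr_gt0.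
have sq : s = q ^+ 2 by rewrite sqr_sqrtr// ltW.
have -> : r / q * (s / 2) = r * q / 2 by rewrite sq; field; rewrite gt_eqF.
have : s <= (2 * r) ^+ 2.
  have := dot_ge0 (y - z); rewrite dot_sub_sphere -/s subr_ge0 exprMn.
  by rewrite -natrX.
rewrite sq ler_pXn2r ?nnegrE ?mulr_ge0 ?(ltW r0) ?(ltW q0)// => qr.
have := ler_wpM2r (ltW q0) qr; lra.
Qed.

(** An antipodal midpoint would be at squared distance 4 r^2, more than [mid_dist] allows. Bisection
    can therefore be repeated. *)
Lemma mid_neq_opp : y + mid r y z != 0.
Proof.
apply/eqP => E; have := mid_dist.
have mE : mid r y z = - y by apply/eqP; rewrite -addr_eq0 addrC E.
rewrite mE opprK dot_sub_sphere.
have : 0 < dot (y + z) (y + z) by rewrite dot_gt0.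
have -> : dot (y + y) (y + y) = 4 * r ^+ 2 by rewrite dotDl !dotDr yr; ring.
have : 0 < r ^+ 2 by rewrite exprn_gt0.
lra.
Qed.

End Mid.

Section Transport.
Context (R : realType) (n : nat) (M : manifold R n) (F : M -> 'rV[R]_n.+1) (r : R).
Hypotheses (r0 : 0 < r) (sF : smooth_map F) (FS : forall x, dot (F x) (F x) = r ^+ 2).
Hypothesis iF : forall (a : atlas M) p, chart_img (chart_of a) p ->
  row_free (diff_mx F a p).
Variables (d : R) (sec : M -> 'rV[R]_n.+1 -> M).
Hypotheses (d0 : 0 < d) (Hsec : forall x, is_section F r x d (sec x)).

Lemma sec_id x : sec x (F x) = x.
Proof. by have [_ [V [_ Vx]]] := Hsec x; apply. Qed.

(** The sections are chosen point by point, with no continuity in the base point. Near [t0],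
    however, the section at [f t] agrees with the one at [f t0], by unique lifting along a
    segment. *)
Lemma sec_continuous (T : topologicalType) (f : T -> M) (z : T -> 'rV[R]_n.+1) (t0 : T) :
  {for t0, continuous f} -> {for t0, continuous z} ->
  `|z t0 - F (f t0)| < d -> {for t0, continuous (fun t => sec (f t) (z t))}.
Proof.
move=> cf cz zd; set x1 := f t0.
have [H1 [V [oV Vx Vs]]] := Hsec x1.
have cF := smooth_map_continuous sF.
have cFf : {for t0, continuous (F \o f)} by apply: continuous_comp => //; exact: cF.
have nV : nbhs t0 (f @^-1` V) by apply: cf; exact: open_nbhs_nbhs.
have n1 : \forall t \near t0, `|F (f t) - F x1| < d.
  have /cvgrPdist_lt/(_ d d0) := cFf; apply: filterS => t.
  by rewrite distrC.
have n2 : \forall t \near t0, `|z t - F x1| < d.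
  have c : {for t0, continuous (fun t => `|z t - F x1|)}.
    apply: (@continuous_comp _ _ _ (fun t => z t - F x1) Num.norm); last exact: norm_continuous.
    exact: (cvgB cz (cvg_cst _)).
  by apply: (cvgr_lt _ c).
have n3 : \forall t \near t0, `|z t - F (f t)| < d.
  have c : {for t0, continuous (fun t => `|z t - F (f t)|)}.
    apply: (@continuous_comp _ _ _ (fun t => z t - F (f t)) Num.norm); last exact: norm_continuous.
    exact: (cvgB cz cFf).
  by apply: (cvgr_lt _ c).
have nE : \forall t \near t0, sec x1 (z t) = sec (f t) (z t).
  apply: filterS (filterI nV (filterI n1 (filterI n2 n3))) => t [Vt [t1 [t2 t3]]].
  have [H2 _] := Hsec (f t).
  (* The segment stays in the balls of both sections, and both lifts of it start at [f t]. *)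
  pose w (s : R) := F (f t) + s *: (z t - F (f t)).
  have w1 s : 0 <= s <= 1 -> `|w s - F x1| < d by move=> s01; exact: segment_norm_lt.
  have w2 s : 0 <= s <= 1 -> `|w s - F (f t)| < d.
    move=> /andP[s0 s1]; rewrite /w addrAC subrr add0r normrZ ger0_norm//.
    by rewrite (le_lt_trans _ t3)// ler_piMl.
  have cw : continuous w by exact: line_continuous.
  have -> : z t = w 1 by rewrite /w scale1r subrKC.
  apply: (@path_unique _ _ _ F r r0 sF FS iF (fun s => sec x1 (w s)) (fun s => sec (f t) (w s))).
  - move=> s s01; apply: (@continuous_comp _ _ _ w (sec x1)); first exact: cw.
    by have [] := H1 _ (w1 s s01).
  - move=> s s01; apply: (@continuous_comp _ _ _ w (sec (f t))); first exact: cw.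
    by have [] := H2 _ (w2 s s01).
  - move=> s s01; have [_ ->] := H1 _ (w1 s s01).
    by have [_ ->] := H2 _ (w2 s s01).
  - by rewrite /w scale0r addr0 sec_id Vs.
have c : {for t0, continuous (fun t => sec x1 (z t))}.
  apply: (@continuous_comp _ _ _ z (sec x1)) => //.
  by have [] := H1 _ zd.
rewrite /continuous_at; apply: cvg_trans c; exact: near_eq_cvg.
Qed.

(* Lifts the arc from F x to z by bisection: after L halvings the pieces are
   short enough for the local sections. *)
Fixpoint transport (L : nat) (x : M) (z : 'rV[R]_n.+1) : M :=
  if L is L'.+1 then transport L' (transport L' x (mid r (F x) z)) z else sec x z.

Lemma transport_id L x : transport L x (F x) = x.
Proof.
have mE : mid r (F x) (F x) = F x.
  rewrite /mid /radial dotDl !dotDr FS.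
  have -> : r ^+ 2 + r ^+ 2 + (r ^+ 2 + r ^+ 2) = (2 * r) ^+ 2 by ring.
  rewrite sqrtr_sqr gtr0_norm ?mulr_gt0// -[F x]scale1r -scalerDl scalerA.
  by congr (_ *: _); field; rewrite gt_eqF.
by elim: L => [|L IH] /=; [exact: sec_id|rewrite mE IH].
Qed.

(** A bisection at least halves the squared chord, so [L] of them bring it below d^2, the range of
    the sections. *)
Let close L (y z : 'rV[R]_n.+1) := dot (y - z) (y - z) < d ^+ 2 * 2 ^+ L.

Let mid_close L y z : dot y y = r ^+ 2 -> dot z z = r ^+ 2 -> y + z != 0 ->
  close L.+1 y z -> close L y (mid r y z) /\ close L (mid r y z) z.
Proof.
move=> yr zr yz; rewrite /close [2 ^+ L.+1]exprS mulrCA => yzd.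
split.
  apply: le_lt_trans (mid_dist r0 yr zr yz) _; lra.
have zy : z + y != 0 by rewrite addrC.
rewrite -[X in dot X _]opprB -[X in dot _ X]opprB dotNl dotNr opprK.
have := mid_dist r0 zr yr zy; rewrite [mid r z y]midC => /le_lt_trans; apply.
rewrite -[X in dot X _]opprB -[X in dot _ X]opprB dotNl dotNr opprK; lra.
Qed.

Lemma transport_over L x z : dot z z = r ^+ 2 -> F x + z != 0 -> close L (F x) z ->
  F (transport L x z) = z.
Proof.
elim: L x z => [|L IH] x z zr xz xzd /=.
  have [H _] := Hsec x; have [|_ ->] := H z; last exact: radial_id.
  rewrite distrC; apply: norm_lt_dot => //.
  by move: xzd; rewrite /close expr0 mulr1.
have [c1 c2] := mid_close (FS x) zr xz xzd.
have Fm : F (transport L x (mid r (F x) z)) = mid r (F x) z.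
  apply: IH => //; first exact: dot_radial.
  by apply: mid_neq_opp => //; exact: FS.
apply: IH => //; rewrite Fm//.
by rewrite addrC midC; apply: mid_neq_opp => //; rewrite addrC.
Qed.

(** In the induction the intermediate point becomes a moving starting point, which is why both [f]
    and [z] depend on a parameter in an arbitrary space. *)
Lemma transport_continuous L (T : topologicalType) (f : T -> M) (z : T -> 'rV[R]_n.+1) (t0 : T) :
  {for t0, continuous f} -> {for t0, continuous z} ->
  dot (z t0) (z t0) = r ^+ 2 -> F (f t0) + z t0 != 0 -> close L (F (f t0)) (z t0) ->
  {for t0, continuous (fun t => transport L (f t) (z t))}.
Proof.
elim: L f z => [|L IH] f z cf cz zr fz fzd /=.
  apply: sec_continuous => //; rewrite distrC; apply: norm_lt_dot => //.
  by move: fzd; rewrite /close expr0 mulr1.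
have [c1 c2] := mid_close (FS _) zr fz fzd.
have mr : dot (mid r (F (f t0)) (z t0)) (mid r (F (f t0)) (z t0)) = r ^+ 2.
  exact: dot_radial.
have mo : F (f t0) + mid r (F (f t0)) (z t0) != 0.
  by apply: mid_neq_opp => //; exact: FS.
have cm : {for t0, continuous (fun t => mid r (F (f t)) (z t))}.
  apply: (@continuous_comp _ _ _ (fun t => F (f t) + z t) (radial r)); last exact: radial_continuous.
  have cFf : {for t0, continuous (F \o f)}.
    by apply: continuous_comp => //; exact: smooth_map_continuous.
  exact: (cvgD cFf cz).
have Fm : F (transport L (f t0) (mid r (F (f t0)) (z t0))) = mid r (F (f t0)) (z t0).
  exact: transport_over.
apply: (IH (fun t => transport L (f t) (mid r (F (f t)) (z t))) z) => //.
- exact: (IH f (fun t => mid r (F (f t)) (z t))).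
- by rewrite Fm addrC midC; apply: mid_neq_opp => //; rewrite addrC.
- by move: c2; rewrite -{1}Fm.
Qed.

(** No squared chord exceeds 4 r^2, so one number of bisections suffices for all pairs. *)
Lemma close_ex : exists L, forall x z, dot z z = r ^+ 2 -> close L (F x) z.
Proof.
pose c := 4 * r ^+ 2 / d ^+ 2.
have c0 : 0 <= c by rewrite divr_ge0 ?sqr_ge0// mulr_ge0 ?sqr_ge0.
exists (Num.bound c) => x z zr; rewrite /close (dot_sub_sphere (FS x) zr).
have E : 4 * r ^+ 2 = d ^+ 2 * c by rewrite /c; field; rewrite gt_eqF.
apply: (@le_lt_trans _ _ (4 * r ^+ 2)); first by rewrite gerBl dot_ge0.
rewrite E ltr_pM2l ?exprn_gt0//; apply: lt_le_trans (archi_boundP c0) _.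
by rewrite -natrX ler_nat ltnW// ltn_expl.
Qed.

End Transport.

(** In dimension above one a punctured ball is connected: two points are joined by their segment or,
    if their line meets the centre, by two segments through a point off that line. *)
Lemma punctured_ball_const (R : realType) (n : nat) (p0 : 'rV[R]_n) (rho : R)
    (P : 'rV[R]_n -> Prop) : (1 < n)%N ->
  (forall q, q != p0 -> `|q - p0| < rho -> P q -> \forall q' \near q, P q') ->
  (forall q, q != p0 -> `|q - p0| < rho -> ~ P q -> \forall q' \near q, ~ P q') ->
  forall q q', q != p0 -> `|q - p0| < rho -> q' != p0 -> `|q' - p0| < rho ->
    P q -> P q'.
Proof.
move=> n1 oP oN.
have seg q q' : `|q - p0| < rho -> `|q' - p0| < rho ->
    (forall s : R, q + s *: (q' - q) != p0) -> P q -> P q'.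
  move=> qr qr' ne Pq.
  pose w (s : R) := q + s *: (q' - q).
  have cw : continuous w by exact: line_continuous.
  have wr s : 0 <= s <= 1 -> `|w s - p0| < rho by move=> s01; exact: segment_norm_lt.
  have -> : q' = w 1 by rewrite /w scale1r subrKC.
  apply: (@connected_clopen R `[0, 1]%classic (fun s => P (w s))).
  - exact: segment_connected.
  - move=> s /=; rewrite in_itv /= => s01 Ps.
    have H : \forall t \near s, P (w t) := cw s _ (oP _ (ne s) (wr s s01) Ps).
    by apply: filterS H.
  - move=> s /=; rewrite in_itv /= => s01 Ps.
    have H : \forall t \near s, ~ P (w t) := cw s _ (oN _ (ne s) (wr s s01) Ps).
    by apply: filterS H.
  - by exists 0 => //=; rewrite ?in_itv /= ?lexx ?ler01// /w scale0r addr0.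
  - by rewrite /= in_itv /= lexx ler01.
move=> q q' qp qr qp' qr' Pq.
have [H|/existsNP[t /negP/negPn/eqP Ht]] := pselect (forall s : R, q + s *: (q' - q) != p0).
  exact: (seg q).
have r0 : 0 < rho := le_lt_trans (normr_ge0 _) qr.
have [j uj] : exists j, (q - p0) 0 j != 0.
  apply/existsP; apply: contraT; rewrite negb_exists => /forallP H.
  case/negP: qp; rewrite -subr_eq0; apply/eqP/matrixP => a b; rewrite ord1 [RHS]mxE.
  by have := H b; rewrite negbK => /eqP.
have [i ij] : exists i : 'I_n, i != j.
  apply/existsP; apply: contraT; rewrite negb_exists => /forallP H.
  have : (#|'I_n| <= #|[set j]%SET|)%N.
    apply: subset_leq_card; apply/fintype.subsetP => l _.
    by have := H l; rewrite negbK inE.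
  by rewrite card_ord cards1 leqNgt n1.
have E1 : (1 - t) * (q - p0) 0 j + t * (q' - p0) 0 j = 0.
  have -> : (1 - t) * (q - p0) 0 j + t * (q' - p0) 0 j = (q + t *: (q' - q) - p0) 0 j.
    by rewrite !mxE; ring.
  by rewrite Ht subrr mxE.
have t1 : 1 - t != 0.
  apply/eqP => t1; have {}t1 : t = 1 by apply/eqP; rewrite eq_sym -subr_eq0 t1.
  by case/negP: qp'; rewrite -Ht t1 scale1r subrKC.
have uj' : (q' - p0) 0 j != 0.
  apply/eqP => h; move: E1; rewrite h mulr0 addr0 => /eqP.
  by rewrite mulf_eq0 (negPf t1) (negPf uj).
(* [m] leaves the centre along a coordinate [i] other than [j]. On a line from [q] or [q'] to [m],
   the offset from the centre has zero [j]-coordinate only at [m], which is not the centre. *)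
pose m := p0 + (rho / 2) *: (delta_mx 0 i : 'rV[R]_n).
have mj : (m - p0) 0 j = 0.
  by rewrite /m addrAC subrr add0r !mxE eqxx /= eq_sym (negPf ij) mulr0.
have mi : (m - p0) 0 i = rho / 2.
  by rewrite /m addrAC subrr add0r !mxE !eqxx /= mulr1.
have rh : rho / 2 != 0 by rewrite gt_eqF// divr_gt0.
have mr : `|m - p0| < rho.
  rewrite /m addrAC subrr add0r normrZ gtr0_norm ?divr_gt0//.
  apply: (@le_lt_trans _ _ (rho / 2)).
    rewrite ler_piMr ?(ltW (divr_gt0 _ _))//; apply: mx_norm_le => // a b; rewrite mxE.
    by case: (_ && _); rewrite /= ?normr1 ?normr0.
  by rewrite ltr_pdivrMr// ltr_pMr// ltr1n.
have avoid (v : 'rV[R]_n) s : (v - p0) 0 j != 0 -> v + s *: (m - v) != p0.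
  move=> vj; apply/eqP => h.
  have E k : (1 - s) * (v - p0) 0 k + s * (m - p0) 0 k = 0.
    have -> : (1 - s) * (v - p0) 0 k + s * (m - p0) 0 k = (v + s *: (m - v) - p0) 0 k.
      by rewrite !mxE; ring.
    by rewrite h subrr mxE.
  have /eqP := E j; rewrite mj mulr0 addr0 mulf_eq0 (negPf vj) orbF => /eqP s1.
  have /eqP := E i; rewrite mi s1 mul0r add0r mulf_eq0 (negPf rh) orbF => /eqP s0.
  by move: s1; rewrite s0 subr0 => /eqP; rewrite oner_eq0.
apply: (seg m) => //.
  move=> s; have := avoid q' (1 - s) uj'.
  have -> // : q' + (1 - s) *: (m - q') = m + s *: (q' - m).
  by apply/matrixP => a b; rewrite !mxE; ring.
by apply: (seg q) => // s; exact: avoid.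
Qed.

Lemma chart_nbhs (R : realType) (n : nat) (M : manifold R n) (w : M) (A : set M) :
  nbhs w A -> exists (a : atlas M) (rho : R),
   [/\ 0 < rho, chart_dom (chart_of a) w,
     (forall q, `|q - chart_coord (chart_of a) w| < rho ->
        chart_img (chart_of a) q /\ A (chart_param (chart_of a) q)) &
     \forall v \near w, exists2 q, `|q - chart_coord (chart_of a) w| < rho &
        v = chart_param (chart_of a) q].
Proof.
move=> nA; have [a aw] := atlas_cover w; exists a.
have ip := chart_img_coord aw; set p0 := chart_coord (chart_of a) w in ip *.
have cp := chart_param_cvg ip.
have n1 : nbhs p0 (chart_param (chart_of a) @^-1` A).
  by apply: cp; rewrite /p0 chart_coordK.
have n2 : nbhs p0 (chart_img (chart_of a)).
  by apply: open_nbhs_nbhs; split=> //; exact: open_chart_img.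
have [rho rho0 H] := nbhs_norm_lt (filterI n2 n1).
have n3 : nbhs w (chart_dom (chart_of a)).
  by apply: open_nbhs_nbhs; split=> //; exact: chart_dom_open.
have n4 : \forall v \near w, `|chart_coord (chart_of a) v - p0| < rho.
  have /cvgrPdist_lt/(_ rho rho0) := chart_coord_cvg aw.
  by apply: filterS => v; rewrite distrC.
exists rho; split; first exact: rho0.
- exact: aw.
- by move=> q qr; have [i1 i2] := H q qr; split.
apply: filterS (filterI n3 n4) => v [av vr].
by exists (chart_coord (chart_of a) v) => //; rewrite chart_coordK.
Qed.

Lemma not_isolated (R : realType) (n : nat) (M : manifold R n) (w : M) (A : set M) :
  (0 < n)%N -> nbhs w A -> exists2 v, A v & v <> w.
Proof.
move=> n0 nA; have [a [rho [rho0 aw H _]]] := chart_nbhs nA.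
set p0 := chart_coord (chart_of a) w in H.
pose q := p0 + (rho / 2) *: (delta_mx 0 (Ordinal n0) : 'rV[R]_n).
have qr : `|q - p0| < rho.
  rewrite /q addrAC subrr add0r normrZ gtr0_norm ?divr_gt0//.
  apply: (@le_lt_trans _ _ (rho / 2)).
    rewrite ler_piMr ?(ltW (divr_gt0 _ _))//; apply: mx_norm_le => // i j; rewrite mxE.
    by case: (_ && _); rewrite /= ?normr1 ?normr0.
  by rewrite ltr_pdivrMr// ltr_pMr// ltr1n.
have [iq Aq] := H q qr; exists (chart_param (chart_of a) q) => // E.
have [_ qE] := chart_dom_param iq; move: qE; rewrite E -/p0 => /matrixP/(_ 0 (Ordinal n0)).
rewrite /q !mxE !eqxx /= mulr1 => /eqP; rewrite eq_sym addrC -subr_eq0 addrK.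
by rewrite gt_eqF// divr_gt0.
Qed.

(** * Bijectivity of an immersion of a closed manifold into the sphere *)

Section SphereImmersion.
Context (R : realType) (n : nat) (M : manifold R n) (F : M -> 'rV[R]_n.+1) (r : R).
Hypotheses (n1 : (1 < n)%N) (r0 : 0 < r) (sF : smooth_map F).
Hypothesis FS : forall x, dot (F x) (F x) = r ^+ 2.
Hypothesis iF : forall (a : atlas M) p, chart_img (chart_of a) p ->
  row_free (diff_mx F a p).
Hypotheses (cM : compact [set: M]) (kM : connected [set: M]).

Let n0 : (0 < n)%N. Proof. exact: ltnW. Qed.

Let closed_point (x y : M) : x <> y -> \forall v \near x, v <> y.
Proof.
move=> xy.
have cy : open (~` [set y]).
  apply: closed_openC; apply: accessible_closed_set1.
  exact: hausdorff_accessible (@space_hausdorff _ _ M).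
have := open_nbhs_nbhs (conj cy xy : open_nbhs x _).
by apply: filterS.
Qed.

Let near_neq0 (z : 'rV[R]_n.+1) (w : M) : F w + z != 0 ->
  \forall v \near w, F v + z != 0.
Proof.
move=> wz; have cF := smooth_map_continuous sF.
have c : {for w, continuous (fun v => `|F v + z|)}.
  have c1 : {for w, continuous (fun v => F v + z)} by exact: (cvgD (cF w) (cvg_cst _)).
  by apply: (@continuous_comp _ _ _ (fun v => F v + z) Num.norm); [exact: c1|exact: norm_continuous].
have : \forall v \near w, 0 < `|F v + z| by apply: (cvgr_gt _ c); rewrite /= normr_gt0.
by apply: filterS => v; rewrite normr_gt0.
Qed.

Theorem sphere_immersion_injective (x y : M) : F x = F y -> x = y.
Proof.
move=> xy; apply: contrapT => nxy; set z := F x in xy.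
have zr : dot z z = r ^+ 2 by exact: FS.
have [d d0 /choice[sec Hsec]] := uniform_sections r0 sF FS iF cM.
have [L HL] := close_ex FS d0.
pose psi w := transport F r sec L w z.
have psic w : F w + z != 0 -> {for w, continuous psi}.
  move=> wz; apply: (@transport_continuous _ _ _ F r r0 sF FS iF d sec d0 Hsec L M id (fun=> z) w) => //.
  - exact: cvg_cst.
  - exact: HL.
have psiF w : F w + z != 0 -> F (psi w) = z.
  by move=> wz; apply: (transport_over r0 FS d0 Hsec) => //; exact: HL.
have psi_id w : F w = z -> psi w = w.
  by move=> wE; rewrite /psi -wE; exact: (transport_id r0 FS Hsec).
(* psi maps M, less the points antipodal to z, to the fibre over z and fixes
   that fibre.  The set psi = x is open and closed; as n > 1, removing isolated
   points does not disconnect M, so psi is constant. *)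
pose C w := F w + z != 0 /\ psi w = x.
pose C' w := F w + z != 0 /\ psi w <> x.
have oC w : C w -> \forall v \near w, C v.
  move=> [wz px]; have [V [oV Vx iV]] := immersion_locally_injective r0 sF FS iF x.
  have nV : nbhs w (psi @^-1` V) by apply: psic => //; apply: open_nbhs_nbhs; rewrite px.
  apply: filterS (filterI nV (near_neq0 wz)) => v [Vv vz]; split=> //.
  by apply: iV => //; rewrite psiF.
have oC' w : C' w -> \forall v \near w, C' v.
  move=> [wz px].
  have nV : nbhs w (psi @^-1` [set v | v <> x]) by apply: psic => //; exact: closed_point.
  by apply: filterS (filterI nV (near_neq0 wz)) => v [Vv vz]; split.
(* By local injectivity [w] is the only nearby point over the antipode, and the punctured coordinate
   ball around it is connected, so one of the two alternatives holds throughout. *)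
have dich w : F w + z == 0 ->
    (\forall v \near w, v = w \/ C v) \/ (\forall v \near w, v = w \/ C' v).
  move=> wz; have [V [oV Vw iV]] := immersion_locally_injective r0 sF FS iF w.
  have [a [rho [rho0 aw H nr]]] := chart_nbhs (open_nbhs_nbhs (conj oV Vw)).
  set p0 := chart_coord (chart_of a) w in H nr.
  have pw : chart_param (chart_of a) p0 = w by exact: chart_coordK.
  have neq q : q != p0 -> `|q - p0| < rho -> F (chart_param (chart_of a) q) + z != 0.
    move=> qp qr; apply/eqP => E; have [iq Vq] := H q qr.
    have : chart_param (chart_of a) q = w.
      apply: iV => //; move/eqP: wz E => <-; exact: addIr.
    move=> E2; have [_] := chart_dom_param iq; rewrite E2 -/p0 => E3.
    by case/eqP: qp.
  pose P q := psi (chart_param (chart_of a) q) = x.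
  have const q q' : q != p0 -> `|q - p0| < rho -> q' != p0 -> `|q' - p0| < rho -> P q -> P q'.
    apply: (@punctured_ball_const R n p0 rho P n1).
      move=> s sp sr Ps; have cs := chart_param_cvg (H s sr).1.
      have : C (chart_param (chart_of a) s) by split=> //; exact: neq.
      move=> /oC/cs nC; have {}nC : \forall t \near s, C (chart_param (chart_of a) t) := nC.
      by apply: filterS nC => t [_ h]; exact: h.
    move=> s sp sr Ps; have cs := chart_param_cvg (H s sr).1.
    have : C' (chart_param (chart_of a) s) by split=> //; exact: neq.
    move=> /oC'/cs nC; have {}nC : \forall t \near s, C' (chart_param (chart_of a) t) := nC.
    by apply: filterS nC => t [_ h]; exact: h.
  have [[q [qp [qr Pq]]]|nP] := pselect (exists q, q != p0 /\ `|q - p0| < rho /\ P q).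
    left; apply: filterS nr => v [q' qr' ->].
    have [->|qp'] := eqVneq q' p0; first by left.
    by right; split; [exact: neq|exact: (const q)].
  right; apply: filterS nr => v [q' qr' ->].
  have [->|qp'] := eqVneq q' p0; first by left.
  by right; split; [exact: neq|move=> Pq; apply: nP; exists q'].
(* [P] and [Q] extend [C] and [C'] over the antipodal fibre by what holds around each point. Both
   are open, and they exclude each other because no point is isolated. *)
pose P w := C w \/ (F w + z == 0 /\ \forall v \near w, v = w \/ C v).
pose Q w := C' w \/ (F w + z == 0 /\ \forall v \near w, v = w \/ C' v).
have oP w : P w -> \forall v \near w, P v.
  case=> [Cw|[wz nw]]; first by apply: filterS (oC w Cw) => v; left.
  by apply: filterS (nw) => v [->|Cv]; [right|left].
have oQ w : Q w -> \forall v \near w, Q v.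
  case=> [Cw|[wz nw]]; first by apply: filterS (oC' w Cw) => v; left.
  by apply: filterS (nw) => v [->|Cv]; [right|left].
have PQ w : P w -> ~ Q w.
  move=> [[wz px]|[wz nw]] [[wz' px']|[wz' nw']] //.
  - by rewrite wz' in wz.
  - by rewrite wz in wz'.
  have [v [E1 E2] vw] := not_isolated n0 (filterI nw nw').
  by case: E1 => // -[_ e1]; case: E2 => // -[_ /(_ e1)].
have QP w : ~ P w -> Q w.
  move=> nP; have [wz|wz] := eqVneq (F w + z) 0.
    case: (dich w); first by rewrite wz.
      by move=> h; case: nP; right; split=> //; rewrite wz.
    by move=> h; right; split=> //; rewrite wz.
  by left; split=> // px; apply: nP; left.
have all : forall w, [set: M] w -> P w.
  apply: (connected_clopen kM).
  - by move=> w _ /oP; apply: filterS.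
  - move=> w _ /QP/oQ; apply: filterS => v Qv _ Pv; exact: (PQ v).
  exists x => //; left; split; last exact: psi_id.
  by rewrite -mulr2n -scaler_nat scaler_eq0 pnatr_eq0 /= -dot_gt0 zr exprn_gt0.
have [[_ py]|[yz _]] := all y I.
  by apply: nxy; rewrite -py psi_id.
move: yz; rewrite -xy -mulr2n -scaler_nat scaler_eq0 pnatr_eq0 /=.
by rewrite -dot_eq0 zr expf_eq0 /= gt_eqF.
Qed.

(** Transport to [z] starts from any point not over the antipode of [z]; such a point exists because
    the antipode has at most one preimage and points are not isolated. *)
Theorem sphere_immersion_surjective (z : 'rV[R]_n.+1) : [set: M] !=set0 ->
  dot z z = r ^+ 2 -> exists x, F x = z.
Proof.
move=> [x0 _] zr.
have [d d0 /choice[sec Hsec]] := uniform_sections r0 sF FS iF cM.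
have [L HL] := close_ex FS d0.
have [x xz] : exists x, F x + z != 0.
  have [E|] := eqVneq (F x0 + z) 0; last by exists x0.
  have [x _ xx0] := not_isolated n0 (@filterT _ (nbhs x0) _).
  exists x; apply/eqP => E'; apply: xx0; apply: sphere_immersion_injective.
  by apply: (addIr z); rewrite E'.
exists (transport F r sec L x z); apply: (transport_over r0 FS d0 Hsec) => //.
exact: HL.
Qed.

Theorem sphere_immersion_diffeo : [set: M] !=set0 -> diffeo_onto (@sphere R n r) F.
Proof.
move=> M0; split; [exact: sF|exact: FS|].
have [x0 _] := M0.
pose G y := xget x0 (fun x => F x = y).
have FG y : sphere r y -> F (G y) = y.
  move=> /(sphere_immersion_surjective M0)[x Fx].
  by apply: (@xgetPex _ x0 (fun x => F x = y)); exists x.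
have GF x : G (F x) = x by apply: sphere_immersion_injective; apply: FG; exact: FS.
exists G; split=> // y Sy.
have [a [V [W [h [[oV Vx oW WF] [sh hE Vh]]]]]] := local_section r0 sF FS iF (G y).
exists a, W, h; split=> //; first by rewrite -(FG y Sy).
move=> z Wz Sz; have [iz Fz] := hE z Wz.
have zE : G z = chart_param (chart_of a) (h z).
  by apply: sphere_immersion_injective; rewrite FG// Fz radial_id.
by rewrite zE; have [c1 c2] := chart_dom_param iz.
Qed.

End SphereImmersion.

(** * Integrals over parallels *)

Local Open Scope ring_scope.

Definition segint (R : realType) (a b : R) (f : R -> R) : R :=
  \int[@lebesgue_measure R]_(x in `[a, b]) f x.

Section SegmentIntegral.
Context (R : realType) (a b : R).
Hypothesis ab : a < b.
Let mu := @lebesgue_measure R.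

Lemma segment_integrable (f : R -> R) : continuous f ->
  mu.-integrable `[a, b] (EFin \o f).
Proof.
move=> cf; apply: continuous_compact_integrable; first exact: segment_compact.
by apply: continuous_subspaceT.
Qed.

Lemma segint_le (f g : R -> R) : continuous f -> continuous g ->
  (forall x, f x <= g x) -> segint a b f <= segint a b g.
Proof.
move=> cf cg fg; apply: le_Rintegral; [exact: measurable_itv|exact: segment_integrable..|].
by move=> x _; exact: fg.
Qed.

Lemma segintB (f g : R -> R) : continuous f -> continuous g ->
  segint a b (fun x => f x - g x) = segint a b f - segint a b g.
Proof.
by move=> cf cg; apply: RintegralB; [exact: measurable_itv|exact: segment_integrable..].
Qed.

Lemma segint_derive (f F : R -> R) : continuous f ->
  (forall x : R, a <= x <= b -> is_derive x (1 : R) F (f x)) -> segint a b f = F b - F a.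
Proof.
move=> cf dF; rewrite /segint /Rintegral.
have cF x : a <= x <= b -> {for x, continuous F}.
  move=> xab; apply: differentiable_continuous; apply/derivable1_diffP.
  by have [] := dF x xab.
rewrite (@continuous_FTC2 R f F a b ab) //.
- by apply: continuous_subspaceT.
- split=> [x||]; first by rewrite in_itv /= => /andP[ax xb]; have [] := dF x; rewrite ?ltW.
    by apply: cvg_at_right_filter; apply: cF; rewrite lexx ltW.
  by apply: cvg_at_left_filter; apply: cF; rewrite lexx ltW.
- move=> x; rewrite in_itv /= derive1E => /andP[ax xb].
  by have [] := dF x; rewrite ?ltW.
Qed.

Lemma antiderivative (f : R -> R) : continuous f ->
  exists F : R -> R, forall x : R, a <= x <= b -> is_derive x (1 : R) F (f x).
Proof.
(* Integrating from a - 1 makes [a] an interior point, so the derivative there is two-sided. *)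
move=> cf; exists (fun x => \int[mu]_(t in `[a - 1, x]) f t) => x /andP[ax xb].
have [||||d1 d2] := @continuous_FTC1_closed R f (a - 1) x (b + 1).
- by rewrite (le_lt_trans xb)// ltrDl.
- apply: continuous_compact_integrable; first exact: segment_compact.
  by apply: continuous_subspaceT.
- by rewrite (lt_le_trans _ ax)// gtrBl.
- exact: cf.
apply: DeriveDef; first exact: d1.
by rewrite -derive1E; exact: d2.
Qed.

Lemma segint_param (f f' : R -> R -> R) (p C : R) :
  (forall q, continuous (f q)) ->
  (forall q t : R, is_derive q (1 : R) (f ^~ t) (f' q t)) ->
  (forall q t, p - 1 < q < p + 1 -> a <= t <= b -> `|f' q t| <= C) ->
  is_derive p (1 : R) (fun q : R => segint a b (f q)) (segint a b (f' p)).
Proof.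
move=> cf df bf.
have C0 : 0 <= C.
  apply: le_trans (bf p a _ _) => //; last by rewrite lexx ltW.
  by rewrite gtrBl ltrDl ltr01.
have Ip : (p - 1 < p < p + 1)%R by rewrite gtrBl ltrDl ltr01.
have pE q t : partial1of2 f q t = f' q t.
  by rewrite partial1of2E; have [] := df q t.
have G1 := @cvg_differentiation_under_integral R _ _ mu f `[a, b] (measurable_itv _) p (p - 1) (p + 1).
have D := @derivable_under_integral R _ _ mu f `[a, b] (measurable_itv _) p (p - 1) (p + 1).
have E := @differentiation_under_integral R _ _ mu f `[a, b] (measurable_itv _) p (p - 1) (p + 1).
have h1 : `]p - 1, p + 1[%classic p by rewrite /= in_itv.
have h2 : forall x, `]p - 1, p + 1[%classic x -> mu.-integrable `[a, b] (EFin \o f x).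
  by move=> x _; exact: segment_integrable.
have h3 : forall x y, `]p - 1, p + 1[%classic x -> `[a, b]%classic y -> derivable (f ^~ y) x 1.
  by move=> x y _ _; have [] := df x y.
have h4 : mu.-integrable `[a, b] (EFin \o (fun _ : R => C)).
  by apply: segment_integrable => x; exact: cvg_cst.
have h5 : forall x y, `]p - 1, p + 1[%classic x -> `[a, b]%classic y -> `|partial1of2 f x y| <= C.
  by move=> x y; rewrite /= !in_itv /= => xp yab; rewrite pE; exact: bf.
apply: DeriveDef.
  exact: (D h1 h2 h3 (fun=> C) (fun=> C0) h4 h5).
rewrite -derive1E [LHS](E h1 h2 h3 (fun=> C) (fun=> C0) h4 h5).
by apply: eq_Rintegral => y _; rewrite pE.
Qed.

End SegmentIntegral.

Lemma is_derive_mull (R : realType) (c t : R) : is_derive t (1 : R) (fun s => c * s) c.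
Proof.
have [e1 e2] := @is_deriveZ R R R id c t 1 1 (is_derive_id t 1).
by apply: DeriveDef => //; rewrite [LHS]e2 /GRing.scale /= mulr1.
Qed.

Lemma derive_ge0_le (R : realType) (f f' : R -> R) (a b : R) : a <= b ->
  (forall x : R, a <= x <= b -> is_derive x (1 : R) f (f' x)) ->
  (forall x, a <= x <= b -> 0 <= f' x) -> f a <= f b.
Proof.
move=> ab df f0; have [->//|anb] := eqVneq a b.
have ltab : a < b by rewrite lt_neqAle anb.
have [||c cin E] := @MVT R f f' a b ltab.
- by move=> x; rewrite in_itv /= => /andP[ax xb]; apply: df; rewrite !ltW.
- by apply: derivable_within_continuous => x; rewrite in_itv /= => xab; have [] := df x xab.
rewrite -subr_ge0 E mulr_ge0 ?subr_ge0//; apply: f0.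
by move: cin; rewrite in_itv /= => /andP[? ?]; rewrite !ltW.
Qed.

Lemma derive_lipschitz (R : realType) (f f' : R -> R) (a b M : R) : a <= b ->
  (forall x : R, a <= x <= b -> is_derive x (1 : R) f (f' x)) ->
  (forall x, a <= x <= b -> `|f' x| <= M) -> `|f b - f a| <= M * (b - a).
Proof.
move=> ab df fM; have [<-|anb] := eqVneq a b; first by rewrite !subrr normr0 mulr0.
have ltab : a < b by rewrite lt_neqAle anb.
have [||c cin ->] := @MVT R f f' a b ltab.
- by move=> x; rewrite in_itv /= => /andP[ax xb]; apply: df; rewrite !ltW.
- by apply: derivable_within_continuous => x; rewrite in_itv /= => xab; have [] := df x xab.
move: cin; rewrite in_itv /= => /andP[ac cb].
rewrite normrM (ger0_norm (_ : 0 <= b - a)) ?subr_ge0// ler_wpM2r ?subr_ge0//.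
by apply: fM; rewrite !ltW.
Qed.

(** * Green's theorem on a band and oscillation along a parallel *)

Definition pt (R : realType) (x y : R) : 'rV[R]_2 :=
  \row_i (if i == 0 then x else y).

Lemma pt0 (R : realType) (x y : R) : pt x y 0 0 = x.
Proof. by rewrite mxE. Qed.

Lemma pt1 (R : realType) (x y : R) : pt x y 0 1 = y.
Proof. by rewrite mxE. Qed.

Lemma ord2P (i : 'I_2) : i = 0 \/ i = 1.
Proof.
by case: i => [[|[|//]]] hi; [left|right]; exact: val_inj.
Qed.

Lemma ptE (R : realType) (v : 'rV[R]_2) : v = pt (v 0 0) (v 0 1).
Proof.
by apply/matrixP => i j; rewrite ord1; case: (ord2P j) => ->; rewrite (pt0, pt1).
Qed.

Section TwoVariables.
Context (R : realType) (f : 'rV[R]_2 -> R).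
Hypothesis sf : smooth_on [set: 'rV[R]_2] f.

Lemma is_derive_pt0 (x y : R) :
  is_derive x (1 : R) (fun x => f (pt x y)) (partial 0 f (pt x y)).
Proof.
have E (t : R) : pt t y = pt 0 y + t *: (delta_mx 0 0 : 'rV[R]_2).
  apply/matrixP => i j; rewrite ord1; case: (ord2P j) => ->.
    by rewrite pt0 !mxE /= mulr1 add0r.
  by rewrite pt1 !mxE /= mulr0 addr0.
have d : differentiable f (pt 0 y + x *: (delta_mx 0 0 : 'rV[R]_2)).
  exact: smooth_on_diff sf I.
have -> : (fun x => f (pt x y)) = (fun x => f (pt 0 y + x *: (delta_mx 0 0 : 'rV[R]_2))).
  by apply/funext => t; rewrite E.
by rewrite (E x) (partialE 0 d); exact: is_derive_line.
Qed.

Lemma is_derive_pt1 (x y : R) :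
  is_derive y (1 : R) (fun y => f (pt x y)) (partial 1 f (pt x y)).
Proof.
have E (t : R) : pt x t = pt x 0 + t *: (delta_mx 0 1 : 'rV[R]_2).
  apply/matrixP => i j; rewrite ord1; case: (ord2P j) => ->.
    by rewrite pt0 !mxE /= mulr0 addr0.
  by rewrite pt1 !mxE /= mulr1 add0r.
have d : differentiable f (pt x 0 + y *: (delta_mx 0 1 : 'rV[R]_2)).
  exact: smooth_on_diff sf I.
have -> : (fun y => f (pt x y)) = (fun y => f (pt x 0 + y *: (delta_mx 0 1 : 'rV[R]_2))).
  by apply/funext => t; rewrite E.
by rewrite (E y) (partialE 1 d); exact: is_derive_line.
Qed.

Lemma continuous_pt0 (y : R) : continuous (fun x => f (pt x y)).
Proof.
move=> x; apply: differentiable_continuous; apply/derivable1_diffP.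
by have [] := is_derive_pt0 x y.
Qed.

Lemma bounded_pt (rho : R) : exists C : R, forall x y, `|x| <= rho -> `|y| <= rho ->
  `|f (pt x y)| <= C.
Proof.
have [r0|r0] := ltP rho 0.
  exists 0 => x y xr; have := le_lt_trans xr r0; by rewrite normr_lt0.
pose A := [set v : 'rV[R]_2 | `|v - 0| <= rho + 1].
have cA : compact A by apply: ball_compact; rewrite ltr_wpDl.
have A0 : A !=set0 by exists 0; rewrite /A /= subr0 normr0 addr_ge0.
have cf : {within A, continuous (fun v => `|f v|)}.
  apply: continuous_subspaceT => v.
  apply: (@continuous_comp _ _ _ f Num.norm); last exact: norm_continuous.
  exact: differentiable_continuous (smooth_on_diff sf I).
have [c _ Hc] := @EVT_max_rV R 2 (fun v => `|f v|) A A0 cA cf.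
exists `|f c| => x y xr yr; apply: Hc; rewrite inE /A /= subr0.
apply: mx_norm_le => [|i j]; first by rewrite addr_ge0.
rewrite ord1; case: (ord2P j) => ->; rewrite (pt0, pt1).
  by rewrite (le_trans xr)// lerDl.
by rewrite (le_trans yr)// lerDl.
Qed.

End TwoVariables.

(* The integral J of -Q over the parallel of height y vanishes at y = h and
   y = -h, and J' is the integral of D, which is almost nonnegative.  Hence J is
   small, and so is J' at some point of any interval that is not too short. *)
Lemma green_mvt (R : realType) (P Q D : 'rV[R]_2 -> R) (T h N tau : R) :
  smooth_on setT P -> smooth_on setT Q -> smooth_on setT D ->
  (forall v, partial 0 P v - partial 1 Q v = D v) ->
  0 < T -> 0 < h -> 0 <= N -> 0 < tau <= h ->
  (forall y, P (pt T y) = P (pt 0 y)) ->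
  (forall x, Q (pt x h) = 0) -> (forall x, Q (pt x (- h)) = 0) ->
  (forall x y, - h <= y <= h -> - N <= D (pt x y)) ->
  exists2 y, 0 < y < tau & segint 0 T (fun x => D (pt x y)) <= 2 * h * N * T / tau.
Proof.
move=> sP sQ sD PQD T0 h0 N0 /andP[tau0 tauh] perP Qh Qh' DN.
have sQ1 : smooth_on setT (partial 1 Q) by exact: smooth_on_partial.
have sP0 : smooth_on setT (partial 0 P) by exact: smooth_on_partial.
pose J y := - segint 0 T (fun x => Q (pt x y)).
pose J' y := segint 0 T (fun x => D (pt x y)).
have dJ (y : R) : is_derive y (1 : R) J (J' y).
  have [C HC] := bounded_pt sQ1 (Num.max T (`|y| + 1)).
  have d1 : is_derive y (1 : R) (fun q : R => segint 0 T (fun x => Q (pt x q)))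
      (segint 0 T (fun x => partial 1 Q (pt x y))).
    apply: (@segint_param R 0 T T0 (fun q x => Q (pt x q)) (fun q x => partial 1 Q (pt x q)) y C).
    - by move=> q; exact: continuous_pt0.
    - by move=> q t; exact: is_derive_pt1.
    move=> q t /andP[q1 q2] /andP[t1 t2]; apply: HC.
      by rewrite ger0_norm// le_max t2.
    rewrite le_max; apply/orP; right; rewrite -(subrK y q) addrC.
    by rewrite (le_trans (ler_normD _ _))// lerD2l ler_norml; apply/andP; split; lra.
  have d2 : segint 0 T (fun x => partial 0 P (pt x y)) = 0.
    have -> := @segint_derive R 0 T T0 (fun x => partial 0 P (pt x y)) (fun x => P (pt x y))
      (@continuous_pt0 R _ sP0 y) (fun x _ => is_derive_pt0 sP x y).
    by rewrite perP subrr.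
  have E : J' y = - segint 0 T (fun x => partial 1 Q (pt x y)).
    have := @segintB R 0 T (fun x => partial 0 P (pt x y)) (fun x => partial 1 Q (pt x y))
      (@continuous_pt0 R _ sP0 y) (@continuous_pt0 R _ sQ1 y).
    rewrite d2 sub0r => <-.
    by congr (segint _ _ _); apply/funext => x; rewrite PQD.
  by rewrite E; exact: is_deriveN.
have J'N y : - h <= y <= h -> - (N * T) <= J' y.
  move=> yh.
  have -> : - (N * T) = segint 0 T (fun=> - N).
    have -> := @segint_derive R 0 T T0 (fun=> - N) (fun x => - N * x) (fun x => cvg_cst _)
      (fun x _ => is_derive_mull (- N) x).
    by rewrite mulr0 subr0 mulNr.
  apply: segint_le => //; first by move=> x; exact: cvg_cst.
    exact: continuous_pt0.
  by move=> x; exact: DN.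
have J0 : J h = 0 /\ J (- h) = 0.
  have z0 : segint 0 T (fun=> (0 : R)) = 0.
    have -> := @segint_derive R 0 T T0 (fun=> 0) (fun=> 0) (fun x => cvg_cst _)
      (fun x _ => is_derive_cst _ x 1).
    by rewrite subrr.
  by rewrite /J; split; rewrite (_ : (fun x => Q _) = fun=> 0) ?z0 ?oppr0//; apply/funext => x.
(* Adding N T y makes the function nondecreasing, whence J(0) >= - N T h and J(tau) <= N T h; their
   difference is the 2 h N T of the conclusion. *)
pose K y := J y + N * T * y.
have dK (y : R) : is_derive y (1 : R) K (J' y + N * T).
  exact: (is_deriveD (dJ y) (is_derive_mull (N * T) y)).
have K1 : K (- h) <= K 0.
  apply: (@derive_ge0_le R K (fun y => J' y + N * T)); first by rewrite oppr_le0 ltW.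
  by move=> x xh; rewrite -lerBlDr sub0r; apply: J'N; move: xh; lra.
have K2 : K tau <= K h.
  apply: (@derive_ge0_le R K (fun y => J' y + N * T)); first exact: tauh.
  by move=> x xh; rewrite -lerBlDr sub0r; apply: J'N; move: xh; lra.
have [|c cin E] := @MVT R J J' 0 tau tau0.
  by apply: derivable_within_continuous => x _; have [] := dJ x.
exists c; first by move: cin; rewrite in_itv.
rewrite -/(J' c) ler_pdivlMr// -[tau in J' c * tau]subr0 -E.
move: K1 K2; rewrite /K; have [-> ->] := J0.
have : 0 <= N * T * tau by rewrite !mulr_ge0// ltW.
by lra.
Qed.

(** A Cauchy-Schwarz bound in linearized form: with the free parameter [lam], the square of g'
    enters linearly, so that an integral bound on [D] suffices. *)
Lemma circle_step (R : realType) (D g g' : R -> R) (T K N lam x : R) :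
  0 < T -> 0 < lam -> 0 <= K -> 0 <= N -> 0 <= x <= T ->
  continuous D -> (forall t, - N <= D t) ->
  (forall t : R, is_derive t (1 : R) g (g' t)) ->
  (forall t, g' t ^+ 2 <= K * (D t + 2 * N)) ->
  g x - g 0 <= lam / 2 * T + K / (2 * lam) * (segint 0 T D + 3 * N * T).
Proof.
move=> T0 lam0 K0 N0 /andP[x0 xT] cD DN dg g2.
have [F dF] := antiderivative 0 T cD.
have IF : segint 0 T D = F T - F 0.
  exact: (segint_derive T0 cD dF).
pose m t := (lam / 2 * t + K / (2 * lam) * (F t + 2 * N * t)) - g t.
have dm (t : R) : 0 <= t <= x -> is_derive t (1 : R) m
    ((lam / 2 + K / (2 * lam) * (D t + 2 * N)) - g' t).
  move=> /andP[t0 tx].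
  have dFt := dF t ltac:(by rewrite t0 (le_trans tx)).
  have d1 := is_deriveD dFt (is_derive_mull (2 * N) t).
  have d2 := @is_deriveZ R R R _ (K / (2 * lam)) t 1 _ d1.
  exact: (is_deriveB (is_deriveD (is_derive_mull (lam / 2) t) d2) (dg t)).
(* AM-GM: g' <= lam / 2 + g' ^ 2 / (2 lam) *)
have m1 : m 0 <= m x.
  apply: (derive_ge0_le x0 dm) => t _; rewrite subr_ge0.
  have := g2 t; set d := D t + 2 * N; set y := g' t => yd.
  have -> : lam / 2 + K / (2 * lam) * d = (lam ^+ 2 + K * d) / (2 * lam).
    by field; rewrite gt_eqF.
  rewrite ler_pdivlMr ?mulr_gt0//.
  have := sqr_ge0 (lam - y); nra.
have dF1 (t : R) : x <= t <= T -> is_derive t (1 : R) (fun t => F t + N * t) (D t + N).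
  move=> /andP[xt tT]; have dFt := dF t ltac:(by rewrite tT (le_trans x0)).
  exact: (is_deriveD dFt (is_derive_mull N t)).
(* As D + N >= 0, the integral up to [x] is at most the one up to [T], up to multiples of N T that
   the coefficient 3 absorbs. *)
have F1 : F x + N * x <= F T + N * T.
  by apply: (derive_ge0_le xT dF1) => t _; rewrite -lerBlDr sub0r.
rewrite IF; move: m1; rewrite /m !mulr0 addr0 add0r => m1.
have k0 : 0 <= K / (2 * lam) by rewrite divr_ge0// mulr_ge0// ltW.
have : K / (2 * lam) * (F x - F 0 + 2 * N * x) <= K / (2 * lam) * (F T - F 0 + 3 * N * T).
  rewrite ler_wpM2l//; have := ler_wpM2l N0 xT; have := mulr_ge0 N0 x0; lra.
have : lam / 2 * x <= lam / 2 * T by rewrite ler_wpM2l// divr_ge0// ltW.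
move: m1; rewrite !mulrDr !mulrN; lra.
Qed.

(** * Parametrizations by the normal *)

Notation o0 := (@Ordinal 3 0 isT).
Notation o1 := (@Ordinal 3 1 isT).
Notation o2 := (@Ordinal 3 2 isT).

Definition r3 (R : realType) (a b c : R) : 'rV[R]_3 := \row_i nth 0 [:: a; b; c] i.

Lemma r3E (R : realType) (a b c : R) :
  (r3 a b c 0 o0 = a) * (r3 a b c 0 o1 = b) * (r3 a b c 0 o2 = c).
Proof. by rewrite !mxE. Qed.

Lemma ord3P (i : 'I_3) : [\/ i = o0, i = o1 | i = o2].
Proof.
by case: i => [[|[|[|//]]]] hi; [constructor 1|constructor 2|constructor 3]; exact: val_inj.
Qed.

Lemma rV3P (R : realType) (u v : 'rV[R]_3) :
  u 0 o0 = v 0 o0 -> u 0 o1 = v 0 o1 -> u 0 o2 = v 0 o2 -> u = v.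
Proof.
by move=> e0 e1 e2; apply/matrixP => i j; rewrite ord1; case: (ord3P j) => ->.
Qed.

Lemma sum3 (V : nmodType) (f : 'I_3 -> V) : \sum_i f i = f o0 + f o1 + f o2.
Proof.
rewrite !big_ord_recl big_ord0 addr0 addrA.
by congr (f _ + f _ + f _); exact: val_inj.
Qed.

Lemma dot3 (R : realType) (u v : 'rV[R]_3) :
  dot u v = u 0 o0 * v 0 o0 + u 0 o1 * v 0 o1 + u 0 o2 * v 0 o2.
Proof. by rewrite dotE sum3. Qed.

(** The determinant det(a, b, c), expanded along [a]. *)
Definition tri (R : realType) (a b c : 'rV[R]_3) : R :=
  a 0 o0 * (b 0 o1 * c 0 o2 - b 0 o2 * c 0 o1)
  + a 0 o1 * (b 0 o2 * c 0 o0 - b 0 o0 * c 0 o2)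
  + a 0 o2 * (b 0 o0 * c 0 o1 - b 0 o1 * c 0 o0).

(** A symmetric [L] that kills [w] preserves the plane of [e] and [f], so its invariants are those
    of a symmetric 2 by 2 matrix; the last one is the determinant on that plane. *)
Lemma frame_decomp (R : realType) (e f w : 'rV[R]_3) (L : 'M[R]_3) :
  dot e e = 1 -> dot f f = 1 -> dot w w = 1 ->
  dot e f = 0 -> dot e w = 0 -> dot f w = 0 ->
  L^T = L -> w *m L = 0 ->
  exists a b d : R, [/\ e *m L = a *: e + b *: f, f *m L = b *: e + d *: f,
     \tr L = a + d & (\tr L ^+ 2 - \tr (L *m L)) / 2 = a * d - b ^+ 2].
Proof.
move=> ee ff ww ef ew fw sL wL.
pose O : 'M[R]_3 := \matrix_i (if i == o0 then e else if i == o1 then f else w).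
have rO : (row o0 O = e) * (row o1 O = f) * (row o2 O = w).
  by rewrite !rowK.
have OO : O *m O^T = 1%:M.
  have E i j : (O *m O^T) i j = dot (row i O) (row j O).
    by rewrite !mxE dotE; apply: eq_bigr => k _; rewrite !mxE.
  apply/matrixP => i j; rewrite E [RHS]mxE.
  by case: (ord3P i) => ->; case: (ord3P j) => -> /=; rewrite !rO ?(dotC f e) ?(dotC w e) ?(dotC w f).
have OO' := mulmx1C OO.
pose W := O *m L *m O^T.
have WE i j : W i j = dot (row i O *m L) (row j O).
  rewrite /W mxE dotE; apply: eq_bigr => k _; rewrite -row_mul.
  by rewrite [X in _ = X * _]mxE; congr (_ * _); rewrite !mxE.
have Ws i j : W i j = W j i by rewrite !WE dot_mulmxl sL dotC.
have W2 i : W o2 i = 0 by rewrite WE rO wL dot0l.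
have W2' i : W i o2 = 0 by rewrite Ws W2.
have exp i : row i O *m L = W i o0 *: e + W i o1 *: f.
  have -> : row i O *m L = row i W *m O.
    by rewrite -[LHS]mulmx1 -OO' -!row_mul /W !mulmxA.
  rewrite mulmx_sum_row sum3 !rO ![row i W 0 _]mxE W2' scale0r addr0.
  by [].
have trL : \tr L = W o0 o0 + W o1 o1.
  have -> : \tr L = \tr W by rewrite /W mxtrace_mulC mulmxA OO' mul1mx.
  by rewrite /mxtrace sum3 W2 addr0.
have trLL : \tr (L *m L) = W o0 o0 ^+ 2 + W o1 o1 ^+ 2 + 2 * W o0 o1 ^+ 2.
  have -> : \tr (L *m L) = \tr (W *m W).
    have -> : W *m W = O *m (L *m L) *m O^T.
      by rewrite /W !mulmxA -(mulmxA (O *m L) O^T O) OO' mulmx1.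
    by rewrite [RHS]mxtrace_mulC (mulmxA O^T O) OO' mul1mx.
  have E5 i j : (W *m W) i j = \sum_k W i k * W k j by rewrite mxE.
  rewrite /mxtrace sum3 !E5 !sum3 !W2 !W2' (Ws o1 o0); ring.
exists (W o0 o0), (W o0 o1), (W o1 o1); split.
- by rewrite -(exp o0) rO.
- by rewrite (Ws o0 o1) -(exp o1) rO.
- exact: trL.
- by rewrite trL trLL; field.
Qed.

Lemma partial_tri (R : realType) (n : nat) (f g h : 'rV[R]_n -> 'rV[R]_3) i x :
  differentiable f x -> differentiable g x -> differentiable h x ->
  partial i (fun y => tri (f y) (g y) (h y)) x =
  tri (partial i f x) (g x) (h x) + tri (f x) (partial i g x) (h x)
  + tri (f x) (g x) (partial i h x).
Proof.
move=> df dg dh.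
have fE b : differentiable (fun y => f y 0 b) x /\ partial i (fun y => f y 0 b) x = partial i f x 0 b.
  by rewrite (partial_mxE i 0 b df); split=> //; exact: ((differentiable_mxP _ _).1 df 0 b).
have gE b : differentiable (fun y => g y 0 b) x /\ partial i (fun y => g y 0 b) x = partial i g x 0 b.
  by rewrite (partial_mxE i 0 b dg); split=> //; exact: ((differentiable_mxP _ _).1 dg 0 b).
have hE b : differentiable (fun y => h y 0 b) x /\ partial i (fun y => h y 0 b) x = partial i h x 0 b.
  by rewrite (partial_mxE i 0 b dh); split=> //; exact: ((differentiable_mxP _ _).1 dh 0 b).
have mE (p q : 'rV[R]_n -> R) (dp dq : R) :
    (differentiable p x /\ partial i p x = dp) -> (differentiable q x /\ partial i q x = dq) ->
    differentiable (fun y => p y * q y) x /\ partial i (fun y => p y * q y) x = dp * q x + p x * dq.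
  move=> [p1 p2] [q1 q2]; split; first exact: differentiableM p1 q1.
  by rewrite (partialM i p1 q1) p2 q2.
have aE (p q : 'rV[R]_n -> R) (dp dq : R) :
    (differentiable p x /\ partial i p x = dp) -> (differentiable q x /\ partial i q x = dq) ->
    differentiable (fun y => p y + q y) x /\ partial i (fun y => p y + q y) x = dp + dq.
  move=> [p1 p2] [q1 q2]; split; first exact: differentiableD p1 q1.
  by rewrite (partialD i p1 q1) p2 q2.
have bE (p q : 'rV[R]_n -> R) (dp dq : R) :
    (differentiable p x /\ partial i p x = dp) -> (differentiable q x /\ partial i q x = dq) ->
    differentiable (fun y => p y - q y) x /\ partial i (fun y => p y - q y) x = dp - dq.
  move=> [p1 p2] [q1 q2]; split; first exact: differentiableB p1 q1.
  by rewrite (partialB i p1 q1) p2 q2.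
have [_ ->] := aE _ _ _ _ (aE _ _ _ _
   (mE _ _ _ _ (fE o0) (bE _ _ _ _ (mE _ _ _ _ (gE o1) (hE o2)) (mE _ _ _ _ (gE o2) (hE o1))))
   (mE _ _ _ _ (fE o1) (bE _ _ _ _ (mE _ _ _ _ (gE o2) (hE o0)) (mE _ _ _ _ (gE o0) (hE o2)))))
   (mE _ _ _ _ (fE o2) (bE _ _ _ _ (mE _ _ _ _ (gE o0) (hE o1)) (mE _ _ _ _ (gE o1) (hE o0)))).
rewrite /tri.
move: (partial i f x) (partial i g x) (partial i h x) (f x) (g x) (h x) => a b c a' b' c'.
ring.
Qed.

Lemma smooth_tri (R : realType) (n : nat) (U : set 'rV[R]_n) (f g h : 'rV[R]_n -> 'rV[R]_3) :
  open U -> smooth_on U f -> smooth_on U g -> smooth_on U h ->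
  smooth_on U (fun y => tri (f y) (g y) (h y)).
Proof.
move=> oU sf sg sh; apply/smooth_onP => k.
have cf b := (smooth_onP _ _).1 ((smooth_on_mxP _ oU).1 sf 0 b) k.
have cg b := (smooth_onP _ _).1 ((smooth_on_mxP _ oU).1 sg 0 b) k.
have ch b := (smooth_onP _ _).1 ((smooth_on_mxP _ oU).1 sh 0 b) k.
have cB (p q : 'rV[R]_n -> R) : Ck k U p -> Ck k U q -> Ck k U (fun y => p y - q y).
  move=> cp cq; apply: (@Ck_ext _ _ _ _ _ (fun y => p y + (-1) * q y) _ oU).
    by move=> y _; rewrite mulN1r.
  by apply: (CkD oU cp); apply: (CkM oU _ cq); exact: Ck_cst.
by rewrite /tri; apply: (CkD oU); first apply: (CkD oU); apply: (CkM oU) => //;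
  apply: cB; apply: (CkM oU).
Qed.

Lemma cauchy_schwarz (R : realType) (m : nat) (u v : 'rV[R]_m) :
  dot u v ^+ 2 <= dot u u * dot v v.
Proof.
have [->|u0] := eqVneq u 0; first by rewrite !dot0l expr0n /= mul0r.
have uu : 0 < dot u u by rewrite dot_gt0.
have := dot_ge0 (dot u u *: v - dot u v *: u).
rewrite dotBl !dotBr !dotZl !dotZr (dotC v u) => H.
rewrite -subr_ge0 -(pmulr_rge0 _ uu).
by move: H; rewrite (_ : _ - _ = dot u u * (dot u u * dot v v - dot u v ^+ 2))//; ring.
Qed.

(** Spherical coordinates with longitude [v 0 0] and latitude [v 0 1]; [eth] and [eph] are the unit
    tangents of the parallels and the meridians. *)
Definition sphm (R : realType) (v : 'rV[R]_2) : 'rV[R]_3 :=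
  r3 (cos (v 0 1) * cos (v 0 0)) (cos (v 0 1) * sin (v 0 0)) (sin (v 0 1)).

Definition eth (R : realType) (v : 'rV[R]_2) : 'rV[R]_3 :=
  r3 (- sin (v 0 0)) (cos (v 0 0)) 0.

Definition eph (R : realType) (v : 'rV[R]_2) : 'rV[R]_3 :=
  r3 (- (sin (v 0 1) * cos (v 0 0))) (- (sin (v 0 1) * sin (v 0 0))) (cos (v 0 1)).

Lemma smooth_onM (R : realType) (n : nat) (V : set 'rV[R]_n) (f g : 'rV[R]_n -> R) : open V ->
  smooth_on V f -> smooth_on V g -> smooth_on V (fun x => f x * g x).
Proof.
by move=> oV /smooth_onP sf /smooth_onP sg; apply/smooth_onP => k; exact: CkM.
Qed.

Section Spherical.
Context (R : realType).
Implicit Type v : 'rV[R]_2.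

Lemma spherical_frame v :
  [/\ dot (eth v) (eth v) = 1, dot (eph v) (eph v) = 1 & dot (sphm v) (sphm v) = 1] /\
  [/\ dot (eth v) (eph v) = 0, dot (eth v) (sphm v) = 0 & dot (eph v) (sphm v) = 0].
Proof.
have h0 := cos2Dsin2 (v 0 0); have h1 := cos2Dsin2 (v 0 1).
rewrite !dot3 /eth /eph /sphm !r3E.
move: h0 h1; set c := cos (v 0 0); set s := sin (v 0 0).
set C := cos (v 0 1); set S := sin (v 0 1) => h0 h1.
have hs : s ^+ 2 = 1 - c ^+ 2 by rewrite -h0; ring.
have hS : S ^+ 2 = 1 - C ^+ 2 by rewrite -h1; ring.
split; split; try ring.
- by rewrite -h0; ring.
- transitivity (S ^+ 2 * (c ^+ 2 + s ^+ 2) + C ^+ 2); first by ring.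
  by rewrite h0 hS; ring.
- transitivity (C ^+ 2 * (c ^+ 2 + s ^+ 2) + S ^+ 2); first by ring.
  by rewrite h0 hS; ring.
transitivity (C * S * (1 - (c ^+ 2 + s ^+ 2))); first by ring.
by rewrite h0; ring.
Qed.

Lemma sphm_neq0 v : sphm v != 0.
Proof.
by have [[_ _ /dot1_neq0]] := spherical_frame v.
Qed.

Lemma spherical_cross v : forall w : 'rV[R]_3, tri w (eth v) (eph v) = dot w (sphm v).
Proof.
move=> w; have h0 := cos2Dsin2 (v 0 0).
rewrite /tri dot3 /eth /eph /sphm !r3E.
move: h0; set c := cos (v 0 0); set s := sin (v 0 0).
set C := cos (v 0 1); set S := sin (v 0 1) => h0.
transitivity (w 0 o0 * (C * c) + w 0 o1 * (C * s) + w 0 o2 * (S * (c ^+ 2 + s ^+ 2))).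
  by ring.
by rewrite h0 mulr1.
Qed.

Lemma smooth_cos (j : 'I_2) : smooth_on setT (fun v => cos (v 0 j) : R).
Proof. by apply/smooth_onP => k; have [] := Ck_cossin openT (@Ck_coord R 2 k setT 0 j). Qed.

Lemma smooth_sin (j : 'I_2) : smooth_on setT (fun v => sin (v 0 j) : R).
Proof. by apply/smooth_onP => k; have [] := Ck_cossin openT (@Ck_coord R 2 k setT 0 j). Qed.

Lemma smooth_sphm : smooth_on setT (@sphm R).
Proof.
apply/(smooth_on_mxP _ openT) => i j; rewrite ord1 /sphm.
case: (ord3P j) => ->; under eq_fun do rewrite r3E.
- exact: (smooth_onM openT (smooth_cos 1) (smooth_cos 0)).
- exact: (smooth_onM openT (smooth_cos 1) (smooth_sin 0)).
- exact: smooth_sin.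
Qed.

Let dcos k j v : differentiable (fun v => cos (v 0 j) : R) v /\
  partial k (fun v => cos (v 0 j) : R) v = - sin (v 0 j) * (delta_mx 0 k : 'rV[R]_2) 0 j.
Proof.
rewrite -(partial_coord k j 0 v).
by apply: (@diff_comp1 R 2 (fun v => v 0 j) cos); exact: differentiable_coord.
Qed.

Let dsin k j v : differentiable (fun v => sin (v 0 j) : R) v /\
  partial k (fun v => sin (v 0 j) : R) v = cos (v 0 j) * (delta_mx 0 k : 'rV[R]_2) 0 j.
Proof.
rewrite -(partial_coord k j 0 v).
by apply: (@diff_comp1 R 2 (fun v => v 0 j) sin); exact: differentiable_coord.
Qed.

Lemma partial_sphm v :
  partial 0 (@sphm R) v = cos (v 0 1) *: eth v /\ partial 1 (@sphm R) v = eph v.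
Proof.
have d : differentiable (@sphm R) v := smooth_on_diff smooth_sphm I.
have E0 : (fun v => sphm v 0 o0) = (fun v => cos (v 0 1) * cos (v 0 0)).
  by apply/funext => x; rewrite /sphm r3E.
have E1 : (fun v => sphm v 0 o1) = (fun v => cos (v 0 1) * sin (v 0 0)).
  by apply/funext => x; rewrite /sphm r3E.
have E2 : (fun v => sphm v 0 o2) = (fun v => sin (v 0 1)).
  by apply/funext => x; rewrite /sphm r3E.
have d00 : (delta_mx 0 0 : 'rV[R]_2) 0 0 = 1 by rewrite mxE.
have d01 : (delta_mx 0 0 : 'rV[R]_2) 0 1 = 0 by rewrite mxE.
have d10 : (delta_mx 0 1 : 'rV[R]_2) 0 0 = 0 by rewrite mxE.
have d11 : (delta_mx 0 1 : 'rV[R]_2) 0 1 = 1 by rewrite mxE.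
have c k j := (dcos k j v).1; have s k j := (dsin k j v).1.
have cE k j := (dcos k j v).2; have sE k j := (dsin k j v).2.
split; apply: rV3P; rewrite (partial_mxE _ _ _ d).
- rewrite E0 (partialM 0 (c 0 1) (c 0 0)) !cE d00 d01 mxE /eth r3E; ring.
- rewrite E1 (partialM 0 (c 0 1) (s 0 0)) cE sE d00 d01 mxE /eth r3E; ring.
- by rewrite E2 sE d01 mxE /eth r3E !mulr0.
- rewrite E0 (partialM 1 (c 0 1) (c 0 0)) !cE d10 d11 /eph r3E; ring.
- rewrite E1 (partialM 1 (c 0 1) (s 0 0)) cE sE d10 d11 /eph r3E; ring.
- by rewrite E2 sE d11 /eph r3E mulr1.
Qed.

End Spherical.

(** For a symmetric 2 by 2 matrix with trace [t] and determinant [e], the left-hand side is its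
    squared distance to r id. [c] is the cosine of the latitude, and c >= 1/2 keeps [D] effective
    away from the poles. *)
Lemma speed_arith (R : realType) (r s eta t e D c C : R) :
  0 < r -> 0 < s -> r / 2 <= s -> s <= r -> 0 <= eta -> s ^+ 2 = r ^+ 2 - eta ->
  s <= t / 2 -> t <= C -> s ^+ 2 <= e -> e <= s ^+ 2 + 2 * eta ->
  c * (s * (t / 2) - e) <= D -> - (2 * eta) <= D -> c <= 1 -> 1 / 2 <= c ->
  t ^+ 2 - 2 * e - 2 * r * t + 2 * r ^+ 2 <= (8 * C / r + 1) * (D + 2 * (2 * eta)) /\
  t ^+ 2 - 2 * e - 2 * r * t + 2 * r ^+ 2 <= (C + 2 * r) ^+ 2.
Proof.
move=> r0 s0 rs sr eta0 s2 t0 tC e0 e1 D1 D2 c1 c2.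
have tt : 0 <= t by lra.
have CC : 0 <= C by lra.
split.
  have E : s * (t / 2) - e <= 2 * (D + 2 * eta).
    have [E0|E0] := leP 0 (s * (t / 2) - e); last by lra.
    have : 1 / 2 * (s * (t / 2) - e) <= c * (s * (t / 2) - e) by exact: ler_wpM2r.
    by lra.
  have X1 : s * (t / 2 - s) <= 2 * (D + 2 * (2 * eta)).
    by rewrite mulrBr -expr2; lra.
  have x0 : 0 <= t / 2 - s by rewrite subr_ge0.
  have X2 : r / 2 * (t / 2 - s) <= s * (t / 2 - s) by exact: ler_wpM2r.
  have X3 : t / 2 - s <= 4 / r * (D + 2 * (2 * eta)).
    rewrite -(ler_pM2l (_ : 0 < r / 2)); last by rewrite divr_gt0.
    have -> : r / 2 * (4 / r * (D + 2 * (2 * eta))) = 2 * (D + 2 * (2 * eta)).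
      by field; rewrite gt_eqF.
    by lra.
  (* What remains of the left-hand side, 2 r^2 - 2 e, is at most 2 eta, hence at most D + 4 eta. *)
  have X4 : t ^+ 2 - 2 * r * t <= 2 * t * (t / 2 - s).
    have : t * s <= t * r by exact: ler_wpM2l.
    by rewrite (_ : 2 * t * (t / 2 - s) = t ^+ 2 - 2 * (t * s)); [lra|field].
  have X5 : 2 * t * (t / 2 - s) <= 2 * C * (4 / r * (D + 2 * (2 * eta))).
    by apply: ler_pM; rewrite ?mulr_ge0// ler_pM2l.
  have -> : (8 * C / r + 1) * (D + 2 * (2 * eta)) =
      2 * C * (4 / r * (D + 2 * (2 * eta))) + (D + 2 * (2 * eta)).
    by field; rewrite gt_eqF.
  by lra.
have : t ^+ 2 <= C ^+ 2 by rewrite ler_pXn2r.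
have : 0 <= r * t by rewrite mulr_ge0// ltW.
have : 0 <= C * r by rewrite mulr_ge0// ltW.
have : 0 <= r ^+ 2 by exact: sqr_ge0.
have : 0 <= s ^+ 2 by exact: sqr_ge0.
rewrite (_ : (C + 2 * r) ^+ 2 = C ^+ 2 + 4 * (C * r) + 4 * r ^+ 2); last by ring.
by rewrite (_ : 2 * r * t = 2 * (r * t)); [lra|ring].
Qed.

(** * Oscillation of an almost round map on the sphere *)

Section SphereMap.
Context (R : realType) (U : 'rV[R]_3 -> 'rV[R]_3) (r C eta : R).
Hypotheses (r0 : 0 < r) (C0 : 0 < C) (eta0 : 0 <= eta) (etar : eta <= 3 / 4 * r ^+ 2).
Hypothesis sU : smooth_on [set z : 'rV[R]_3 | z != 0] U.
Let L y := jacobian U y.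
Let e2 y := (\tr (L y) ^+ 2 - \tr (L y *m L y)) / 2.
Hypothesis hL : forall y, dot y y = 1 ->
  [/\ (L y)^T = L y, y *m L y = 0, 0 < \tr (L y) <= C &
      r ^+ 2 - eta <= e2 y <= r ^+ 2 + eta].

(** Comparing with [s0] instead of [r] makes two signs exact: the determinant is at least s0^2,
    hence the half trace is at least s0. The bound on [eta] keeps s0 >= r / 2. *)
Let s0 := Num.sqrt (r ^+ 2 - eta).
Let s0r : r / 2 <= s0 <= r.
Proof.
have h : (r / 2) ^+ 2 <= r ^+ 2 - eta.
  have -> : (r / 2) ^+ 2 = r ^+ 2 / 4 by field.
  have := etar; move: (r ^+ 2) => q; lra.
apply/andP; split.
  by rewrite -[leLHS]ger0_norm ?divr_ge0 ?(ltW r0)// -sqrtr_sqr ler_wsqrtr.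
rewrite -[leRHS]ger0_norm ?(ltW r0)// -sqrtr_sqr ler_wsqrtr//.
by rewrite gerBl.
Qed.
Let s02 : s0 ^+ 2 = r ^+ 2 - eta.
Proof. by rewrite sqr_sqrtr// subr_ge0; have := etar; have := sqr_ge0 r; lra. Qed.

Let openZ := @open_neq0 R 3.

Let u v := U (sphm v).

Let su : smooth_on setT u.
Proof.
apply: (@smooth_on_comp _ _ _ _ _ setT _ U _ openT openZ _ sU (@smooth_sphm R)) => v _.
exact: sphm_neq0.
Qed.

Let du v : differentiable u v. Proof. exact: smooth_on_diff su I. Qed.
Let dw v : differentiable (@sphm R) v. Proof. exact: smooth_on_diff (@smooth_sphm R) I. Qed.

Let partial_u i v : partial i u v = partial i (@sphm R) v *m L (sphm v).
Proof.
have dU : differentiable U (sphm v) by apply: smooth_on_diff sU _; exact: sphm_neq0.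
by rewrite -(row_jacobian i (du v)) (jacobian_comp (dw v) dU) row_mul (row_jacobian i (dw v)).
Qed.

Let frame v : exists a b d : R,
  [/\ partial 0 u v = cos (v 0 1) *: (a *: eth v + b *: eph v),
      partial 1 u v = b *: eth v + d *: eph v,
      \tr (L (sphm v)) = a + d & e2 (sphm v) = a * d - b ^+ 2].
Proof.
have [[h1 h2 h3] [h4 h5 h6]] := spherical_frame v.
have [sL yL _ _] := hL h3.
have [a [b [d [E1 E2 E3 E4]]]] := frame_decomp h1 h2 h3 h4 h5 h6 sL yL.
have [p0 p1] := partial_sphm v.
by exists a, b, d; split; rewrite ?partial_u ?p0 ?p1 -?scalemxAl ?E1 ?E2.
Qed.

Let south := u (pt 0 (- (pi / 2))).

(* The support function of the surface with the origin moved to its south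
   pole. *)
Let height v := dot (u v - south) (sphm v).

Let is_derive_dot (f : 'rV[R]_2 -> 'rV[R]_3) (z : 'rV[R]_3) : smooth_on setT f ->
  (forall x y : R, is_derive x (1 : R) (fun x => dot (f (pt x y)) z) (dot (partial 0 f (pt x y)) z)) /\
  (forall x y : R, is_derive y (1 : R) (fun y => dot (f (pt x y)) z) (dot (partial 1 f (pt x y)) z)).
Proof.
move=> sf.
have sd : smooth_on setT (fun v => dot (f v) z).
  apply/smooth_onP => k; apply: (Ck_dot openT); first by have /smooth_onP := sf.
  exact: Ck_cst.
have E i v : partial i (fun v => dot (f v) z) v = dot (partial i f v) z.
  have df : differentiable f v := smooth_on_diff sf I.
  have -> : (fun v => dot (f v) z) = (fun v => \sum_b f v 0 b * z 0 b).
    by apply/funext => x; rewrite dotE.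
  have dfb b : differentiable (fun q => f q 0 b) v.
    exact: ((differentiable_mxP _ _).1 df 0 b).
  rewrite (@partial_sum _ _ _ i _ (fun b v => f v 0 b * z 0 b)); last first.
    by move=> b; apply: differentiableM; [exact: dfb|exact: differentiable_cst].
  rewrite dotE; apply: eq_bigr => b _.
  rewrite (partialM i (dfb b) (differentiable_cst (z 0 b) v)) partial_cst mulr0 addr0.
  by rewrite -(partial_mxE i 0 b df).
by split=> x y; rewrite -E; [exact: is_derive_pt0|exact: is_derive_pt1].
Qed.

(** Along the meridian from the south pole to the latitude of [v], the product with the fixed normal
    [z] has derivative d sin(y - t), and d > 0 by positivity of the trace and determinant. *)
Lemma height_ge0 (v : 'rV[R]_2) :
  - (@pi R / 2) <= v 0 1 <= @pi R / 2 -> 0 <= height v.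
Proof.
move=> /andP[v1 v2]; rewrite {1}(ptE v) /height; set x := v 0 0; set y := v 0 1.
set z := sphm (pt x y).
(* At the pole the longitude is irrelevant, so the meridian through [v] may be used. *)
have southE : south = u (pt x (- (pi / 2))).
  rewrite /south /u; congr U; apply: rV3P; rewrite /sphm !r3E ?pt1 ?pt0//.
    by rewrite cosN cos_pihalf !mul0r.
  by rewrite cosN cos_pihalf !mul0r.
rewrite dotBl subr_ge0 southE.
have [_ D] := is_derive_dot z su.
apply: (@derive_ge0_le R (fun t => dot (u (pt x t)) z)
  (fun t => dot (partial 1 u (pt x t)) z) (- (pi / 2)) y v1) => t /andP[t1 t2].
have [[h1 h2 h3] [h4 h5 h6]] := spherical_frame (pt x t).
have [a [b [d [_ E2 E3 E4]]]] := frame (pt x t).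
rewrite E2 dotDl !dotZl.
have hs := cos2Dsin2 x.
have -> : dot (eth (pt x t)) z = 0.
  by rewrite dot3 /z /eth /sphm !r3E !pt0 !pt1; ring.
have -> : dot (eph (pt x t)) z = sin (y - t).
  rewrite sinB dot3 /z /eph /sphm !r3E !pt0 !pt1.
  transitivity (sin y * cos t - sin t * cos y * (cos x ^+ 2 + sin x ^+ 2)); first by ring.
  by rewrite hs; ring.
rewrite mulr0 add0r mulr_ge0//; last first.
  apply: sin_ge0_pi; move: t1 t2 v2 (pi_gt0 R); rewrite -/y => t1 t2 v2 pp.
  by apply/andP; split; lra.
have [_ _ /andP[tr0 _] /andP[e0 _]] := hL h3.
have e20 : 0 < a * d - b ^+ 2.
  rewrite -E4; apply: lt_le_trans e0; have : 0 < r ^+ 2 by rewrite exprn_gt0.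
  by have := etar; lra.
rewrite E3 in tr0; have bb := sqr_ge0 b.
(* Otherwise (a + d) d would be at most 0, whereas a d > b^2 makes it positive. *)
rewrite leNgt; apply/negP => h.
have : (a + d) * d < 0 by rewrite pmulr_rlt0.
have := sqr_ge0 d; move: bb e20; rewrite mulrDl -expr2; lra.
Qed.

Let w v := u v - south.

Let sw : smooth_on setT w.
Proof.
apply/smooth_onP => k; apply: (CkD openT); first by have /smooth_onP := su.
exact: Ck_cst.
Qed.

Let dww v : differentiable w v. Proof. exact: smooth_on_diff sw I. Qed.

Let partial_w i v : partial i w v = partial i u v.
Proof. by rewrite (partialB i (du v) (differentiable_cst south v)) partial_cst subr0. Qed.

(* Minkowski's formulas in differential form: P, Q are the components of the
   one-form (s0 det(y, w, dy) - det(y, w, dw)) / 2, whose exterior derivative D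
   is computed in DE.  Since det(dU) is close to s0 ^ 2 on the tangent plane,
   D is almost nonnegative and controls how far dU is from r times the
   identity. *)
Let P v := (s0 * tri (sphm v) (w v) (partial 1 (@sphm R) v) - tri (sphm v) (w v) (partial 1 w v)) / 2.
Let Q v := (s0 * tri (sphm v) (w v) (partial 0 (@sphm R) v) - tri (sphm v) (w v) (partial 0 w v)) / 2.
Let D v := partial 0 P v - partial 1 Q v.

Let half_smooth (f g : 'rV[R]_2 -> R) : smooth_on setT f -> smooth_on setT g ->
  smooth_on setT (fun v => (s0 * f v - g v) / 2) /\
  forall i v, partial i (fun v => (s0 * f v - g v) / 2) v =
    (s0 * partial i f v - partial i g v) / 2.
Proof.
move=> sf sg.
have E : (fun v => (s0 * f v - g v) / 2) = (fun v => s0 / 2 * f v + (- 2^-1) * g v).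
  by apply/funext => v; field.
rewrite E; split.
  apply/smooth_onP => k; apply: (CkD openT); apply: (CkM openT); try exact: Ck_cst.
    exact: ((smooth_onP _ _).1 sf k).
  exact: ((smooth_onP _ _).1 sg k).
move=> i v; have df := smooth_on_diff sf (I : setT v); have dg := smooth_on_diff sg (I : setT v).
have dc (c : R) : differentiable (fun _ : 'rV[R]_2 => c) v by exact: differentiable_cst.
rewrite (partialD i (differentiableM (dc _) df) (differentiableM (dc _) dg)).
by rewrite (partialM i (dc _) df) (partialM i (dc _) dg) !partial_cst !mul0r !add0r; field.
Qed.

Let sp (f : 'rV[R]_2 -> 'rV[R]_3) i : smooth_on setT f ->
  smooth_on setT (fun v => tri (sphm v) (w v) (partial i f v)).
Proof.
by move=> sf; apply: (smooth_tri openT (@smooth_sphm R) sw); exact: smooth_on_partial.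
Qed.

Let sP : smooth_on setT P.
Proof. by have [] := half_smooth (sp 1 (@smooth_sphm R)) (sp 1 sw). Qed.
Let sQ : smooth_on setT Q.
Proof. by have [] := half_smooth (sp 0 (@smooth_sphm R)) (sp 0 sw). Qed.
Let sD : smooth_on setT D.
Proof.
have s1 := (smooth_onP _ _).1 (smooth_on_partial 0 sP).
have s2 := (smooth_onP _ _).1 (smooth_on_partial 1 sQ).
apply/smooth_onP => k.
apply: (@Ck_ext _ _ _ _ _ (fun v => partial 0 P v + (-1) * partial 1 Q v) _ openT).
  by move=> v _; rewrite mulN1r.
by apply: (CkD openT (s1 k)); apply: (CkM openT _ (s2 k)); exact: Ck_cst.
Qed.

Let young_v (f : 'rV[R]_2 -> 'rV[R]_3) v : smooth_on setT f ->
  partial 0 (partial 1 f) v = partial 1 (partial 0 f) v.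
Proof.
move=> sf; apply/matrixP => i j; rewrite ord1.
have sfj : smooth_on setT (fun v => f v 0 j) := (smooth_on_mxP f openT).1 sf 0 j.
have d1 := smooth_on_partial_diff 1 sf (I : setT v).
have d0 := smooth_on_partial_diff 0 sf (I : setT v).
have E k : (fun v => partial k f v 0 j) = partial k (fun v => f v 0 j).
  by apply/funext => x; exact: (partial_mxE k 0 j (smooth_on_diff sf (I : setT x))).
have E01 : partial 0 (partial 1 f) v 0 j = partial 0 (partial 1 (fun v => f v 0 j)) v.
  exact: etrans (partial_mxE 0 0 j d1) (congr1 (fun h => partial 0 h v) (E 1)).
have E10 : partial 1 (partial 0 f) v 0 j = partial 1 (partial 0 (fun v => f v 0 j)) v.
  exact: etrans (partial_mxE 1 0 j d0) (congr1 (fun h => partial 1 h v) (E 0)).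
apply: (etrans E01); apply: (etrans _ (esym E10)); apply: partial_partialC.
- by apply: filterE => x; exact: smooth_on_diff sfj I.
- exact: smooth_on_partial_diff sfj I.
- exact: smooth_on_partial_diff sfj I.
Qed.

Let DE v : D v = cos (v 0 1) *
  (s0 * (\tr (L (sphm v)) / 2) - s0 * height v - e2 (sphm v)
   + height v * (\tr (L (sphm v)) / 2)).
Proof.
have [a [b [d [E1 E2 E3 E4]]]] := frame v.
have [p0 p1] := partial_sphm v.
have ds i : differentiable (partial i (@sphm R)) v := smooth_on_partial_diff i (@smooth_sphm R) I.
have dsw i : differentiable (partial i w) v := smooth_on_partial_diff i sw I.
rewrite /D (half_smooth (sp 1 (@smooth_sphm R)) (sp 1 sw)).2.
rewrite (half_smooth (sp 0 (@smooth_sphm R)) (sp 0 sw)).2.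
rewrite (partial_tri 0 (dw v) (dww v) (ds 1)) (partial_tri 0 (dw v) (dww v) (dsw 1)).
rewrite (partial_tri 1 (dw v) (dww v) (ds 0)) (partial_tri 1 (dw v) (dww v) (dsw 0)).
rewrite (young_v v (@smooth_sphm R)) (young_v v sw) !partial_w E1 E2 p0 p1 E3 E4.
have hh : tri (w v) (eth v) (eph v) = height v by rewrite spherical_cross.
have h1 : tri (sphm v) (eth v) (eph v) = 1.
  by rewrite spherical_cross; have [[]] := spherical_frame v.
move: hh h1; rewrite -/(w v).
set h := height v; set k := cos (v 0 1).
(* [Z1] and [Z2] are the mixed second derivatives, which cancel by symmetry; the rest is linear
   algebra in the frame. *)
move: (partial 1 (partial 0 (@sphm R)) v) (partial 1 (partial 0 w) v) => Z1 Z2.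
move: (sphm v) (w v) (eth v) (eph v) => O W e f hh h1.
have scl (x y : R) (A B : 'rV[R]_3) j : (x *: A + y *: B) 0 j = x * A 0 j + y * B 0 j.
  by rewrite !mxE.
have scl1 (x : R) (A : 'rV[R]_3) j : (x *: A) 0 j = x * A 0 j by rewrite mxE.
transitivity (k * (s0 * ((a + d) * tri O e f - 2 * tri W e f)
    - (2 * (a * d - b ^+ 2) * tri O e f - (a + d) * tri W e f)) / 2).
  by rewrite /tri !scl1 !scl; field.
by rewrite hh h1; field.
Qed.

(** The width of the interval allowed for the determinant above s0^2. *)
Let N := 2 * eta.
Let N0 : 0 <= N. Proof. by rewrite /N mulr_ge0. Qed.

(** The first bound is the inequality of the arithmetic and geometric means, ((a + d) / 2)^2 >= a d
    - b^2. *)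
Let trace_ge v : [/\ s0 <= \tr (L (sphm v)) / 2, \tr (L (sphm v)) <= C,
  s0 ^+ 2 <= e2 (sphm v) & e2 (sphm v) <= s0 ^+ 2 + N].
Proof.
have [[_ _ h3] _] := spherical_frame v.
have [a [b [d [_ _ E3 E4]]]] := frame v.
have [_ _ /andP[t0 tC] /andP[e0 e1]] := hL h3.
have h : s0 ^+ 2 <= e2 (sphm v) by rewrite s02.
split=> //; last by move: e1; rewrite s02 /N; lra.
have [/andP[s00 _]] := s0r.
have s1 : 0 <= s0 by apply: le_trans s00; rewrite divr_ge0// ltW.
have t1 : 0 <= \tr (L (sphm v)) / 2 by rewrite divr_ge0// ltW.
rewrite -(ler_pXn2r (_ : 0 < 2)%N) ?nnegrE//; apply: (le_trans h).
rewrite E3 E4; have := sqr_ge0 (a - d); have := sqr_ge0 b.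
have -> : ((a + d) / 2) ^+ 2 = a * d + (a - d) ^+ 2 / 4 by field.
lra.
Qed.

Let s0_gt0 : 0 < s0.
Proof. by have /andP[h _] := s0r; apply: lt_le_trans h; rewrite divr_gt0. Qed.

(** With t the half trace and h the height, the factor of the cosine in [DE] is (s0 t - e2) + h (t -
    s0). The second term is nonnegative and the first at least s0^2 - e2 >= - N. *)
Let D_ge (v : 'rV[R]_2) : - (@pi R / 2) <= v 0 1 <= @pi R / 2 ->
  cos (v 0 1) * (s0 * (\tr (L (sphm v)) / 2) - e2 (sphm v)) <= D v /\ - N <= D v.
Proof.
move=> hv; have [t0 _ _ e1] := trace_ge v; have h0 := height_ge0 hv.
have c0 : 0 <= cos (v 0 1) by apply: cos_ge0_pihalf.
have c1 := cos_le1 (v 0 1).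
rewrite DE; move: t0 e1 h0 c0 c1 s0_gt0 N0.
set t := \tr (L (sphm v)) / 2; set e := e2 (sphm v); set h := height v.
set c := cos (v 0 1) => t0 e1 h0 c0 c1 s1 NN.
have Hh : 0 <= h * (t - s0) by rewrite mulr_ge0// subr_ge0.
have hE : - N <= s0 * t - e.
  have : s0 * s0 <= s0 * t by rewrite ler_wpM2l// ltW.
  by rewrite -expr2; lra.
have S1 : c * (s0 * t - e) <= c * (s0 * t - s0 * h - e + h * t).
  by apply: ler_wpM2l => //; move: Hh; rewrite mulrBr (mulrC h s0); lra.
split=> //; apply: le_trans S1.
have : c * (- N) <= c * (s0 * t - e) by exact: ler_wpM2l.
have : c * N <= 1 * N by exact: ler_wpM2r.
by rewrite mul1r mulrN; lra.
Qed.

Let Y v := u v - r *: sphm v.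

Let sY : smooth_on setT Y.
Proof.
apply/smooth_onP => k.
apply: (@Ck_ext _ _ _ _ _ (fun v => u v + (- r) *: sphm v) _ openT).
  by move=> v _; rewrite scaleNr.
apply: (CkD openT); first by have /smooth_onP := su.
apply: (Ck_scalemx openT); first exact: Ck_cst.
by have /smooth_onP := @smooth_sphm R.
Qed.

Let partial_Y i v : partial i Y v = partial i u v - r *: partial i (@sphm R) v.
Proof.
have [dz E] := partial_scale i (differentiable_cst r v) (dw v).
by rewrite (partialB i (du v) dz) E partial_cst scale0r add0r.
Qed.

Let K := 8 * C / r + 1.

(** Along parallels the speed is bounded by [D], whose integral is small on some of them; along
    meridians only a uniform bound is kept. *)
Let Y_bound (v : 'rV[R]_2) : - (@pi R / 2) <= v 0 1 <= @pi R / 2 -> 1 / 2 <= cos (v 0 1) ->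
  forall e, dot e e = 1 ->
  dot (partial 0 Y v) e ^+ 2 <= K * (D v + 2 * N) /\ dot (partial 1 Y v) e ^+ 2 <= (C + 2 * r) ^+ 2.
Proof.
move=> hv hc e ee; have [t0 tC e0 e1] := trace_ge v.
have [[h1 h2 h3] [h4 h5 h6]] := spherical_frame v.
have [a [b [d [E1 E2 E3 E4]]]] := frame v.
have [p0 p1] := partial_sphm v.
have [D1 D2] := D_ge hv.
have c1 := cos_le1 (v 0 1).
have F0 : partial 0 Y v = cos (v 0 1) *: ((a - r) *: eth v + b *: eph v).
  by rewrite partial_Y E1 p0 scalerA mulrC -scalerA -scalerBr scalerBl addrAC.
have F1 : partial 1 Y v = b *: eth v + (d - r) *: eph v.
  by rewrite partial_Y E2 p1 scalerBl addrA.
have A0 : dot (partial 0 Y v) e ^+ 2 <= (a - r) ^+ 2 + 2 * b ^+ 2 + (d - r) ^+ 2.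
  apply: le_trans (cauchy_schwarz _ _) _; rewrite ee mulr1 F0 dotZl dotZr.
  rewrite dotDl !dotDr !dotZl !dotZr h1 h2 h4 (dotC (eph v)) h4.
  rewrite !(mulr0, mulr1, addr0, add0r) mulrA -!expr2.
  have : cos (v 0 1) ^+ 2 <= 1 by rewrite expr_le1//; lra.
  move=> c2; have : cos (v 0 1) ^+ 2 * ((a - r) ^+ 2 + b ^+ 2) <= 1 * ((a - r) ^+ 2 + b ^+ 2).
    by apply: ler_wpM2r => //; rewrite addr_ge0 ?sqr_ge0.
  by rewrite mul1r; have := sqr_ge0 b; have := sqr_ge0 (d - r); lra.
have A1 : dot (partial 1 Y v) e ^+ 2 <= (a - r) ^+ 2 + 2 * b ^+ 2 + (d - r) ^+ 2.
  apply: le_trans (cauchy_schwarz _ _) _; rewrite ee mulr1 F1.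
  rewrite dotDl !dotDr !dotZl !dotZr h1 h2 h4 (dotC (eph v)) h4.
  rewrite !(mulr0, mulr1, addr0, add0r) -!expr2.
  by have := sqr_ge0 b; have := sqr_ge0 (a - r); lra.
have AE : (a - r) ^+ 2 + 2 * b ^+ 2 + (d - r) ^+ 2 =
    \tr (L (sphm v)) ^+ 2 - 2 * e2 (sphm v) - 2 * r * \tr (L (sphm v)) + 2 * r ^+ 2.
  by rewrite E3 E4; ring.
move: A0 A1; rewrite AE => A0 A1.
have /andP[rs sr] := s0r.
have [X Z] := speed_arith r0 s0_gt0 rs sr eta0 s02 t0 tC e0 e1 D1 D2 c1 hc.
by split; [exact: (le_trans A0 X)|exact: (le_trans A1 Z)].
Qed.

Let sphm_periodic (y : R) : sphm (pt (pi *+ 2) y) = sphm (pt 0 y) /\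
  eph (pt (pi *+ 2) y) = eph (pt 0 y).
Proof.
have c : cos (pi *+ 2 : R) = cos 0 by rewrite cos2pi cos0.
have s : sin (pi *+ 2 : R) = sin 0 by rewrite sin2pi sin0.
by rewrite /sphm /eph !pt0 !pt1 c s.
Qed.

Let Q_pole x y : cos y = 0 -> Q (pt x y) = 0.
Proof.
move=> c; have [p0 _] := partial_sphm (pt x y).
rewrite /Q partial_w partial_u p0 pt1 c scale0r mul0mx /tri !mxE.
by rewrite !(mulr0, mul0r, subr0, addr0).
Qed.

(* The equator is joined to a parallel on which the integral of D is small by
   two short meridian arcs. *)
Lemma sphere_map_step (e : 'rV[R]_3) (tau lam : R) : dot e e = 1 ->
  0 < tau <= pi / 2 -> (forall y : R, 0 <= y <= tau -> 1 / 2 <= cos y) -> 0 < lam ->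
  dot (U (r3 0 1 0) - r *: r3 0 1 0 - (U (r3 1 0 0) - r *: r3 1 0 0)) e <=
    2 * (C + 2 * r) * tau + lam / 2 * (pi *+ 2)
    + (8 * C / r + 1) / (2 * lam) *
      (2 * (pi / 2) * (2 * eta) * (pi *+ 2) / tau + 3 * (2 * eta) * (pi *+ 2)).
Proof.
move=> ee /andP[tau0 taupi] hcos lam0; set p := r3 1 0 0; set q := r3 0 1 0.
have pp := pi_gt0 R; have T0 : 0 < (pi *+ 2 : R) by rewrite mulr2n; lra.
have hp : 0 < (pi / 2 : R) by lra.
have [||||| y /andP[y0 yt] Iy] := @green_mvt R P Q D (pi *+ 2) (pi / 2) N tau sP sQ sD
  (fun v => erefl) T0 hp N0.
- by rewrite tau0.
- move=> y; have [E1 E2] := sphm_periodic y.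
  by rewrite /P !partial_w !partial_u !(partial_sphm _).2 /w /u E1 E2.
- by move=> x; apply: Q_pole; exact: cos_pihalf.
- by move=> x; apply: Q_pole; rewrite cosN cos_pihalf.
- by move=> x y hy; have [] := @D_ge (pt x y); rewrite ?pt1.
have yh : - (pi / 2) <= y <= (pi / 2 : R) by apply/andP; split; lra.
have cy : 1 / 2 <= cos y by apply: hcos; rewrite !ltW.
have [d0 d1] := is_derive_dot e sY.
have K0 : 0 <= K by rewrite /K addr_ge0// divr_ge0 ?ltW// mulr_gt0.
have M0 : 0 <= C + 2 * r by have := C0; have := r0; lra.
have xin : 0 <= (@pi R / 2) <= @pi R *+ 2.
  by apply/andP; split; rewrite ?(mulr2n pi); lra.
have cD : continuous (fun x => D (pt x y)) by exact: continuous_pt0.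
have DN (t : R) : - N <= D (pt t y) by have [] := @D_ge (pt t y); rewrite ?pt1.
have g2 (t : R) : dot (partial 0 Y (pt t y)) e ^+ 2 <= K * (D (pt t y) + 2 * N).
  by have [] := @Y_bound (pt t y) _ _ e ee; rewrite ?pt1.
have step := @circle_step R (fun x => D (pt x y)) (fun x => dot (Y (pt x y)) e)
    (fun x => dot (partial 0 Y (pt x y)) e) (pi *+ 2) K N lam (pi / 2) T0 lam0 K0 N0
    xin cD DN (d0^~ y) g2.
have mer (x : R) : `|dot (Y (pt x y)) e - dot (Y (pt x 0)) e| <= (C + 2 * r) * tau.
  apply: (@le_trans _ _ ((C + 2 * r) * (y - 0))); last first.
    by rewrite subr0 ler_wpM2l// ltW.
  apply: (@derive_lipschitz R (fun t => dot (Y (pt x t)) e) (fun t => dot (partial 1 Y (pt x t)) e)).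
    exact: ltW.
  move=> t /andP[t0 ty].
  rewrite -(ler_pXn2r (_ : 0 < 2)%N) ?nnegrE// -normrX ger0_norm ?sqr_ge0//.
  have [||_ ->//] := @Y_bound (pt x t) _ _ e ee; rewrite pt1.
    by apply/andP; split; lra.
  by apply: hcos; rewrite t0 /=; lra.
have Ep : sphm (pt 0 0) = p.
  by rewrite /sphm !pt0 !pt1 cos0 sin0 mulr1 mulr0.
have Eq : sphm (pt (pi / 2) 0) = q.
  by rewrite /sphm !pt0 !pt1 cos0 sin0 cos_pihalf sin_pihalf mulr1 mulr0.
rewrite dotBl; have := mer 0; have := mer (pi / 2).
rewrite /(Y (pt 0 0)) /(Y (pt (pi / 2) 0)) /u Ep Eq.
rewrite !ler_norml => /andP[m1 m2] /andP[m3 m4].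
have Kl : 0 <= K / (2 * lam) by rewrite divr_ge0// mulr_ge0// ltW.
have : K / (2 * lam) * (segint 0 (pi *+ 2) (fun x => D (pt x y)) + 3 * N * (pi *+ 2)) <=
   K / (2 * lam) * (2 * (pi / 2) * N * (pi *+ 2) / tau + 3 * N * (pi *+ 2)).
  by rewrite ler_wpM2l// lerD2r.
move: step m1 m2 m3 m4; rewrite -/K -/N; lra.
Qed.
End SphereMap.

(** * Uniform closeness of an almost round map to a translate of r id *)

Lemma cos_ge_sub (R : realType) (y : R) : 0 <= y -> 1 - y <= cos y.
Proof.
move=> y0.
have := @derive_lipschitz R cos (fun t => - sin t) 0 y 1 y0.
have H1 : forall x, 0 <= x <= y -> is_derive x (1 : R) cos (- sin x).
  by move=> x _; exact: is_derive_cos.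
have H2 : forall x : R, 0 <= x <= y -> `|- sin x| <= 1.
  by move=> x _; rewrite normrN ler_norml sin_geN1 sin_le1.
by move=> /(_ H1 H2); rewrite cos0 subr0 mul1r ler_norml => /andP[+ _]; lra.
Qed.

Lemma unit_orthogonal_pair (R : realType) (p q : 'rV[R]_3) :
  exists m : 'rV[R]_3, [/\ dot m m = 1, dot p m = 0 & dot q m = 0].
Proof.
pose B : 'M[R]_(3, 1 + 1) := row_mx p^T q^T; pose v := nz_row (kermx B).
have v0 : v != 0.
  rewrite /v nz_row_eq0 -mxrank_eq0 mxrank_ker subn_eq0 -ltnNge.
  exact: leq_ltn_trans (rank_leq_col B) _.
have vB : v *m B = 0 by apply/sub_kermxP; exact: nz_row_sub.
move: vB; rewrite mul_mx_row => /eqP; rewrite row_mx_eq0 => /andP[/eqP vp /eqP vq].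
have vv : 0 < dot v v by rewrite dot_gt0.
exists ((Num.sqrt (dot v v))^-1 *: v); split.
- rewrite dotZl dotZr mulrA -expr2 exprVn sqr_sqrtr ?(ltW vv)// mulVf// gt_eqF//.
- by rewrite dotZr (_ : dot p v = 0) ?mulr0 // dotC /dot vp mxE.
- by rewrite dotZr (_ : dot q v = 0) ?mulr0 // dotC /dot vq mxE.
Qed.

(* U is the parametrization of a closed convex surface by its unit normal,
   extended by homogeneity of degree 0.  As y L = 0, the last expression is the
   product of the two principal radii of curvature. *)
Definition almost_round (R : realType) (r C eta : R) (U : 'rV[R]_3 -> 'rV[R]_3) : Prop :=
  smooth_on [set z : 'rV[R]_3 | z != 0] U /\
  forall y, dot y y = 1 -> let L := jacobian U y in
    [/\ L^T = L, y *m L = 0, 0 < \tr L <= C &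
      r ^+ 2 - eta <= (\tr L ^+ 2 - \tr (L *m L)) / 2 <= r ^+ 2 + eta].

Lemma almost_round_step (R : realType) (r C delta : R) : 0 < r -> 0 < C -> 0 < delta ->
  exists2 eta, 0 < eta & forall U e, almost_round r C eta U -> dot e e = 1 ->
  dot (U (r3 0 1 0) - r *: r3 0 1 0 - (U (r3 1 0 0) - r *: r3 1 0 0)) e <= delta.
Proof.
move=> r0 C0 d0; have pp := pi_gt0 R.
have M0 : 0 < C + 2 * r by lra.
(* [tau] and [lam] make the meridian and the [lam] term at most delta / 4 each, before [eta] is
   chosen; 1/2 keeps the cosine at least 1/2. *)
pose tau := Num.min (1 / 2) (delta / (8 * (C + 2 * r))).
pose lam := delta / (4 * pi).
pose A := (8 * C / r + 1) / (2 * lam).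
pose B := 2 * (pi / 2) * 2 * (pi *+ 2) / tau + 3 * 2 * (pi *+ 2).
have tau0 : 0 < tau by rewrite lt_min divr_gt0 //= divr_gt0// mulr_gt0.
have lam0 : 0 < lam by rewrite divr_gt0// mulr_gt0.
have A0 : 0 < A.
  have h1 : 0 < 8 * C / r by rewrite divr_gt0// mulr_gt0.
  have h2 : 0 < 2 * lam by rewrite mulr_gt0.
  by rewrite divr_gt0// addr_gt0.
have T0 : 0 < @pi R *+ 2 by rewrite (mulr2n pi); lra.
have B0 : 0 < B.
  have h1 : 0 < 2 * (pi / 2) * 2 * (@pi R *+ 2) by rewrite !mulr_gt0// divr_gt0.
  have h2 : 0 < 3 * 2 * (@pi R *+ 2) by rewrite mulr_gt0// mulr_gt0.
  by rewrite addr_gt0// divr_gt0.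
(* The remaining term is A B eta, also at most delta / 4. *)
pose eta := Num.min (3 / 4 * r ^+ 2) (delta / (4 * (A * B))).
have eta0 : 0 < eta.
  have h1 : 0 < 4 * (A * B) by rewrite mulr_gt0// mulr_gt0.
  have h2 : 0 < 3 / 4 * r ^+ 2 by apply: mulr_gt0; [lra|exact: exprn_gt0].
  by rewrite lt_min h2 divr_gt0.
have etar : eta <= 3 / 4 * r ^+ 2 by rewrite ge_min lexx.
have etaB : A * B * eta <= delta / 4.
  apply: (@le_trans _ _ (A * B * (delta / (4 * (A * B))))).
    by apply: ler_wpM2l; [rewrite mulr_ge0// ltW|rewrite /eta ge_min lexx orbT].
  by rewrite le_eqVlt; apply/orP; left; apply/eqP; field; rewrite !gt_eqF.
have tauM : (C + 2 * r) * tau <= delta / 8.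
  apply: (@le_trans _ _ ((C + 2 * r) * (delta / (8 * (C + 2 * r))))).
    by apply: ler_wpM2l; [exact: ltW|rewrite /tau ge_min lexx orbT].
  by rewrite le_eqVlt; apply/orP; left; apply/eqP; field; rewrite gt_eqF.
exists eta => // U e [sU hL] ee.
apply: (le_trans (@sphere_map_step R U r C eta r0 C0 (ltW eta0) etar sU hL e tau lam ee _ _ lam0)).
- rewrite tau0 /=; apply: (@le_trans _ _ (1 / 2)); first by rewrite ge_min lexx.
  by have := pi_ge2 R; lra.
- move=> y /andP[y0 yt]; have := cos_ge_sub y0.
  have : tau <= 1 / 2 by rewrite ge_min lexx.
  by move: yt; lra.
have E1 : lam / 2 * (pi *+ 2) = delta / 4.
  rewrite /lam; move: (@pi R) pp => z z0; rewrite (mulr2n z).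
  by field; rewrite gt_eqF.
have E2 : A * (2 * (pi / 2) * (2 * eta) * (pi *+ 2) / tau + 3 * (2 * eta) * (pi *+ 2))
   = A * B * eta by rewrite /B; field; rewrite gt_eqF.
rewrite E1 -/A E2; move: etaB tauM; rewrite -(mulrA 2); lra.
Qed.

(** Conjugation by an orthogonal matrix preserves symmetry, kernel and traces. It carries the
    estimate from one pair of coordinate vectors to all orthonormal pairs. *)
Lemma almost_round_rotate (R : realType) (r C eta : R) (U : 'rV[R]_3 -> 'rV[R]_3) (O : 'M[R]_3) :
  O *m O^T = 1%:M -> almost_round r C eta U ->
  almost_round r C eta (fun z => U (z *m O) *m O^T).
Proof.
move=> OO [sU hL].
have OO' : O^T *m O = 1%:M by exact: mulmx1C.
have zO (z : 'rV[R]_3) : z != 0 -> z *m O != 0.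
  by apply: contra => /eqP h; rewrite -[z]mulmx1 -OO mulmxA h mul0mx.
have opZ := @open_neq0 R 3.
have lin (m n : nat) (A : 'M[R]_(m, n)) : smooth_on setT (fun z : 'rV[R]_m => z *m A).
  apply/smooth_onP => k; apply: (Ck_mulmx openT); [|exact: Ck_cst].
  by have /smooth_onP := @smooth_on_id R m setT openT.
have linJ (m n : nat) (A : 'M[R]_(m, n)) (z : 'rV[R]_m) : jacobian (fun z : 'rV[R]_m => z *m A) z = A.
  apply/row_matrixP => i; rewrite row_jacobian; last exact: smooth_on_diff (lin _ _ A) I.
  by rewrite (partial_mulmxr A i ex_diff) partial_id rowE.
have sUO : smooth_on [set z : 'rV[R]_3 | z != 0] (fun z => U (z *m O)).
  by apply: (smooth_on_comp opZ opZ zO sU); exact: smooth_onW (lin _ _ O).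
split; first exact: (smooth_on_comp opZ openT (fun _ _ => I) (lin _ _ O^T) sUO).
move=> y yy /=.
have y0 := dot1_neq0 yy.
have yO : dot (y *m O) (y *m O) = 1 by rewrite dot_mulmxl -mulmxA OO mulmx1.
have [h1 h2 h3 h4] := hL _ yO.
have dO : differentiable (fun z : 'rV[R]_3 => z *m O) y := smooth_on_diff (lin _ _ O) I.
have dU : differentiable U (y *m O) := smooth_on_diff sU (zO _ y0).
have dUO : differentiable (fun z => U (z *m O)) y := smooth_on_diff sUO y0.
have -> : jacobian (fun z => U (z *m O) *m O^T) y = O *m jacobian U (y *m O) *m O^T.
  rewrite (jacobian_comp dUO (smooth_on_diff (lin _ _ O^T) I)) linJ.
  by rewrite (jacobian_comp dO dU) linJ.
have tr1 (A : 'M[R]_3) : \tr (O *m A *m O^T) = \tr A.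
  by rewrite mxtrace_mulC mulmxA OO' mul1mx.
have sq (A : 'M[R]_3) : (O *m A *m O^T) *m (O *m A *m O^T) = O *m (A *m A) *m O^T.
  by rewrite !mulmxA -(mulmxA _ O^T O) OO' mulmx1.
rewrite sq !tr1; split=> //.
  by rewrite !trmx_mul trmxK h1 mulmxA.
by rewrite !mulmxA h2 mul0mx.
Qed.

(** Arbitrary [p] and [q] are compared through a unit vector orthogonal to both, at the cost of two
    steps of delta / 2. *)
Lemma almost_round_rigid (R : realType) (r C delta : R) : 0 < r -> 0 < C -> 0 < delta ->
  exists2 eta, 0 < eta & forall U p q e, almost_round r C eta U ->
  dot p p = 1 -> dot q q = 1 -> dot e e = 1 ->
  dot (U q - r *: q - (U p - r *: p)) e <= delta.
Proof.
move=> r0 C0 d0; have d20 : 0 < delta / 2 by rewrite divr_gt0.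
have [eta eta0 step] := almost_round_step r0 C0 d20.
exists eta => // U p q e hU pp qq ee.
have ortho (x y : 'rV[R]_3) : dot x x = 1 -> dot y y = 1 -> dot x y = 0 ->
    dot (U y - r *: y - (U x - r *: x)) e <= delta / 2.
  move=> xx yy xy; have [z [zz xz yz]] := unit_orthogonal_pair x y.
  pose O : 'M[R]_3 := \matrix_i (if i == o0 then x else if i == o1 then y else z).
  have rO i : row i O = if i == o0 then x else if i == o1 then y else z by rewrite rowK.
  have OO : O *m O^T = 1%:M.
    apply/matrixP => i j.
    have -> : (O *m O^T) i j = dot (row i O) (row j O).
      by rewrite dotE mxE; apply: eq_bigr => l _; rewrite [(O^T) _ _]mxE [row i O _ _]mxE [row j O _ _]mxE.
    rewrite !rO [RHS]mxE.
    have yx := etrans (dotC y x) xy; have zx := etrans (dotC z x) xz.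
    have zy := etrans (dotC z y) yz.
    by case: (ord3P i) => ->; case: (ord3P j) => ->;
      rewrite ?eqxx /= ?xx ?yy ?zz ?xy ?xz ?yz ?yx ?zx ?zy.
  have eO : dot (e *m O^T) (e *m O^T) = 1.
    by rewrite dot_mulmxl trmxK -mulmxA (mulmx1C OO) mulmx1.
  have E0 : r3 1 0 0 *m O = x.
    apply/matrixP => i j; rewrite ord1 mxE sum3 !r3E mul1r !mul0r !addr0.
    by have <- : row o0 O 0 j = O o0 j; [rewrite [LHS]mxE|rewrite rO].
  have E1 : r3 0 1 0 *m O = y.
    apply/matrixP => i j; rewrite ord1 mxE sum3 !r3E mul1r !mul0r !addr0 add0r.
    by have <- : row o1 O 0 j = O o1 j; [rewrite [LHS]mxE|rewrite rO].
  have := step _ (e *m O^T) (almost_round_rotate OO hU) eO.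
  rewrite /= E0 E1.
  have F (a b c d : 'rV[R]_3) : a *m O = b -> c *m O = d ->
      U b *m O^T - r *: a - (U d *m O^T - r *: c) = (U b - r *: b - (U d - r *: d)) *m O^T.
    move=> <- <-; rewrite !mulmxBl -!scalemxAl -!mulmxA OO !mulmx1 //.
  by rewrite (F _ _ _ _ E1 E0) dot_mulmxl trmxK -mulmxA (mulmx1C OO) mulmx1.
have [m [mm pm qm]] := unit_orthogonal_pair p q.
have s1 := ortho p m pp mm pm.
have s2 : dot (U q - r *: q - (U m - r *: m)) e <= delta / 2 by apply: ortho; rewrite // dotC.
move: s1 s2; rewrite !dotBl; lra.
Qed.

(** * Dimension at least three *)

Lemma sup_norm_ge (R : realType) (n : nat) (M : manifold R n) (g : riem_metric M)
    (T : atlas M -> 'rV[R]_n -> 'M[R]_n) (c : R) (a : atlas M) (p : 'rV[R]_n) :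
  chart_img (chart_of a) p -> (sup_norm g T <= c%:E)%E -> form_norm (g a p) (T a p) <= c.
Proof.
move=> ap Tc; rewrite -lee_fin; apply: le_trans Tc.
by apply: ereal_sup_ubound; exists a, p.
Qed.

Lemma coord_le_form_norm (R : realType) (n : nat) (d : 'rV[R]_n) (c : R) :
  Num.sqrt (\sum_i d 0 i ^+ 2) <= c -> forall i, `|d 0 i| <= c.
Proof.
move=> dc i; apply: le_trans dc; rewrite -sqrtr_sqr ler_wsqrtr//.
by rewrite (bigD1 i)//= lerDl; apply: sumr_ge0 => j _; exact: sqr_ge0.
Qed.

Section Curvatures.
Context (R : realType) (n : nat) (M : manifold R n.+1) (g : riem_metric M)
  (X nu : M -> 'rV[R]_n.+2) (k b e : R).
Hypotheses (hX : isometric_immersion g X) (hnu : unit_normal X nu).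
Hypotheses (hb : sup_norm g (second_form X nu) = b%:E) (he : (einstein_defect g k <= e%:E)%E).

Lemma principal_curvatures (a : atlas M) (p : 'rV[R]_n.+1) : chart_img (chart_of a) p ->
  exists (P : 'M[R]_n.+1) (x : 'rV[R]_n.+1),
  [/\ P *m g a p *m P^T = 1%:M, P *m second_form X nu a p *m P^T = diag_mx x,
      (forall i, `|x 0 i| <= b) &
      (forall i, `|(\sum_j x 0 j) * x 0 i - x 0 i ^+ 2 - k| <= e)].
Proof.
move=> ap; have sB := second_form_sym hX hnu ap.
have [P [x [PG PB]]] := simultaneous_diag (gram_sym g ap) sB (gram_posdef g ap).
have [iG nB] := form_norm_diag PG PB.
exists P, x; split=> //.
  by apply: coord_le_form_norm; rewrite -nB; apply: (sup_norm_ge ap); rewrite hb.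
pose d := \row_i ((\sum_j x 0 j) * x 0 i - x 0 i ^+ 2 - k).
have trB : \tr (second_form X nu a p *m invmx (g a p)) = \sum_j x 0 j.
  by rewrite iG mulmxA mxtrace_mulC mulmxA PB mxtrace_diag.
have PR : P *m (ricci (g a) p - k *: g a p) *m P^T = diag_mx d.
  have step (H : R) (B G : 'M[R]_n.+1) :
      P *m (H *: B - B *m (P^T *m P) *m B - k *: G) *m P^T =
      H *: (P *m B *m P^T) - P *m B *m P^T *m (P *m B *m P^T) - k *: (P *m G *m P^T).
    by rewrite !mulmxBr !mulmxBl -!scalemxAr -!scalemxAl !mulmxA.
  rewrite (ricci_second_form hX hnu ap) trB iG step PG PB.
  rewrite mulmx_diag; apply/matrixP => i j; rewrite !mxE.
  by case: eqP => _; rewrite ?mulr1n ?mulr0n ?mulr1 ?mulr0 ?subr0// expr2.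
have [_ nR] := form_norm_diag PG PR.
move=> i; have -> : (\sum_j x 0 j) * x 0 i - x 0 i ^+ 2 - k = d 0 i by rewrite mxE.
by apply: coord_le_form_norm; rewrite -nR; exact: (sup_norm_ge ap he).
Qed.

(** [w] is the coordinate vector of [u] in the principal frame; the second formula is the third
    fundamental form, the square of the shape operator. *)
Lemma principal_frame (a : atlas M) (p u : 'rV[R]_n.+1) (P : 'M[R]_n.+1) (x : 'rV[R]_n.+1) :
  chart_img (chart_of a) p ->
  P *m g a p *m P^T = 1%:M -> P *m second_form X nu a p *m P^T = diag_mx x ->
  exists w : 'rV[R]_n.+1,
    dot (u *m g a p) u = \sum_i w 0 i ^+ 2 /\
    dot (u *m diff_mx nu a p) (u *m diff_mx nu a p) = \sum_i w 0 i ^+ 2 * x 0 i ^+ 2.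
Proof.
move=> ap PG PB; have [iG _] := form_norm_diag PG PB.
have sG : (g a p)^T = g a p := gram_sym g ap.
have uG := gram_unit hX hnu ap.
pose w := u *m g a p *m P^T; exists w.
have uw : u = w *m P by rewrite /w -mulmxA -iG -mulmxA mulmxV ?mulmx1.
have E (A : 'M[R]_n.+1) : dot (u *m A) u = dot (w *m (P *m A *m P^T)) w.
  by rewrite uw !mulmxA [RHS]dot_mulmxl trmxK.
split.
  by rewrite E PG mulmx1 dotE; apply: eq_bigr => i _; rewrite expr2.
have -> : dot (u *m diff_mx nu a p) (u *m diff_mx nu a p) =
    dot (u *m (diff_mx nu a p *m (diff_mx nu a p)^T)) u.
  by rewrite mulmxA [RHS]dot_mulmxl trmxK.
have step (B : 'M[R]_n.+1) : P *m (B *m (P^T *m P) *m B) *m P^T =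
    P *m B *m P^T *m (P *m B *m P^T) by rewrite !mulmxA.
rewrite E (third_form hX hnu ap) iG step PB mulmx_diag.
rewrite dotE; apply: eq_bigr => i _; rewrite mul_mx_diag !mxE; ring.
Qed.
End Curvatures.

(** A kernel vector of unit length would give |0 - 1| <= theta. *)
Lemma almost_isometry_row_free (R : realType) (n m : nat) (M : manifold R n) (g : riem_metric M)
    (theta : R) (F : M -> 'rV[R]_m) : theta < 1 -> almost_isometry g theta F ->
  forall a p, chart_img (chart_of a) p -> row_free (diff_mx F a p).
Proof.
move=> t1 hF a p ap; apply/negPn/negP => nf.
have [v v0 vJ] : exists2 v : 'rV[R]_n, v != 0 & v *m diff_mx F a p = 0.
  exists (nz_row (kermx (diff_mx F a p))).
    by rewrite nz_row_eq0 kermx_eq0.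
  by apply/sub_kermxP; exact: nz_row_sub.
have vv := gram_posdef g ap v0; set q := dot _ _ in vv.
have := hF a p ((Num.sqrt q)^-1 *: v) ap; rewrite -!scalemxAl vJ scaler0 dot0l.
rewrite dotZl dotZr -/q mulrA -expr2 exprVn sqr_sqrtr ?(ltW vv)// mulVf ?gt_eqF//.
move=> /(_ erefl); rewrite sub0r normrN normr1 leNgt => /negP; exact.
Qed.

Lemma smooth_map_scale (R : realType) (n m : nat) (M : manifold R n) (c : R) (F : M -> 'rV[R]_m) :
  smooth_map F -> smooth_map (fun x => c *: F x) /\
  forall a p, chart_img (chart_of a) p ->
    diff_mx (fun x => c *: F x) a p = c *: diff_mx F a p.
Proof.
move=> sF; split=> [a|a p ap].
  apply/smooth_onP => k; have /smooth_onP/(_ k) sFa := sF a.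
  have oa := open_chart_img (chart_of a).
  by apply: (Ck_ext oa _ (Ck_scalemx oa (Ck_cst k _ c) sFa)).
have dF : differentiable (local_expr F a) p := smooth_on_diff (sF a) ap.
exact: jacobian_scale.
Qed.

(** The dimension is [n.+1], so 1 < n means at least three principal curvatures. *)
Lemma pinched_hypersurface (R : realType) (n : nat) (k b theta : R) : (1 < n)%N ->
  0 < k -> 0 < theta -> theta < 1 ->
  exists2 e : R, 0 < e &
  forall (M : manifold R n.+1) (g : riem_metric M) (X nu : M -> 'rV[R]_n.+2),
    closed_hypersurface g X nu -> sup_norm g (second_form X nu) = b%:E ->
    (einstein_defect g k <= e%:E)%E ->
    exists2 F : M -> 'rV[R]_n.+2,
      diffeo_onto (@sphere R n.+1 (Num.sqrt ((n.+1%:R - 1) / k))) F & almost_isometry g theta F.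
Proof.
move=> n1 k0 t0 t1; set r := Num.sqrt _.
have nE : n.+1%:R - 1 = n%:R :> R by rewrite -natr1 addrK.
have nz : (0 : R) < n%:R by rewrite ltr0n ltnW.
have n0 : 0 < (n.+1%:R - 1) / k by rewrite nE divr_gt0.
have r0 : 0 < r by rewrite sqrtr_gt0.
have r2 : r ^+ 2 = (n.+1%:R - 1) / k by rewrite sqr_sqrtr// ltW.
pose c := 1 + 4 * (n.+1%:R * b) ^+ 2 / k.
have c0 : 0 < c by rewrite ltr_pwDl// divr_ge0 ?(ltW k0)// mulr_ge0// sqr_ge0.
(* k / 2 is the threshold of [pinched_curvatures]; the other bound turns its error c e, scaled by
   r^2, into at most [theta]. *)
pose e := Num.min (k / 2) (theta / (r ^+ 2 * c)).
have e0 : 0 < e by rewrite lt_min divr_gt0//= divr_gt0// mulr_gt0// exprn_gt0.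
exists e => // M g X nu [cM [kM M0] _ hX hnu] hb he.
have [sn nu1 _] := hnu.
have [sF dF] := smooth_map_scale r sn.
have iso : almost_isometry g theta (fun x => r *: nu x).
  move=> a p u ap uu; rewrite dF// -scalemxAr dotZl dotZr.
  have [P [x [PG PB xb xe]]] := principal_curvatures hX hnu hb he ap.
  have [w [w1 ->]] := principal_frame hX hnu u ap PG PB.
  have b0 : 0 <= b := le_trans (normr_ge0 _) (xb ord0).
  have ek : e <= k / 2 by rewrite /e ge_min lexx.
  have pin := @pinched_curvatures R n.+1 k b e (x 0) n1 k0 b0 ek xb xe.
  rewrite -uu w1 !mulr_sumr -sumrB.
  apply: (le_trans (ler_norm_sum _ _ _)).
  rewrite -[leRHS]mulr1 -uu w1 mulr_sumr; apply: ler_sum => i _.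
  have -> : r * (r * (w 0 i ^+ 2 * x 0 i ^+ 2)) - w 0 i ^+ 2 =
      w 0 i ^+ 2 * (r ^+ 2 * (x 0 i ^+ 2 - k / (n.+1%:R - 1))).
    rewrite mulrBr (_ : r ^+ 2 * (k / _) = 1); first by ring.
    by rewrite r2 !nE; field; rewrite !gt_eqF.
  rewrite normrM ger0_norm ?sqr_ge0// mulrC ler_wpM2r ?sqr_ge0//.
  rewrite normrM ger0_norm ?sqr_ge0//.
  apply: (@le_trans _ _ (r ^+ 2 * (c * e))).
    by rewrite ler_wpM2l ?sqr_ge0//; exact: pin.
  rewrite mulrA -ler_pdivlMl ?mulr_gt0 ?exprn_gt0// mulrC.
  by rewrite /e ge_min lexx orbT.
exists (fun x => r *: nu x) => //.
apply: sphere_immersion_diffeo => //.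
- exact: leqW.
- by move=> x; rewrite dotZl dotZr nu1 mulr1 expr2.
- by move=> a p; exact: almost_isometry_row_free t1 iso a p.
Qed.

Lemma curve_not_almost_einstein (R : realType) (k b : R) (M : manifold R 1) (g : riem_metric M)
    (X nu : M -> 'rV[R]_2) : 0 < k ->
  closed_hypersurface g X nu -> sup_norm g (second_form X nu) = b%:E ->
  ~ (einstein_defect g k <= (k / 2)%:E)%E.
Proof.
move=> k0 [_ [_ [x _]] _ hX hnu] hb he.
have [a ax] := atlas_cover x.
have [P [z [_ _ _ /(_ ord0)]]] := principal_curvatures hX hnu hb he (chart_img_coord ax).
rewrite big_ord1 expr2 subrr sub0r normrN gtr0_norm//.
by lra.
Qed.

(** * Surfaces *)

Lemma smooth_on_local (R : realType) (n : nat) (V : normedModType R) (U : set 'rV[R]_n)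
    (f : 'rV[R]_n -> V) :
  (forall x, U x -> exists2 W : set 'rV[R]_n, W x & smooth_on W f) -> smooth_on U f.
Proof. by move=> H s x /H[W Wx]; apply. Qed.

Lemma inv_close (R : realType) (k K e : R) : 0 < k -> e <= k / 2 -> `|K - k| <= e ->
  k^-1 - 2 * e / k ^+ 2 <= K^-1 <= k^-1 + 2 * e / k ^+ 2.
Proof.
move=> k0 ek; rewrite ler_norml => /andP[h1 h2].
have K0 : k / 2 <= K by lra.
have Kp : 0 < K by lra.
have e0 : 0 <= e by lra.
have -> : 2 * e / k ^+ 2 = e / (k / 2 * k) by field; rewrite gt_eqF.
have -> : K^-1 = k^-1 + (k - K) / (K * k) by field; rewrite !gt_eqF.
have H : `|(k - K) / (K * k)| <= e / (k / 2 * k).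
  have Kk : 0 < K * k by rewrite mulr_gt0.
  rewrite normrM normfV (gtr0_norm Kk); apply: ler_pM => //.
  - by rewrite invr_ge0 ltW.
  - by rewrite ler_norml; apply/andP; split; lra.
  by rewrite lef_pV2 ?posrE ?mulr_gt0// ?divr_gt0// ler_pM2r.
by move: H; rewrite ler_norml => /andP[H1 H2]; rewrite lerD2l lerD2l H1 H2.
Qed.

(** Here s = |X - c| / r, q is r times the derivative of s along a unit vector u, and A = |dF(u)|^2.
    Then s is within t of 1 and q^2 <= t, so A is close to 1; the factor 8 is a crude bound. *)
Lemma pinched_speed (R : realType) (t s q A : R) : 0 <= t -> t <= 1 / 8 ->
  1 - t <= s -> s <= 1 + t -> q ^+ 2 * s ^+ 2 <= t ^+ 2 -> 1 = q ^+ 2 + s ^+ 2 * A ->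
  `|A - 1| <= 8 * t.
Proof.
move=> t0 t1 s1 s2 qs E.
have s0 : 0 < s by lra.
have ss : 0 < s ^+ 2 by rewrite exprn_gt0.
have q0 := sqr_ge0 q.
have tt : t ^+ 2 <= t / 8 by rewrite expr2 ler_wpM2l//; lra.
have tt0 := sqr_ge0 t.
have S1 : (1 - t) ^+ 2 <= s ^+ 2 by rewrite ler_pXn2r// nnegrE; lra.
have S2 : s ^+ 2 <= (1 + t) ^+ 2 by rewrite ler_pXn2r// nnegrE; lra.
have e1 : (1 - t) ^+ 2 = 1 - 2 * t + t ^+ 2 by ring.
have e2 : (1 + t) ^+ 2 = 1 + 2 * t + t ^+ 2 by ring.
move: S1 S2; rewrite e1 e2 => S1 S2.
have Q : q ^+ 2 <= t.
  have H : 1 / 2 <= s ^+ 2 by lra.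
  have : q ^+ 2 * (1 / 2) <= q ^+ 2 * s ^+ 2 by exact: ler_wpM2l.
  by lra.
have t8 : 0 <= 8 * t by lra.
rewrite ler_norml; apply/andP; split.
  rewrite -(ler_pM2l ss) mulrBr mulr1.
  have : 8 * t * s ^+ 2 >= 8 * t * (1 - 2 * t + t ^+ 2) by exact: ler_wpM2l.
  have : t * (t ^+ 2) >= 0 by rewrite mulr_ge0.
  have -> : 8 * t * (1 - 2 * t + t ^+ 2) = 8 * t - 16 * t ^+ 2 + 8 * (t * t ^+ 2) by ring.
  have -> : s ^+ 2 * - (8 * t) = - (8 * t * s ^+ 2) by ring.
  by lra.
rewrite -(ler_pM2l ss) mulrBr mulr1.
have : 8 * t * s ^+ 2 >= 8 * t * (1 - 2 * t + t ^+ 2) by exact: ler_wpM2l.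
have : t * (t ^+ 2) >= 0 by rewrite mulr_ge0.
have -> : 8 * t * (1 - 2 * t + t ^+ 2) = 8 * t - 16 * t ^+ 2 + 8 * (t * t ^+ 2) by ring.
have -> : s ^+ 2 * (8 * t) = 8 * t * s ^+ 2 by ring.
by lra.
Qed.

(** * Radial projection of an immersion uniformly close to a sphere *)

Section RadialProjection.
Context (R : realType) (n : nat) (M : manifold R n) (g : riem_metric M)
  (X nu : M -> 'rV[R]_n.+1) (r t s : R) (c : 'rV[R]_n.+1).
Hypotheses (hX : isometric_immersion g X) (hnu : unit_normal X nu).
Hypotheses (r0 : 0 < r) (t0 : 0 <= t) (t1 : t <= 1 / 8) (s1 : s ^+ 2 = 1).
Hypothesis near_sphere : forall x e, dot e e = 1 ->
  `|dot (s *: (X x - c) - r *: nu x) e| <= r * t.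

Let Z x := X x - c.
Let rho x := Num.sqrt (dot (Z x) (Z x)).
Let F x := radial r (Z x).

Let ZnE x : s * dot (Z x) (nu x) = r + dot (s *: Z x - r *: nu x) (nu x).
Proof. by have [_ n1 _] := hnu; rewrite (dotBl (s *: Z x)) !dotZl n1 mulr1 addrC subrK. Qed.

Let sZZ x : dot (s *: Z x) (s *: Z x) = rho x ^+ 2.
Proof. by rewrite dotZl dotZr mulrA -expr2 s1 mul1r sqr_sqrtr// dot_ge0. Qed.

Let rho_ge x : r * (1 - t) <= rho x.
Proof.
have [_ n1 _] := hnu.
rewrite -(ler_pXn2r (_ : 0 < 2)%N) ?nnegrE ?sqrtr_ge0//; last first.
  by rewrite mulr_ge0 ?(ltW r0)//; have := t1; lra.
rewrite -sZZ; apply: le_trans (_ : (s * dot (Z x) (nu x)) ^+ 2 <= _); last first.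
  by have := cauchy_schwarz (s *: Z x) (nu x); rewrite n1 mulr1 dotZl.
have H := near_sphere x (n1 x); move: H; rewrite ler_norml => /andP[H _].
have P : 0 <= r * (1 - t) by rewrite mulr_ge0 ?(ltW r0)//; have := t1; lra.
have Q : r * (1 - t) <= s * dot (Z x) (nu x).
  by rewrite ZnE mulrBr mulr1 lerD2l.
by rewrite ler_pXn2r// nnegrE//; exact: le_trans Q.
Qed.

Let rho_gt0 x : 0 < rho x.
Proof. by apply: lt_le_trans (rho_ge x); rewrite mulr_gt0//; have := t1; lra. Qed.

Let Z0 x : Z x != 0. Proof. by rewrite -dot_gt0 -sqrtr_gt0; exact: rho_gt0. Qed.

Let rho_le x : rho x <= r * (1 + t).
Proof.
have [_ n1 _] := hnu; have rp := rho_gt0 x.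
pose e := (rho x)^-1 *: (s *: Z x).
have ee : dot e e = 1.
  by rewrite dotZl dotZr sZZ expr2 mulKf ?gt_eqF// mulVf// gt_eqF.
have E : rho x = r * dot (nu x) e + dot (s *: Z x - r *: nu x) e.
  by rewrite (dotBl (s *: Z x)) (dotZl r) addrC subrK /e dotZr sZZ expr2 mulKf// gt_eqF.
have H := near_sphere x ee; move: H; rewrite ler_norml => /andP[_ H].
have ne : dot (nu x) e <= 1.
  have := cauchy_schwarz (nu x) e; rewrite n1 ee mulr1 => q.
  by rewrite -(sqrtr1 R) -(sqrtr1 R) (le_trans (ler_norm _))// -sqrtr_sqr ler_wsqrtr// sqrtr1.
have : r * dot (nu x) e <= r * 1 by rewrite ler_pM2l.
by rewrite {1}E mulrDr; move: H; lra.
Qed.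

Lemma radial_smooth : smooth_map F.
Proof.
have [sX _] := hX => a.
have oa := open_chart_img (chart_of a).
have sZ : smooth_on (chart_img (chart_of a)) (fun q => local_expr X a q - c).
  have sXa := sX a; apply/smooth_onP => k; have /smooth_onP/(_ k) cX := sXa.
  by have := CkD oa cX (Ck_cst k _ (- c)).
by apply: (smooth_on_comp oa (@open_neq0 R n.+1) _ (@smooth_radial R n.+1 r) sZ) => q _; exact: Z0.
Qed.

Lemma radial_sphere x : dot (F x) (F x) = r ^+ 2.
Proof. exact: dot_radial. Qed.

Lemma radial_almost_isometry : almost_isometry g (8 * t) F.
Proof.
have [sX HX] := hX; have [sn n1 Xn] := hnu.
move=> a p u ap uu; have [fJ gE] := HX a p ap.
set x := chart_param (chart_of a) p.
have oa := open_chart_img (chart_of a).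
have dX : differentiable (local_expr X a) p := smooth_on_diff (sX a) ap.
have sF : smooth_map F := radial_smooth.
have dF : differentiable (local_expr F a) p := smooth_on_diff (sF a) ap.
pose Zl q := local_expr X a q - c.
have dZ : differentiable Zl p by apply: differentiableB => //; exact: differentiable_cst.
(* This is |X - c| / r, written as a dot product so that its differentiability follows from that of
   [X] and [F]. *)
pose sg q := dot (Zl q) (local_expr F a q) / r ^+ 2.
have ZF y : Z y = (rho y / r) *: F y.
  rewrite /F /radial scalerA -/(rho y) (_ : _ * _ = 1) ?scale1r//.
  by field; rewrite !gt_eqF.
have sgE q : sg q = rho (chart_param (chart_of a) q) / r.
  rewrite /sg /Zl /local_expr /= -/(Z _) ZF dotZl radial_sphere.
  by rewrite mulfK// expf_neq0// gt_eqF.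
have ZE : Zl = (fun q => sg q *: local_expr F a q).
  by apply/funext => q; rewrite sgE /Zl /local_expr /= -/(Z _) ZF.
have dsg : differentiable sg p.
  have cX := (smooth_onP _ _).1 (sX a) 0; have cF := (smooth_onP _ _).1 (sF a) 0.
  have cZ : Ck 0 (chart_img (chart_of a)) Zl by have := CkD oa cX (Ck_cst 0 _ (- c)).
  have cd := Ck_dot oa cZ cF.
  exact: (Ck_diff (CkM oa cd (Ck_cst 0 _ (r ^+ 2)^-1)) ap).
pose w := u *m diff_mx X a p; pose v := u *m diff_mx F a p.
suff : `|dot v v - 1| <= 8 * t by [].
have [al wE] : exists al : R, w = al *: F x + sg p *: v.
  exists (\sum_i u 0 i * partial i sg p).
  have Ew : w = \sum_i u 0 i *: partial i (local_expr X a) p := row_unit_jacobian u dX.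
  have Ev : v = \sum_i u 0 i *: partial i (local_expr F a) p := row_unit_jacobian u dF.
  rewrite Ew Ev.
  rewrite scaler_suml scaler_sumr -big_split /=; apply: eq_bigr => i _.
  have E1 : partial i Zl p = partial i (local_expr X a) p.
    apply: (etrans (partialB i dX (differentiable_cst c p))).
    by rewrite partial_cst subr0.
  have E2 : partial i Zl p = partial i sg p *: F x + sg p *: partial i (local_expr F a) p.
    exact: (etrans (congr1 (fun h => partial i h p) ZE) (partial_scale i dsg dF).2).
  by rewrite -E1 E2 scalerDr !scalerA (mulrC (sg p)).
have ww : dot w w = 1.
  by rewrite /w -uu gE dot_mulmxl mulmxA dotC.
have vF : dot v (F x) = 0.
  have J0 : diff_mx F a p *m (F x)^T = 0.
    by apply: (@jacobian_dot_cst _ _ _ (local_expr F a) p (r ^+ 2) dF); apply: filterE => q; exact: radial_sphere.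
  by rewrite /v /dot -mulmxA J0 mulmx0 mxE.
have wn : dot w (nu x) = 0 by rewrite /w /dot -mulmxA (Xn a p ap) mulmx0 mxE.
clearbody w v.
have wF : dot w (F x) = al * r ^+ 2.
  by rewrite wE dotDl (dotZl al) (dotZl (sg p)) radial_sphere vF mulr0 addr0.
have wv : dot w v = sg p * dot v v.
  by rewrite wE dotDl (dotZl al) (dotZl (sg p)) (dotC (F x)) vF mulr0 add0r.
(* X - c = sg F and |F| is constant, so |dX u|^2 is the sum of (d sg u)^2 r^2
   and sg^2 |dF u|^2. *)
have N1 : 1 = (al * r) ^+ 2 + sg p ^+ 2 * dot v v.
  have E0 : dot w w = dot w (al *: F x + sg p *: v) := congr1 (dot w) wE.
  apply: (etrans (esym ww)); apply: (etrans E0).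
  rewrite (dotDr (al *: F x) (sg p *: v) w) (dotZr al w (F x)) (dotZr (sg p) w v) wF wv.
  by move: (dot v v) (sg p) => A B; ring.
have sr : sg p = rho x / r by exact: sgE.
apply: (@pinched_speed R t (sg p) (al * r)) => //.
- by rewrite sr ler_pdivlMr// mulrC; exact: rho_ge.
- by rewrite sr ler_pdivrMr// mulrC; exact: rho_le.
rewrite -exprMn.
(* As [w] is tangent, the [nu] term vanishes, and closeness of positions alone bounds the radial
   part of [w]. *)
have H := near_sphere x ww.
have E : dot (s *: (X x - c) - r *: nu x) w = s * (al * r * sg p) * r.
  rewrite dotC dotBr !dotZr wn mulr0 subr0 -/(Z x) ZF dotZr wF -sr; ring.
move: H; rewrite E normrM (gtr0_norm r0) mulrC ler_pM2l// => H.
rewrite -[leLHS]mul1r -s1 -exprMn -[leLHS]ger0_norm ?sqr_ge0// normrX ler_pXn2r// nnegrE//.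
Qed.
End RadialProjection.

(** * Parametrization of a surface by its unit normal *)

Section Support.
Context (R : realType) (M : manifold R 2) (g : riem_metric M)
  (X nu : M -> 'rV[R]_3) (k b e : R).
Hypotheses (k0 : 0 < k) (ek : e <= k / 2).
Hypothesis hyp : closed_hypersurface g X nu.
Hypotheses (hb : sup_norm g (second_form X nu) = b%:E) (he : (einstein_defect g k <= e%:E)%E).

Let hX : isometric_immersion g X. Proof. by case: hyp. Qed.
Let hnu : unit_normal X nu. Proof. by case: hyp. Qed.

Lemma surface_curvatures (a : atlas M) (p : 'rV[R]_2) : chart_img (chart_of a) p ->
  exists (P : 'M[R]_2) (x : 'rV[R]_2),
  [/\ P *m g a p *m P^T = 1%:M, P *m second_form X nu a p *m P^T = diag_mx x,
      (forall i, `|x 0 i| <= b) & `|x 0 0 * x 0 1 - k| <= e].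
Proof.
move=> ap; have [P [x [PG PB xb xe]]] := principal_curvatures hX hnu hb he ap.
exists P, x; split=> //; have := xe 0.
rewrite !big_ord_recl big_ord0 addr0.
have -> : lift ord0 ord0 = (1 : 'I_2) by exact: val_inj.
by rewrite (_ : _ - _ - _ = x 0 0 * x 0 1 - k); last by ring.
Qed.

Lemma gauss_map_immersion (a : atlas M) (p : 'rV[R]_2) : chart_img (chart_of a) p ->
  row_free (diff_mx nu a p).
Proof.
move=> ap; have [P [x [PG PB _ xe]]] := surface_curvatures ap.
have [_ HX] := hX; have [fJ _] := HX a p ap.
have x0 : x 0 0 * x 0 1 != 0.
  apply/eqP => h; move: xe; rewrite h sub0r normrN gtr0_norm//.
  by have := ek; have := k0; lra.
have uB : second_form X nu a p \in unitmx.
  have : P *m second_form X nu a p *m P^T \in unitmx.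
    rewrite PB unitmxE det_diag unitfE !big_ord_recl big_ord0 mulr1.
    by have -> : lift ord0 ord0 = (1 : 'I_2) by exact: val_inj.
  by rewrite !unitmx_mul => /andP[/andP[]].
rewrite (weingarten hX hnu ap) /row_free mxrankMfree// mxrank_unit//.
by rewrite unitmx_mul uB unitmx_inv (gram_unit hX hnu ap).
Qed.

Lemma gauss_map_diffeo : diffeo_onto (@sphere R 2 1) nu.
Proof.
have [cM [kM M0] _ _ _] := hyp; have [sn n1 _] := hnu.
apply: sphere_immersion_diffeo => //; last exact: gauss_map_immersion.
by move=> x; rewrite n1 expr1n.
Qed.

(** [X] is composed with the inverse of the Gauss map and with the radial projection. The extension
    is defined on an open subset of R^3, where it has an ordinary Jacobian. *)
Lemma support_map : exists U : 'rV[R]_3 -> 'rV[R]_3,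
  [/\ smooth_on [set z : 'rV[R]_3 | z != 0] U,
      (forall x, U (nu x) = X x),
      (forall z (t : R), 0 < t -> U (t *: z) = U z) &
      (forall y, dot y y = 1 -> exists x, nu x = y)].
Proof.
have [sn nS [G [GF FG loc]]] := gauss_map_diffeo; have [sX _] := hX.
have [_ n1 _] := hnu.
have S1 (y : 'rV[R]_3) : dot y y = 1 -> sphere 1 y by rewrite /sphere /= expr1n.
have rS (z : 'rV[R]_3) : z != 0 -> sphere 1 (radial 1 z).
  by move=> z0; rewrite /sphere /= dot_radial.
exists (fun z => X (G (radial 1 z))); split.
- apply: smooth_on_local => z z0.
  have [a [W [h [oW Wz sh hG]]]] := loc _ (rS z z0).
  pose V := [set z : 'rV[R]_3 | z != 0 /\ W (radial 1 z)].
  have oV : open V.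
    rewrite openE => t [t0 Wt]; apply: filterI.
      exact: (open_nbhs_nbhs (conj (@open_neq0 R 3) t0)).
    exact: (radial_continuous t0 (open_nbhs_nbhs (conj oW Wt))).
  exists V => //.
  pose W' := [set y : 'rV[R]_3 | W y /\ chart_img (chart_of a) (h y)].
  have hV t : V t -> h (radial 1 t) = chart_coord (chart_of a) (G (radial 1 t)) /\
      chart_dom (chart_of a) (G (radial 1 t)).
    by move=> [t0 Wt]; have [] := hG _ Wt (rS t t0).
  have oa := open_chart_img (chart_of a).
  have sr : smooth_on V (radial 1) by apply: smooth_onW (@smooth_radial R 3 1) => t [].
  have shr : smooth_on V (fun t => h (radial 1 t)).
    by apply: (smooth_on_comp oV oW _ sh sr) => t [].
  apply: (smooth_on_ext oV _ (smooth_on_comp oV oa _ (sX a) shr)) => t Vt /=.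
    have [E1 E2] := hV t Vt.
    by rewrite /local_expr /= E1 chart_coordK.
  by have [-> E2] := hV t Vt; exact: chart_img_coord.
- by move=> x; rewrite (radial_id ltr01) ?GF// n1 expr1n.
- move=> z t t0; congr (X (G _)).
  rewrite /radial dotZl dotZr mulrA -expr2 sqrtrM ?sqr_ge0// sqrtr_sqr gtr0_norm//.
  rewrite scalerA; congr (_ *: z); rewrite !mul1r invfM mulrAC mulVf ?mul1r//.
  by rewrite gt_eqF.
by move=> y /S1 yS; exists (G y); exact: FG.
Qed.

(** Euler's relation in degree zero: the map is constant along the ray through [y]. *)
Lemma homogeneous_jacobian (m n : nat) (U : 'rV[R]_m -> 'rV[R]_n) (y : 'rV[R]_m) :
  differentiable U y -> (forall t : R, 0 < t -> U (t *: y) = U y) -> y *m jacobian U y = 0.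
Proof.
move=> dU hU; rewrite -deriveEjacobian//.
rewrite /derive; apply: cvg_lim => //; apply: cvg_near_cst.
have : \forall h \near (0 : R)^', - 1 < h by apply: nbhs_dnbhs; apply: lt_nbhsr; rewrite ltrN10.
apply: filterS => h h1 /=.
have -> : h *: y + y = (1 + h) *: y by rewrite addrC scalerDl scale1r.
by rewrite hU ?subrr ?scaler0// addrC -ltrBlDr sub0r.
Qed.

Section SupportJacobian.
Variable U : 'rV[R]_3 -> 'rV[R]_3.
Hypotheses (sU : smooth_on [set z : 'rV[R]_3 | z != 0] U).
Hypotheses (Unu : forall x, U (nu x) = X x).
Hypotheses (Uhom : forall z (t : R), 0 < t -> U (t *: z) = U z).

Lemma support_jacobian (z : M) (L := jacobian U (nu z)) :
  exists x : 'rV[R]_2, [/\ (forall i, `|x 0 i| <= b), `|x 0 0 * x 0 1 - k| <= e,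
   (L^T = L /\ nu z *m L = 0), \tr L = (x 0 0)^-1 + (x 0 1)^-1 &
   (\tr L ^+ 2 - \tr (L *m L)) / 2 = (x 0 0 * x 0 1)^-1].
Proof.
have [sn n1 Xn] := hnu; have [sX HX] := hX.
have [a az] := atlas_cover z; pose q := chart_coord (chart_of a) z.
have aq : chart_img (chart_of a) q by exact: chart_img_coord.
have qz : chart_param (chart_of a) q = z by exact: chart_coordK.
have y0 : nu z != 0 := dot1_neq0 (n1 z).
have dU : differentiable U (nu z) := smooth_on_diff sU y0.
have [P [x [PG PB xb xe]]] := surface_curvatures aq.
have [iG _] := form_norm_diag PG PB.
have [fJ gE] := HX a q aq.
exists x.
have xx : 0 < x 0 0 * x 0 1.
  by move: xe; rewrite ler_norml => /andP[h _]; have := ek; have := k0; lra.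
have /andP[x0 x1] : (x 0 0 != 0) && (x 0 1 != 0) by rewrite -negb_or -mulf_eq0 gt_eqF.
have yL : nu z *m L = 0 by apply: homogeneous_jacobian => // t t0; exact: Uhom.
have DL : diff_mx nu a q *m L = diff_mx X a q.
  have dn : differentiable (local_expr nu a) q := smooth_on_diff (sn a) aq.
  have nq : local_expr nu a q = nu z by rewrite /local_expr /= qz.
  have dU' : differentiable U (local_expr nu a q) by rewrite nq.
  rewrite /L -nq; apply: (etrans (esym (jacobian_comp dn dU'))).
  by congr (jacobian _ q); apply/funext => t; exact: Unu.
(* In the principal frame the differentials of X and nu are E and diag(x) E, so
   that jacobian U inverts the shape operator. *)
pose E := P *m diff_mx X a q.
have EE : E *m E^T = 1%:M by rewrite /E trmx_mul mulmxA -(mulmxA P) -gE.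
have Ey : E *m (nu z)^T = 0.
  by rewrite /E -mulmxA -[nu z](congr1 nu qz) (Xn a q aq) mulmx0.
have fE : row_free E.
  apply/row_freeP; exists E^T; exact: EE.
have [_ pr _] := hypersurface_frame_unit fE (n1 z) Ey.
have PD : P *m diff_mx nu a q = diag_mx x *m E.
  by rewrite (weingarten hX hnu aq) iG -PB /E !mulmxA.
pose xi : 'rV[R]_2 := \row_i (x 0 i)^-1.
have EL : E *m L = diag_mx xi *m E.
  have E1 : diag_mx x *m (E *m L) = E by rewrite mulmxA -PD -mulmxA DL.
  rewrite -[RHS](congr1 (mulmx (diag_mx xi)) E1) mulmxA mulmx_diag.
  rewrite (_ : diag_mx _ = 1%:M) ?mul1mx//; apply/matrixP => i j; rewrite !mxE.
  by case: (ord2P i) => ->; rewrite mulVf.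
have LE : L = E^T *m diag_mx xi *m E.
  have invmx1' : invmx (1%:M : 'M[R]_2) = 1%:M by exact: invmx1.
  have pr' : E^T *m E + (nu z)^T *m nu z = 1%:M by rewrite -pr EE invmx1' mulmx1.
  transitivity ((E^T *m E + (nu z)^T *m nu z) *m L); first by rewrite pr' mul1mx.
  rewrite mulmxDl -(mulmxA _ (nu z) L) yL mulmx0 addr0 -(mulmxA _ E L) EL.
  by rewrite mulmxA.
have sum2 (f : 'I_2 -> R) : \sum_i f i = f 0 + f 1.
  rewrite !big_ord_recl big_ord0 addr0.
  by have -> : lift ord0 ord0 = (1 : 'I_2) by exact: val_inj.
have trL : \tr L = (x 0 0)^-1 + (x 0 1)^-1.
  by rewrite LE mxtrace_mulC mulmxA EE mul1mx mxtrace_diag sum2 !mxE.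
have trLL : \tr (L *m L) = (x 0 0)^-1 ^+ 2 + (x 0 1)^-1 ^+ 2.
  rewrite {1}LE -(mulmxA _ E L) EL mxtrace_mulC mulmxA -(mulmxA _ E E^T) EE mulmx1.
  rewrite mulmx_diag.
  by rewrite mxtrace_diag sum2 !mxE !expr2.
split; [exact: xb|exact: xe| |exact: trL|].
  by split; [rewrite LE (trmx_mul _ E) (trmx_mul E^T) trmxK tr_diag_mx mulmxA|].
by rewrite trL trLL; field; rewrite x0 x1.
Qed.
End SupportJacobian.
End Support.

Section Rigidity.
Context (R : realType) (M : manifold R 2) (g : riem_metric M)
  (X nu : M -> 'rV[R]_3) (k b e : R).
Hypotheses (k0 : 0 < k) (ek : e <= k / 2).
Hypothesis hyp : closed_hypersurface g X nu.
Hypotheses (hb : sup_norm g (second_form X nu) = b%:E) (he : (einstein_defect g k <= e%:E)%E).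

(** The trace is a continuous function without zeros on a connected space. *)
Lemma support_trace_sign (U : 'rV[R]_3 -> 'rV[R]_3) :
  smooth_on [set z : 'rV[R]_3 | z != 0] U ->
  (forall z, \tr (jacobian U (nu z)) != 0) ->
  exists2 s : R, s ^+ 2 = 1 & forall z, 0 < s * \tr (jacobian U (nu z)).
Proof.
move=> sU T0; have [cM [kM [z0 _]] _ _ hnu] := hyp; have [sn n1 _] := hnu.
have nz z : nu z != 0 := dot1_neq0 (n1 z).
pose T z := \tr (jacobian U (nu z)).
have cT : continuous T.
  move=> z; apply: (@continuous_comp _ _ _ nu (fun y => \tr (jacobian U y))).
    exact: smooth_map_continuous.
  apply: differentiable_continuous.
  have dJ : differentiable (jacobian U) (nu z).
    exact: smooth_on_diff (smooth_on_jacobian (@open_neq0 R 3) sU) (nz z).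
  have dJi i := (differentiable_mxP _ _).1 dJ i i.
  have -> : (fun y => \tr (jacobian U y)) =
      (fun y => jacobian U y o0 o0 + jacobian U y o1 o1 + jacobian U y o2 o2).
    by apply/funext => y; rewrite /mxtrace sum3.
  by apply: differentiableD; [apply: differentiableD|]; exact: dJi.
have sign (s : R) (w : M) : 0 < s * T w -> s ^+ 2 = 1 -> forall z, 0 < s * T z.
  move=> sw s1.
  have csT : continuous (fun z => s * T z) by move=> z; apply: cvgMr; exact: cT.
  have P := @connected_clopen M setT (fun z => 0 < s * T z) kM.
  move=> z; apply: (P _ _ _ z I).
  - move=> x _ Px; have H : \forall y \near x, 0 < s * T y := csT x _ (lt_nbhsr Px).
    by apply: filterS H.
  - move=> x _ Px; have sx : s * T x < 0.
      have s0 : s != 0.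
        by apply/eqP => h; move/eqP: s1; rewrite h expr0n /= eq_sym oner_eq0.
      have sTx : s * T x != 0 := mulf_neq0 s0 (T0 x).
      by rewrite lt_neqAle sTx leNgt; exact/negP.
    have H : \forall y \near x, s * T y < 0 := csT x _ (lt_nbhsl sx).
    by apply: filterS H => y Hy _; apply/negP; rewrite -leNgt ltW.
  by exists w.
have [h|h] := ltP 0 (T z0).
  by exists 1; [rewrite expr1n|apply: (sign _ z0); rewrite ?mul1r// expr1n].
have h1 : (-1 : R) ^+ 2 = 1 by rewrite sqrrN expr1n.
exists (-1) => //; apply: (sign _ z0) => //.
have Tz : T z0 != 0 := T0 z0.
by rewrite mulN1r oppr_gt0 lt_neqAle Tz.
Qed.

Lemma almost_round_support (r eta : R) : r ^+ 2 = k^-1 -> 2 * e / k ^+ 2 <= eta ->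
  exists (U : 'rV[R]_3 -> 'rV[R]_3) (s : R),
  [/\ s ^+ 2 = 1, (forall x, U (nu x) = s *: X x) & almost_round r (4 * `|b| / k + 1) eta U].
Proof.
move=> rk hk.
have [U [sU Unu Uhom Usurj]] := support_map k0 ek hyp hb he.
have J z := support_jacobian k0 ek hyp hb he sU Unu Uhom z.
have T0 z : \tr (jacobian U (nu z)) != 0.
  have [x [_ xe _ -> _]] := J z.
  have xx : 0 < x 0 0 * x 0 1.
    by move: xe; rewrite ler_norml => /andP[h _]; have := ek; have := k0; lra.
  have /andP[x0 x1] : (x 0 0 != 0) && (x 0 1 != 0) by rewrite -negb_or -mulf_eq0 gt_eqF.
  (* A zero trace would make the curvatures opposite and their product nonpositive. *)
  apply/eqP => h; have : x 0 0 + x 0 1 = 0.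
    have -> : x 0 0 + x 0 1 = (x 0 0 * x 0 1) * ((x 0 0)^-1 + (x 0 1)^-1) by field; rewrite x0 x1.
    by rewrite h mulr0.
  move/eqP; rewrite addr_eq0 => /eqP h'; move: xx; rewrite h' mulNr -expr2 oppr_gt0.
  by rewrite ltNge sqr_ge0.
have [s s1 sT] := support_trace_sign sU T0.
have [_ _ _ _ [sn n1 _]] := hyp.
exists (fun z => s *: U z), s; split=> //; first by move=> x; rewrite Unu.
split.
  apply/smooth_onP => l; have cU := (smooth_onP _ _).1 sU l.
  exact: (Ck_scalemx (@open_neq0 R 3) (Ck_cst l _ s) cU).
move=> y yy; have [z zy] := Usurj y yy.
have y0 := dot1_neq0 yy.
have dU : differentiable U y := smooth_on_diff sU y0.
have [x [xb xe [sL yL] tL e2]] := J z; have st := sT z.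
move: sL yL tL e2 st; rewrite zy => sL yL tL e2 st /=.
rewrite (jacobian_scale s dU).
move: (jacobian U y) sL yL tL e2 st => L sL yL tL e2 st.
have E : s *: L *m (s *: L) = L *m L.
  by rewrite -scalemxAl -scalemxAr scalerA -expr2 s1 scale1r.
rewrite E mxtraceZ exprMn s1 mul1r e2.
have Kk : x 0 0 * x 0 1 - k >= - e /\ x 0 0 * x 0 1 >= k / 2.
  by move: xe; rewrite ler_norml => /andP[h _]; have := ek; have := k0; split; lra.
split.
- by rewrite linearZ /= sL.
- by rewrite -scalemxAr yL scaler0.
- rewrite st /=.
  have xx : 0 < x 0 0 * x 0 1 by have := k0; lra.
  have /andP[x0 x1] : (x 0 0 != 0) && (x 0 1 != 0) by rewrite -negb_or -mulf_eq0 gt_eqF.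
  have s1' : `|s| = 1 by rewrite -sqrtr_sqr s1 sqrtr1.
  apply: le_trans (ler_norm _) _; rewrite normrM s1' mul1r tL.
  have -> : (x 0 0)^-1 + (x 0 1)^-1 = (x 0 0 + x 0 1) / (x 0 0 * x 0 1) by field; rewrite x0 x1.
  have -> : 4 * `|b| / k = 2 * `|b| / (k / 2) by field; rewrite gt_eqF.
  apply: (@le_trans _ _ (2 * `|b| / (k / 2))); last by rewrite lerDl.
  rewrite normrM normfV (gtr0_norm xx); apply: ler_pM => //.
    by rewrite invr_ge0 ltW.
    apply: le_trans (ler_normD _ _) _.
    by have := xb 0; have := xb 1; have := ler_norm b; lra.
  by rewrite lef_pV2 ?posrE ?divr_gt0//; case: Kk.
have /andP[i1 i2] := inv_close k0 ek xe.
by rewrite rk; apply/andP; split; have := hk; lra.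
Qed.

End Rigidity.

Lemma pinched_surface (R : realType) (k b theta : R) : 0 < k -> 0 < theta -> theta < 1 ->
  exists2 e : R, 0 < e &
  forall (M : manifold R 2) (g : riem_metric M) (X nu : M -> 'rV[R]_3),
    closed_hypersurface g X nu -> sup_norm g (second_form X nu) = b%:E ->
    (einstein_defect g k <= e%:E)%E ->
    exists2 F : M -> 'rV[R]_3,
      diffeo_onto (@sphere R 2 (Num.sqrt ((2 - 1) / k))) F & almost_isometry g theta F.
Proof.
move=> k0 th0 th1; set r := Num.sqrt _.
have rk : r ^+ 2 = k^-1.
  have E : (2 - 1) / k = k^-1 by rewrite (_ : 2 - 1 = 1 :> R) ?mul1r//; ring.
  by rewrite /r E sqr_sqrtr// invr_ge0 ltW.
have r0 : 0 < r.
  have : r != 0 by apply/eqP => h; move: rk; rewrite h expr0n => /eqP; rewrite eq_sym invr_eq0 gt_eqF.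
  by move=> h; rewrite lt_neqAle eq_sym h sqrtr_ge0.
pose C := 4 * `|b| / k + 1.
have C0 : 0 < C by rewrite ltr_wpDl// divr_ge0 ?(ltW k0)// mulr_ge0.
(* [radial_almost_isometry] loses a factor 8. *)
pose t := theta / 8.
have t0 : 0 < t by rewrite divr_gt0.
have [eta eta0 rigid] := almost_round_rigid r0 C0 (mulr_gt0 r0 t0).
pose e := Num.min (k / 2) (eta * k ^+ 2 / 2).
have e0 : 0 < e by rewrite lt_min !divr_gt0// mulr_gt0// exprn_gt0.
have ek : e <= k / 2 by rewrite /e ge_min lexx.
have he2 : 2 * e / k ^+ 2 <= eta.
  have h : e <= eta * k ^+ 2 / 2 by rewrite /e ge_min lexx orbT.
  by rewrite ler_pdivrMr ?exprn_gt0//; lra.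
exists e => // M g X nu hyp hb he.
have [U [s [s1 UX hU]]] := almost_round_support k0 ek hyp hb he rk he2.
have [cM [kM [z0 _]] _ hX hnu] := hyp; have [sn n1 _] := hnu.
(* This centre makes s (X - c) - r nu vanish at [z0]; [rigid] bounds it elsewhere, used with - u for
   the lower bound. *)
pose c := s *: (U (nu z0) - r *: nu z0).
have near_sphere x u : dot u u = 1 -> `|dot (s *: (X x - c) - r *: nu x) u| <= r * t.
  move=> uu.
  have -> : s *: (X x - c) - r *: nu x = U (nu x) - r *: nu x - (U (nu z0) - r *: nu z0).
    rewrite scalerBr -UX /c scalerA -expr2 s1 scale1r.
    by rewrite addrAC.
  rewrite ler_norml (rigid _ _ _ _ hU)// andbT.
  have := rigid U (nu z0) (nu x) (- u) hU (n1 z0) (n1 x); rewrite dotNl dotNr opprK => /(_ uu).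
  by rewrite dotNr lerNl.
have t8 : t <= 1 / 8 by rewrite /t; lra.
have tE : 8 * t = theta by rewrite /t; field.
have iso := radial_almost_isometry hX hnu r0 (ltW t0) t8 s1 near_sphere.
have sF := radial_smooth hX hnu r0 t8 s1 near_sphere.
have SF := radial_sphere hnu r0 t8 s1 near_sphere.
rewrite tE in iso.
exists (fun x => radial r (X x - c)) => //.
apply: (sphere_immersion_diffeo _ r0 sF SF _ cM kM) => //; last by exists z0.
exact: almost_isometry_row_free th1 iso.
Qed.

Theorem corollary2 (R : realType) (n : nat) (k b : R) (hn : (0 < n)%N)
    (hk : 0 < k) :
  (exists2 eps : R, 0 < eps &
     forall (M : manifold R n) (g : riem_metric M) (X nu : M -> 'rV[R]_n.+1),
       closed_hypersurface g X nu ->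
       sup_norm g (second_form X nu) = b%:E ->
       (einstein_defect g k <= eps%:E)%E ->
       exists F : M -> 'rV[R]_n.+1,
         diffeo_onto (@sphere R n (Num.sqrt ((n%:R - 1) / k))) F) /\
  (forall theta : R, 0 < theta -> theta < 1 ->
     exists2 eps_theta : R, 0 < eps_theta &
       forall (M : manifold R n) (g : riem_metric M) (X nu : M -> 'rV[R]_n.+1),
         closed_hypersurface g X nu ->
         sup_norm g (second_form X nu) = b%:E ->
         (einstein_defect g k <= eps_theta%:E)%E ->
         exists2 F : M -> 'rV[R]_n.+1,
           diffeo_onto (@sphere R n (Num.sqrt ((n%:R - 1) / k))) F &
           almost_isometry g theta F).
Proof.
set part2 := (X in _ /\ X).
suff H2 : part2.
  (* Any theta in ]0, 1[ would do for the first half. *)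
  split=> //; have h0 : (0 : R) < 1 / 2 by rewrite divr_gt0.
  have h1 : (1 / 2 : R) < 1 by lra.
  have [eps eps0 H] := H2 _ h0 h1.
  by exists eps => // M g X nu h hb he; have [F HF _] := H M g X nu h hb he; exists F.
rewrite {}/part2 => theta th0 th1; case: n hn => [//|[|[|n]]] _.
- exists (k / 2); first by rewrite divr_gt0.
  by move=> M g X nu h hb he; case: (curve_not_almost_einstein hk h hb he).
- exact: pinched_surface.
exact: pinched_hypersurface.
Qed.
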